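(* Let $E$ be a polarized complex variation of Hodge structure on the punctured disk $\Delta^{*}$, with Hodge metric $h$, space of multi-valued flat sections $V$ and monodromy operator $T\in\mathrm{GL}(V)$. If $v\in V$ is a nonzero multi-valued flat section with $Tv=\lambda v$ for some $\lambda\in\mathbb{C}$, then the function $\varphi_v=\log h(v,v)$ on $\mathbb{H}=\{z\in\mathbb{C}:\operatorname{Re}z<0\}$ remains bounded from above as $|\operatorname{Re}z|\to\infty$.
   Context: A polarized (complex) variation of Hodge structure of weight $n$ on a complex manifold $X$ is a smooth complex vector bundle $E$ (of finite rank) with a decomposition $E=\bigoplus_{p+q=n}E^{p,q}$ into smooth subbundles, a flat connection $d$ mapping $A^0(X,E^{p,q})$ into $A^{1,0}(X,E^{p,q})\oplus A^{1,0}(X,E^{p-1,q+1})\oplus A^{0,1}(X,E^{p,q})\oplus A^{0,1}(X,E^{p+1,q-1})$, and a $d$-flat hermitian pairing $Q$ on $E$ for which the $E^{p,q}$ are mutually orthogonal and such that $h(v,w)=\sum_{p+q=n}(-1)^qQ(v^{p,q},w^{p,q})$ is a smooth hermitian (positive definite) metric on $E$, called the Hodge metric. $\Delta^{*}=\{0<|t|<1\}$, with universal covering $\exp:\mathbb{H}\to\Delta^{*}$. $V$ is the space of $d$-flat sections of $\exp^{*}E$ on $\mathbb{H}$; for $v\in V$, $h(v,v)$ is a smooth function on $\mathbb{H}$. $T\in\mathrm{GL}(V)$ is defined by $(Tv)(z)=v(z-2\pi i)$. *)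

(* Defs.v *)
From HB Require Import structures.
From mathcomp Require Import all_boot all_order all_algebra.
From mathcomp Require Import all_classical all_reals all_analysis.
From mathcomp Require Import complex.
Set Implicit Arguments.
Unset Strict Implicit.
Unset Printing Implicit Defensive.
Import Order.TTheory GRing.Theory Num.Theory numFieldNormedType.Exports.
Local Open Scope classical_set_scope.
Local Open Scope ring_scope.
Local Open Scope complex_scope.

(* Complex numbers are R[i] with R : realType; R[i]^o is the same type, on
   which the library puts the topology of the norm. *)

Section SmoothFunctions.
Variable R : realType.
Implicit Types (v z : R[i]) (f : R[i] -> R[i]).

(* Real directional derivatives: v = 1 is d/dx and v = 'i is d/dy. *)
Definition slice v f z (t : R) : R[i] := f (z + t%:C * v).

Definition has_partial v f z : Prop :=
  derivable (fun t => complex.Re (slice v f z t)) 0 1 /\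
  derivable (fun t => complex.Im (slice v f z t)) 0 1.

Definition partial v f z : R[i] :=
  derive1 (fun t => complex.Re (slice v f z t)) 0 +i*
  derive1 (fun t => complex.Im (slice v f z t)) 0.

Fixpoint Ck (k : nat) (U : set R[i]^o) f : Prop :=
  (forall z, U z -> {for z, continuous (f : R[i]^o -> R[i]^o)}) /\
  if k is k'.+1 then
    [/\ forall z, U z -> has_partial 1 f z /\ has_partial 'i%C f z,
        Ck k' U (partial 1 f) & Ck k' U (partial 'i%C f)]
  else True.

Definition smooth_at f z : Prop :=
  exists U : set R[i]^o, [/\ open U, U z & forall k, Ck k U f].

(* The Wirtinger derivatives: df = (del f) dz + (delbar f) dzbar. *)
Definition del f z : R[i] := (partial 1 f z - 'i%C * partial 'i%C f z) / 2.
Definition delbar f z : R[i] := (partial 1 f z + 'i%C * partial 'i%C f z) / 2.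

End SmoothFunctions.

(* A complex vector bundle of rank rk on an open subset of R[i], given by its
   fibers and an atlas of local frames.  The atlas is indexed by points: the
   frame attached to p is defined over the neighbourhood chart_dom p of p.
   Everything is total, and only the values over the base are meaningful. *)
Record bundle (R : realType) := Bundle {
  rk : nat;
  fiber :> R[i] -> vectType R[i];
  chart_dom : R[i] -> set R[i]^o;
  frame : forall p x : R[i], rk.-tuple (fiber x)
}.

Section Bundles.
Variables (R : realType) (E : bundle R).

Definition section_of : Type := forall x : R[i], E x.

Definition frame_section (p : R[i]) (k : 'I_(rk E)) : section_of :=
  fun x => tnth (frame E p x) k.

Definition frame_coord (p : R[i]) (k : 'I_(rk E)) (s : section_of) (x : R[i]) :
  R[i] := coord (frame E p x) k (s x).

Definition section_smooth_at (s : section_of) (x : R[i]) : Prop :=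
  forall k, smooth_at (frame_coord x k s) x.

Definition smooth_bundle (X : set R[i]^o) : Prop :=
  [/\ forall p, X p -> [/\ open (chart_dom E p), chart_dom E p p,
        chart_dom E p `<=` X &
        forall x, chart_dom E p x -> basis_of fullv (frame E p x)]
    & forall p q x, X p -> X q -> chart_dom E p x -> chart_dom E q x ->
        forall j k, smooth_at (frame_coord p k (frame_section q j)) x].

Definition smooth_subbundle (X : set R[i]^o) (F : forall x, {vspace E x}) :
  Prop :=
  forall x, X x -> exists (m : nat) (e : 'I_m -> section_of),
    (forall i, section_smooth_at (e i) x) /\
    \forall y \near (x : R[i]^o), basis_of (F y) [tuple e i y | i < m].

(* A connection d s = (nabla s) dz + (nablabar s) dzbar.  It acts on local
   sections: its value at x only depends on the germ of the section at x. *)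
Record connection := Connection {
  nabla : section_of -> section_of;
  nablabar : section_of -> section_of
}.

Definition is_derivation (X : set R[i]^o)
    (delta : (R[i] -> R[i]) -> R[i] -> R[i]) (D : section_of -> section_of) :
  Prop :=
  forall x, X x -> forall s t : section_of,
    section_smooth_at s x -> section_smooth_at t x ->
  [/\ section_smooth_at (D s) x,
      (\forall y \near (x : R[i]^o), s y = t y) -> D s x = D t x,
      D (fun y => s y + t y) x = D s x + D t x
    & forall f : R[i] -> R[i], smooth_at f x ->
        D (fun y => f y *: s y) x = delta f x *: s x + f x *: D s x].

Definition is_connection (X : set R[i]^o) (D : connection) : Prop :=
  is_derivation X (@del R) (nabla D) /\
  is_derivation X (@delbar R) (nablabar D).

(* The curvature of D is [nabla, nablabar] dz /\ dzbar. *)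
Definition flat_connection (X : set R[i]^o) (D : connection) : Prop :=
  forall x, X x -> forall s, section_smooth_at s x ->
    nabla D (nablabar D s) x = nablabar D (nabla D s) x.

Definition flat_section (X : set R[i]^o) (D : connection) (s : section_of) :
  Prop :=
  forall x, X x ->
    [/\ section_smooth_at s x, nabla D s x = 0 & nablabar D s x = 0].

End Bundles.

Section Pullback.
Variables (R : realType) (f : R[i] -> R[i]) (E : bundle R).

Definition pullback : bundle R :=
  @Bundle R (rk E) (fun z => E (f z)) (fun p => f @^-1` chart_dom E (f p))
    (fun p z => frame E (f p) (f z)).

(* For v = sum_k c_k (e_k \o f) one has
   (f^*d) v = sum_k d(c_k) (e_k \o f) + c_k f^*(d e_k), where
   f^*(a dw + b dwbar) = (a \o f) df + (b \o f) d(fbar). *)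
Definition pullback_part (delta : (R[i] -> R[i]) -> R[i] -> R[i])
    (D : connection E) (v : section_of pullback) : section_of pullback :=
  fun z => \sum_(k < rk E)
    (delta (@frame_coord R pullback z k v) z *: frame_section (f z) k (f z) +
     @frame_coord R pullback z k v z *:
       (delta f z *: nabla D (frame_section (f z) k) (f z) +
        delta (fun w => (f w)^*) z *:
          nablabar D (frame_section (f z) k) (f z))).

Definition pullback_connection (D : connection E) : connection pullback :=
  Connection (pullback_part (@del R) D) (pullback_part (@delbar R) D).

End Pullback.

(* h(v, w) = \sum_(p + q = n) (-1)^q Q(v^{p,q}, w^{p,q}) on a vector space
   decomposed as the direct sum of the F p, for p in the finite list ps. *)
Definition hodge_form (R : realType) (V : vectType R[i]) (n : int)
    (ps : seq int) (F : int -> {vspace V}) (Q : V -> V -> R[i]) (v w : V) :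
  R[i] :=
  \sum_(p <- ps) (-1) ^ (n - p) *
    Q (sumv_pi (\sum_(i <- ps) F i)%VS p v)
      (sumv_pi (\sum_(i <- ps) F i)%VS p w).

(* Polarized complex variations of Hodge structure on a connected open set X.
   hodge p x is the fiber at x of E^{p,q}, where q = weight - p; it vanishes
   unless p is in the list hodge_types (a finite list is enough for all points
   of X, since the rank is finite and the ranks of the E^{p,q} are constant). *)
Record pvhs (R : realType) (X : set R[i]^o) := PVHS {
  weight : int;
  vb :> bundle R;
  vb_smooth : smooth_bundle vb X;
  conn : connection vb;
  connP : is_connection X conn;
  conn_flat : flat_connection X conn;
  hodge_types : seq int;
  hodge : int -> forall x, {vspace vb x};
  hodge_types_uniq : uniq hodge_types;
  hodge_out : forall p x, X x -> p \notin hodge_types -> hodge p x = 0%VS;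
  hodge_smooth : forall p, smooth_subbundle X (hodge p);
  hodge_direct : forall x, X x ->
    directv (\sum_(p <- hodge_types) hodge p x)%VS;
  hodge_full : forall x, X x ->
    (\sum_(p <- hodge_types) hodge p x)%VS = fullv;
  (* (1,0)-part: E^{p,q} + E^{p-1,q+1};  (0,1)-part: E^{p,q} + E^{p+1,q-1} *)
  griffiths : forall p x (s : section_of vb), X x -> section_smooth_at s x ->
    (\forall y \near (x : R[i]^o), s y \in hodge p y) ->
    nabla conn s x \in (hodge p x + hodge (p - 1) x)%VS /\
    nablabar conn s x \in (hodge p x + hodge (p + 1) x)%VS;
  pairing : forall x, {hermitian vb x for false & @Num.conj R[i]};
  pairing_smooth : forall x (s t : section_of vb), X x ->
    section_smooth_at s x -> section_smooth_at t x ->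
    smooth_at (fun y => pairing y (s y) (t y)) x;
  (* d Q(s, t) = Q(d s, t) + Q(s, d t), with Q conjugate-linear on the right *)
  pairing_flat : forall x (s t : section_of vb), X x ->
    section_smooth_at s x -> section_smooth_at t x ->
    del (fun y => pairing y (s y) (t y)) x =
      pairing x (nabla conn s x) (t x) + pairing x (s x) (nablabar conn t x) /\
    delbar (fun y => pairing y (s y) (t y)) x =
      pairing x (nablabar conn s x) (t x) + pairing x (s x) (nabla conn t x);
  hodge_orthogonal : forall p p' x, X x -> p != p' ->
    forall v w, v \in hodge p x -> w \in hodge p' x -> pairing x v w = 0;
  hodge_pos : forall x v, X x -> v != 0 ->
    0 < hodge_form weight hodge_types (hodge ^~ x) (pairing x) v v;
  hodge_form_smooth : forall x (s t : section_of vb), X x ->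
    section_smooth_at s x -> section_smooth_at t x ->
    smooth_at (fun y => hodge_form weight hodge_types (hodge ^~ y) (pairing y)
                          (s y) (t y)) x
}.

Definition hodge_metric (R : realType) (X : set R[i]^o) (E : pvhs X) (x : R[i])
    (v w : E x) : R[i] :=
  hodge_form (weight E) (hodge_types E) (hodge E ^~ x) (pairing E x) v w.


Section PuncturedDisk.
Variable R : realType.

Definition punctured_disk : set R[i]^o := [set t | 0 < `|t| < 1].
Definition half_plane : set R[i]^o := [set z | complex.Re z < 0].

Definition cexp (z : R[i]) : R[i] :=
  (expR (complex.Re z))%:C * (cos (complex.Im z) +i* sin (complex.Im z)).

Definition two_pi_i : R[i] := 0 +i* (2 * pi).

Lemma cexp_period (z : R[i]) : cexp (z - two_pi_i) = cexp z.
Proof.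
case: z => a b; rewrite /cexp /two_pi_i /= subr0.
have -> : b - 2 * pi = b - pi *+ 2 by rewrite mulr_natl.
by rewrite -[in RHS](subrK (pi *+ 2) b) cosD2pi sinD2pi.
Qed.

Variable E : pvhs punctured_disk.

Definition multivalued_section : Type := section_of (pullback cexp E).

(* Membership in V: d-flat sections of exp^*E over the half-plane. *)
Definition multivalued_flat (v : multivalued_section) : Prop :=
  flat_section half_plane (pullback_connection cexp (conn E)) v.

(* (T v)(z) = v(z - 2 pi i), as elements of the same fiber of E. *)
Definition monodromy (v : multivalued_section) : multivalued_section :=
  fun z => eq_rect _ (fun t : R[i] => E t) (v (z - two_pi_i)) _ (cexp_period z).

(* h(v, v), which is a real function, and its logarithm. *)
Definition log_norm (v : multivalued_section) (z : R[i]) : R :=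
  ln (complex.Re (@hodge_metric _ _ E (cexp z) (v z) (v z))).

End PuncturedDisk.

(* Main.v *)
(* Write C for the Weil operator and split the flat connection as the Chern
   connection dd + db plus the Higgs field th and its adjoint ts. The curvature
   identities dd db + th ts = db dd + ts th and [db, th] = 0 give two facts.

   (1) Ahlfors-type estimate: |th|_h <= const / |Re z| on the half-plane.
   At an interior maximum of |th e|^2 |exp z|^2 ((x - a)(b - x))^2 / (b_p |e|^2),
   taken over the points of a strip a <= x <= b and the nonzero e in E^p, with
   b_p = M^2 - p^2, the curvature identities bound the maximum, because b_p is
   strictly concave in p.

   (2) For a flat section v, log h(v, v) is subharmonic, and its gradient is at
   most const / |Re z| by (1).

   If Tv = lambda v, then h(v, v) is multiplied by |lambda|^2 under translation
   by -2 pi i; integrating the gradient over a period at Re z -> -oo shows that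
   |lambda| = 1. So h(v, v) is periodic, and it grows at most like a power of
   |Re z|. Comparing it with (1 + d |x|)^(k+1), whose logarithm is strictly
   superharmonic, on strips -L <= x <= -1, letting L -> oo and then taking
   d = 1/|x|, bounds it. *)
Require Import Defs.
From HB Require Import structures.
From mathcomp Require Import all_boot all_order all_algebra.
From mathcomp Require Import all_classical all_reals all_analysis.
From mathcomp Require Import complex ring lra.
Import Order.TTheory GRing.Theory Num.Theory numFieldNormedType.Exports.
Local Open Scope classical_set_scope.
Local Open Scope ring_scope.
Local Open Scope complex_scope.
Set Implicit Arguments.
Unset Strict Implicit.
(** * Smooth functions of a complex variable *)

(** On the disk the Higgs field has coefficient [theta]; pulled back by the exponential it becomes
    [exp z * theta], hence the factor [|exp z|^2] in (1). The weight vanishes on both vertical sides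
    of the strip, so a positive maximum lies inside, and the resulting bound scales correctly: the
    strip of width [|x|] centred at [x] gives a constant over [x^2].

    The curvature at a maximising vector of type [p] involves the Higgs field on [E^p] and on both
    neighbours. All three are controlled by the same maximum, weighted by [b_p], and the second
    difference of [b_p] is what survives.

    Such an argument would normally take holomorphic sections. Everything happens at one point, so a
    section that is holomorphic there to the required order is enough; and the mixed derivative of a
    logarithm is replaced by the rational expression [lcurv], compared for two functions that touch
    at that point.

    In (2) the gradient bound alone cannot suffice, since its integral in [Re z] diverges
    logarithmically. It only gives polynomial growth; subharmonicity and periodicity in [Im z]
    improve this to boundedness. *)

(* In [ring_scope] the notation [z^*] stands for [Num.conj], in [complex_scope]
   for [conjc]; a separate constant keeps the two from being mixed. *)
Definition cj (R : realType) (z : R[i]) : R[i] := (z^*)%C.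

(** * Real and imaginary parts, and neighbourhoods in the complex plane *)

Section Box.
Variable R : realType.
Implicit Types (w z : R[i]).

Lemma ReM w z : complex.Re (w * z) =
  complex.Re w * complex.Re z - complex.Im w * complex.Im z.
Proof. by case: w; case: z. Qed.

Lemma ImM w z : complex.Im (w * z) =
  complex.Re w * complex.Im z + complex.Im w * complex.Re z.
Proof. by case: w; case: z. Qed.

Lemma ReD w z : complex.Re (w + z) = complex.Re w + complex.Re z.
Proof. by case: w; case: z. Qed.

Lemma ImD w z : complex.Im (w + z) = complex.Im w + complex.Im z.
Proof. by case: w; case: z. Qed.

Lemma ReB w z : complex.Re (w - z) = complex.Re w - complex.Re z.
Proof. by case: w; case: z. Qed.

Lemma ImB w z : complex.Im (w - z) = complex.Im w - complex.Im z.
Proof. by case: w; case: z. Qed.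

Lemma ReZ (t : R) z : complex.Re (t%:C * z) = t * complex.Re z.
Proof. by case: z => a b; rewrite ReM /= mul0r subr0. Qed.

Lemma ImZ (t : R) z : complex.Im (t%:C * z) = t * complex.Im z.
Proof. by case: z => a b; rewrite ImM /= mul0r addr0. Qed.

Lemma cjD w z : cj (w + z) = cj w + cj z.
Proof. by apply/eqP; rewrite eq_complex; case: w => a b; case: z => c d /=; apply/andP; split; apply/eqP; ring. Qed.

Lemma cjB w z : cj (w - z) = cj w - cj z.
Proof. by apply/eqP; rewrite eq_complex; case: w => a b; case: z => c d /=; apply/andP; split; apply/eqP; ring. Qed.

Lemma cjM w z : cj (w * z) = cj w * cj z.
Proof. by apply/eqP; rewrite eq_complex; case: w => a b; case: z => c d /=; apply/andP; split; apply/eqP; ring. Qed.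

Lemma cjN z : cj (- z) = - cj z.
Proof. by rewrite -[- z]add0r cjB /cj conjc0 add0r. Qed.

Lemma cjK z : cj (cj z) = z.
Proof. exact: conjcK. Qed.

Lemma cj_real (x : R) : cj x%:C = x%:C.
Proof. exact: conjc_real. Qed.

Lemma cj0 : cj 0 = 0 :> R[i].
Proof. exact: conjc0. Qed.

Lemma cj1 : cj 1 = 1 :> R[i].
Proof. exact: conjc1. Qed.

Lemma cjV z : cj z^-1 = (cj z)^-1.
Proof. exact: conjc_inv. Qed.

Lemma cji : cj 'i%C = - 'i%C :> R[i].
Proof. by apply/eqP; rewrite eq_complex /= oppr0 !eqxx. Qed.

Lemma cj_eq0 z : (cj z == 0) = (z == 0).
Proof. exact: conjc_eq0. Qed.

Lemma Re_cj z : complex.Re (cj z) = complex.Re z.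
Proof. by case: z. Qed.

Lemma normc_le_ReIm z : `|z| <= (`|complex.Re z| + `|complex.Im z|)%:C.
Proof.
case: z => a b; rewrite normc_def lecR /=.
rewrite -[leRHS]ger0_norm ?addr_ge0// -sqrtr_sqr ler_wsqrtr// sqrrD.
by rewrite !real_normK ?num_real// lerD2r lerDl mulrn_wge0// mulr_ge0.
Qed.

Lemma normc_ge_Im z : `|complex.Im z|%:C <= `|z|.
Proof.
case: z => a b; rewrite normc_def lecR /= -sqrtr_sqr ler_wsqrtr//.
by rewrite lerDr sqr_ge0.
Qed.

(** The norm of [R[i]] is itself complex valued, so balls have radii in [R[i]]. Boxes have real
    radii and split every epsilon argument into real and imaginary parts. *)
Lemma nbhs_box z (A : set R[i]^o) : nbhs (z : R[i]^o) A <->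
  exists2 e : R, 0 < e & forall w, `|complex.Re (w - z)| < e ->
    `|complex.Im (w - z)| < e -> A w.
Proof.
split.
  move=> /(nbhs_normP (z : R[i]^o))[/= e e0 eA].
  have eE : e = (complex.Re e)%:C by case: e e0 {eA} => a b; rewrite ltcE /= => /andP[/eqP -> _].
  have e0' : 0 < complex.Re e by move: e0; rewrite eE ltcR.
  exists (complex.Re e / 2); first by rewrite divr_gt0.
  move=> w wr wi; apply: eA; rewrite /ball_ /= distrC eE.
  rewrite (le_lt_trans (normc_le_ReIm _))// ltcR.
  lra.
move=> [e e0 eA]; apply/(nbhs_normP (z : R[i]^o)); exists e%:C => /=; first by rewrite ltcR.
move=> w /=; rewrite /ball_ /= distrC => we; apply: eA.
  by rewrite -ltcR; exact: le_lt_trans (normc_ge_Re _) we.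
by rewrite -ltcR; exact: le_lt_trans (normc_ge_Im _) we.
Qed.

End Box.

(** Fixes the norm topology on both sides, so that continuity can be stated for plain functions on
    [R[i]]. *)
Definition continuous_pt (R : realType) (f : R[i] -> R[i]) (z : R[i]) : Prop :=
  {for z, continuous (f : R[i]^o -> R[i]^o)}.

Section ContinuousPt.
Variable R : realType.
Implicit Types (w z : R[i]) (f g : R[i] -> R[i]).

Lemma continuous_ptP f z : continuous_pt f z <->
  forall e : R, 0 < e -> \forall w \near (z : R[i]^o),
    `|complex.Re (f w - f z)| < e /\ `|complex.Im (f w - f z)| < e.
Proof.
split.
  move=> fz e e0; apply: (fz [set u | `|complex.Re (u - f z)| < e /\ `|complex.Im (u - f z)| < e]).
  by apply/nbhs_box; exists e.
move=> H A /nbhs_box[e e0 eA].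
by apply: filterS (H e e0) => w [? ?]; apply: eA.
Qed.

Lemma continuous_pt_cst c z : continuous_pt (fun=> c : R[i]) z.
Proof. exact: (@cst_continuous R[i]^o R[i]^o c z). Qed.

Lemma continuous_pt_id z : continuous_pt (@id R[i]) z.
Proof. by move=> A. Qed.

Lemma continuous_ptD f g z : continuous_pt f z -> continuous_pt g z ->
  continuous_pt (fun w => f w + g w) z.
Proof. by move=> cf cg; exact: (@cvgD _ R[i]^o _ _ _ _ _ _ _ cf cg). Qed.

Lemma continuous_ptM f g z : continuous_pt f z -> continuous_pt g z ->
  continuous_pt (fun w => f w * g w) z.
Proof. by move=> cf cg; exact: (@cvgM _ R[i]^o _ _ _ _ _ _ cf cg). Qed.

Lemma continuous_ptV f z : f z != 0 -> continuous_pt f z ->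
  continuous_pt (fun w => (f w)^-1) z.
Proof. by move=> f0 cf; exact: (@cvgV _ R[i]^o _ _ _ _ f0 cf). Qed.

Lemma continuous_pt_comp f g z : continuous_pt f z -> continuous_pt g (f z) ->
  continuous_pt (fun w => g (f w)) z.
Proof. by move=> cf cg; exact: (continuous_comp cf cg). Qed.

Lemma continuous_pt_conj f z : continuous_pt f z ->
  continuous_pt (fun w => cj (f w)) z.
Proof.
move=> /continuous_ptP H; apply/continuous_ptP => e /H.
apply: filterS => w; case: (f w) => a b; case: (f z) => c d /= [? ?]; split=> //.
by rewrite -opprD normrN.
Qed.

Lemma continuous_pt_near f g z : (\forall w \near (z : R[i]^o), f w = g w) ->
  continuous_pt f z -> continuous_pt g z.
Proof.
move=> fg /continuous_ptP H; apply/continuous_ptP => e /H H'.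
near=> w; rewrite -(nbhs_singleton fg).
have <- : f w = g w by near: w.
by near: w.
Unshelve. all: by end_near. Qed.

End ContinuousPt.
Arguments continuous_pt_cst {R} c z.

(** * Wirtinger calculus through continuous difference quotients *)

Section CaratheodoryDiff.
Variable R : realType.
Implicit Types (w z a b c d : R[i]) (f g F : R[i] -> R[i]).

Definition linearized f z (phi psi : R[i] -> R[i]) (w : R[i]) : Prop :=
  f w = f z + (w - z) * phi w + cj (w - z) * psi w.

(* Real differentiability in the form of Caratheodory: the two difference
   quotients are continuous at [z], where they take the values of the Wirtinger
   derivatives.  In this form products and composites are purely algebraic. *)
Definition cdiff f z a b : Prop := exists phi psi : R[i] -> R[i],
  [/\ continuous_pt phi z, continuous_pt psi z, phi z = a, psi z = b &
      \forall w \near (z : R[i]^o),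
        linearized f z phi psi w].

Lemma nearc z (P : R[i] -> Prop) :
  (forall w, P w) -> \forall w \near (z : R[i]^o), P w.
Proof. by move=> H; near=> w; exact: H. Unshelve. all: by end_near. Qed.

Lemma cdiffI f z (phi psi : R[i] -> R[i]) :
  continuous_pt phi z -> continuous_pt psi z ->
  (\forall w \near (z : R[i]^o),
     linearized f z phi psi w) ->
  cdiff f z (phi z) (psi z).
Proof. by move=> cp cq H; exists phi, psi. Qed.

Lemma cdiff_cst c z : cdiff (fun=> c) z 0 0.
Proof.
apply: (@cdiffI _ z (fun=> 0) (fun=> 0) (continuous_pt_cst 0 z) (continuous_pt_cst 0 z)).
by apply: nearc => w; rewrite /linearized !mulr0 !addr0.
Qed.

Lemma cdiff_id z : cdiff id z 1 0.
Proof.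
apply: (@cdiffI _ z (fun=> 1) (fun=> 0) (continuous_pt_cst 1 z) (continuous_pt_cst 0 z)).
by apply: nearc => w; rewrite /linearized !mulr0 mulr1 addr0 addrC subrK.
Qed.

Lemma cdiff_near f g z a b : (\forall w \near (z : R[i]^o), f w = g w) ->
  cdiff f z a b -> cdiff g z a b.
Proof.
move=> fg [phi [psi [? ? ? ? H]]]; exists phi, psi; split => //.
have E := nbhs_singleton fg.
by apply: filterS2 fg H => w; rewrite /linearized E => ->.
Qed.

Lemma cdiff_conj f z a b : cdiff f z a b -> cdiff (fun w => cj (f w)) z (cj b) (cj a).
Proof.
move=> [phi [psi [cp cq <- <- H]]].
apply: (@cdiffI _ z (fun w => cj (psi w)) (fun w => cj (phi w))).
- exact: continuous_pt_conj.
- exact: continuous_pt_conj.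
apply: filterS H => w; rewrite /linearized => ->.
by rewrite 2!cjD 2!cjM cjK addrAC.
Qed.

Lemma cdiff_continuous f z a b : cdiff f z a b -> continuous_pt f z.
Proof.
move=> [phi [psi [cp cq _ _ H]]].
apply: (@continuous_pt_near _ (fun w => f z + (w - z) * phi w + cj (w - z) * psi w)).
  by apply: filterS H => w; rewrite /linearized => ->.
have cz : continuous_pt (fun w => w - z) z.
  apply: continuous_ptD; first exact: continuous_pt_id.
  exact: continuous_pt_cst.
do 2?[apply: continuous_ptD].
- exact: continuous_pt_cst.
- exact: continuous_ptM.
- by apply: continuous_ptM; [exact: continuous_pt_conj|].
Qed.

Lemma cdiffD f g z a b c d : cdiff f z a b -> cdiff g z c d ->
  cdiff (fun w => f w + g w) z (a + c) (b + d).
Proof.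
move=> [p [q [cp cq <- <- H]]] [p' [q' [cp' cq' <- <- H']]].
apply: (@cdiffI _ z (fun w => p w + p' w) (fun w => q w + q' w)).
- exact: continuous_ptD.
- exact: continuous_ptD.
apply: filterS2 H H' => w; rewrite /linearized => -> ->.
move: (cj (w - z)) => x; ring.
Qed.

Lemma cdiffM f g z a b c d : cdiff f z a b -> cdiff g z c d ->
  cdiff (fun w => f w * g w) z (a * g z + f z * c) (b * g z + f z * d).
Proof.
move=> [p [q [cp cq <- <- H]]] G; have cg := cdiff_continuous G.
move: G => [p' [q' [cp' cq' <- <- H']]].
apply: (@cdiffI _ z (fun w => p w * g w + f z * p' w) (fun w => q w * g w + f z * q' w)).
- by apply: continuous_ptD; apply: continuous_ptM; do ?exact: continuous_pt_cst; assumption.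
- by apply: continuous_ptD; apply: continuous_ptM; do ?exact: continuous_pt_cst; assumption.
apply: filterS2 H H' => w; rewrite /linearized => -> ->.
move: (cj (w - z)) => x; ring.
Qed.

(** The increment of the inverse is [(f z - f w) / (f z * f w)], so both quotients of [f] are
    divided by [- (f z * f w)]. *)
Lemma cdiffV f z a b : f z != 0 -> cdiff f z a b ->
  cdiff (fun w => (f w)^-1) z (- a / f z ^+ 2) (- b / f z ^+ 2).
Proof.
move=> fz G; have cf := cdiff_continuous G.
have cV := continuous_ptV fz cf.
move: G => [p [q [cp cq <- <- H]]].
have cX r : continuous_pt r z -> continuous_pt (fun w => - r w / (f z * f w)) z.
  move=> cr; apply: (@continuous_pt_near _ (fun w => (- (f z)^-1 * r w) * (f w)^-1)).
    by apply: nearc => w; rewrite invfM; ring.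
  apply: continuous_ptM cV; apply: continuous_ptM cr.
  exact: continuous_pt_cst.
apply: (@cdiffI _ z (fun w => - p w / (f z * f w)) (fun w => - q w / (f z * f w))).
- exact: cX.
- exact: cX.
have f0 : \forall w \near (z : R[i]^o), f w != 0.
  exact: (@cvgr_neq0 _ R[i]^o R[i]^o _ _ f (f z) cf fz).
suff key w : linearized f z p q w -> f w != 0 ->
    linearized (fun w => (f w)^-1) z (fun w => - p w / (f z * f w))
      (fun w => - q w / (f z * f w)) w.
  by apply: filterS2 H f0 => w; exact: key.
rewrite /linearized => E w0.
have F : f z - f w = - ((w - z) * p w + cj (w - z) * q w) by rewrite E; ring.
have -> : (f w)^-1 = (f z)^-1 + (f z - f w) / (f z * f w) by field; rewrite w0 fz.
rewrite F; move: (cj (w - z)) => x; ring.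
Qed.

(** Conjugating the increment of [F] exchanges its two quotients; this is where [cj b] and [cj a]
    come from. *)
Lemma cdiff_comp F g z a b c d : cdiff F z a b -> cdiff g (F z) c d ->
  cdiff (fun w => g (F w)) z (a * c + cj b * d) (b * c + cj a * d).
Proof.
move=> G; have cF := cdiff_continuous G.
move: G => [p [q [cp cq <- <- H]]] [p' [q' [cp' cq' <- <- H']]].
have cp'' := continuous_pt_comp cF cp'; have cq'' := continuous_pt_comp cF cq'.
apply: (@cdiffI _ z (fun w => p w * p' (F w) + cj (q w) * q' (F w))
  (fun w => q w * p' (F w) + cj (p w) * q' (F w))).
- by apply: continuous_ptD; apply: continuous_ptM; do ?exact: continuous_pt_conj; assumption.
- by apply: continuous_ptD; apply: continuous_ptM; do ?exact: continuous_pt_conj; assumption.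
have H'' : \forall w \near (z : R[i]^o), linearized g (F z) p' q' (F w).
  exact: cF H'.
suff key w : linearized F z p q w -> linearized g (F z) p' q' (F w) ->
    linearized (fun w => g (F w)) z (fun w => p w * p' (F w) + cj (q w) * q' (F w))
      (fun w => q w * p' (F w) + cj (p w) * q' (F w)) w.
  by apply: filterS2 H H'' => w; exact: key.
rewrite /linearized => E ->.
have -> : F w - F z = (w - z) * p w + cj (w - z) * q w by rewrite E; ring.
rewrite (cjD (_ * _)) 2!cjM cjK.
move: (cj (w - z)) (cj (p w)) (cj (q w)) => x y t; ring.
Qed.

Lemma near_line z (v : R[i]) (P : R[i] -> Prop) :
  (\forall w \near (z : R[i]^o), P w) ->
  \forall t \near (0 : R), P (z + t%:C * v).
Proof.
move=> /nbhs_box[e e0 eP].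
set m := `|complex.Re v| + `|complex.Im v| + 1.
have m0 : 0 < m by rewrite ltr_wpDl ?addr_ge0.
apply/nbhs_ballP; exists (e / m) => /=; first by rewrite divr_gt0.
move=> t; rewrite /ball /= sub0r normrN ltr_pdivlMr// => tm.
have E : z + t%:C * v - z = t%:C * v by rewrite addrAC subrr add0r.
apply: eP; rewrite E ?ReZ ?ImZ normrM; apply: le_lt_trans tm;
  rewrite ler_wpM2l// /m.
  by rewrite -addrA lerDl addr_ge0.
by rewrite addrAC lerDr addr_ge0.
Qed.

Lemma is_derive_quotient (g k : R -> R) (l : R) :
  (\forall t \near (0 : R), g t = g 0 + t * k t) ->
  (forall e : R, 0 < e -> \forall t \near (0 : R), `|k t - l| < e) ->
  derivable g 0 1 /\ derive1 g 0 = l.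
Proof.
move=> gk kl.
have H : h^-1 *: ((g \o shift 0) h - g 0) @[h --> 0^'] --> l.
  apply/cvgrPdist_lt => e e0; near=> h.
  have h0 : h != 0 by near: h; exact: nbhs_dnbhs_neq.
  rewrite /= addr0.
  have -> : g h = g 0 + h * k h by near: h; exact: nbhs_dnbhs.
  rewrite addrAC subrr add0r scalerA mulVf// scale1r distrC.
  by near: h; apply: nbhs_dnbhs; exact: kl.
split; last by exact: cvg_lim H.
apply/cvg_ex; exists l; apply: cvg_trans H; apply: near_eq_cvg.
by near=> h; rewrite /= addr0 /shift /= addr0 [h *: 1]mulr1.
Unshelve. all: by end_near. Qed.

(** On the line [z + t v] the increment is [t] times [v phi + cj v psi], which is continuous; its
    value at [z] is the derivative. *)
Lemma cdiff_partial f z a b v : cdiff f z a b ->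
  has_partial v f z /\ partial v f z = v * a + cj v * b.
Proof.
move=> [p [q [cp cq <- <- H]]].
pose k w := v * p w + cj v * q w.
have ck : continuous_pt k z.
  by by apply: continuous_ptD; apply: continuous_ptM; do ?exact: continuous_pt_cst; assumption.
have E : \forall t \near (0 : R),
    slice v f z t = slice v f z 0 + t%:C * k (z + t%:C * v).
  have := near_line v H; apply: filterS => t; rewrite /slice /linearized => ->.
  have -> : z + t%:C * v - z = t%:C * v by rewrite addrAC subrr add0r.
  rewrite mul0r addr0 /k cjM cj_real.
  move: (cj v) => x; ring.
have kl (T : R[i] -> R) (T_add : {morph T : x y / x - y}) :
  (forall (e : R), 0 < e -> \forall w \near (z : R[i]^o), `|T (k w - k z)| < e) ->
  forall e : R, 0 < e -> \forall t \near (0 : R), `|T (k (z + t%:C * v)) - T (k z)| < e.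
  move=> K e /K/(near_line v); apply: filterS => t.
  by rewrite T_add.
have [Re1 Re2] : derivable (fun t => complex.Re (slice v f z t)) 0 1 /\
    derive1 (fun t => complex.Re (slice v f z t)) 0 = complex.Re (k z).
  apply: (@is_derive_quotient _ (fun t => complex.Re (k (z + t%:C * v)))).
    by apply: filterS E => t ->; rewrite ReD ReZ.
  apply: kl => [x y|e e0]; first exact: ReB.
  by move/continuous_ptP : ck => /(_ e e0); apply: filterS => w [].
have [Im1 Im2] : derivable (fun t => complex.Im (slice v f z t)) 0 1 /\
    derive1 (fun t => complex.Im (slice v f z t)) 0 = complex.Im (k z).
  apply: (@is_derive_quotient _ (fun t => complex.Im (k (z + t%:C * v)))).
    by apply: filterS E => t ->; rewrite ImD ImZ.
  apply: kl => [x y|e e0]; first exact: ImB.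
  by move/continuous_ptP : ck => /(_ e e0); apply: filterS => w [].
split; first by split.
rewrite /partial Re2 Im2 -/(k z).
have eta (u : R[i]) : (complex.Re u +i* complex.Im u)%C = u by case: u.
exact: eta.
Qed.

(** The values [a] and [b] are thus determined by [f], and any pair of quotients computes the
    Wirtinger derivatives. The rules for [del] and [delbar] are all read off in this way. *)
Lemma cdiff_del f z a b : cdiff f z a b -> del f z = a /\ delbar f z = b.
Proof.
move=> H; have [_ E1] := cdiff_partial 1 H; have [_ E2] := cdiff_partial 'i%C H.
rewrite /del /delbar E1 E2 cj1 cji.
have ii : 'i%C * 'i%C = -1 :> R[i] by rewrite -expr2 sqr_i.
have n2 : (2 : R[i]) != 0 by rewrite pnatr_eq0.
by split; rewrite !mulrDr !mulrA mulrN ii; field.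
Qed.

End CaratheodoryDiff.

(** * From continuous partial derivatives to differentiability; functions of class C^k *)

Section ContinuouslyDifferentiable.
Variable R : realType.
Implicit Types (w z v a b : R[i]) (f g F : R[i] -> R[i]).

Lemma derivable_shift (g : R -> R) (s : R) :
  derivable (fun t => g (t + s)) 0 1 ->
  derivable g s 1 /\ derive1 g s = derive1 (fun t => g (t + s)) 0.
Proof.
have E : (fun h : R => h^-1 *: ((g \o shift s) (h *: 1) - g s)) =
    (fun h => h^-1 *: (((fun t => g (t + s)) \o shift 0) (h *: 1) - g (0 + s))).
  by apply/funext => h; rewrite /= /shift /= addr0 add0r.
split; first by rewrite /derivable E.
by rewrite !derive1E /derive E.
Qed.

Lemma mean_value_bound (g : R -> R) (b m e : R) :
  (forall t, `|t| <= `|b| -> derivable g t 1 /\ `|derive1 g t - m| <= e) ->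
  `|g b - g 0 - b * m| <= e * `|b|.
Proof.
move=> H.
have der (t : R) : `|t| <= `|b| -> is_derive t 1 g (derive1 g t).
  by move=> /H[dg _]; rewrite derive1E; exact: derivableP.
have cont (x y : R) : (forall t, t \in `[x, y] -> `|t| <= `|b|) ->
    {within `[x, y], continuous g}.
  by move=> xy; apply: derivable_within_continuous => t /xy /H[].
have [b0|b0] := leP 0 b.
  have sub t : t \in `[0, b] -> `|t| <= `|b|.
    by rewrite in_itv /= => /andP[t0 tb]; rewrite !ger0_norm.
  have [c cb E] : exists2 c, c \in `[0, b] & g b - g 0 = derive1 g c * (b - 0).
    apply: MVT_segment => // [t tb|]; last exact: cont sub.
    by apply/der/sub; exact: subset_itv_oo_cc tb.
  rewrite E subr0 (mulrC b) -mulrBl normrM ler_wpM2r//.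
  by have [] := H c (sub _ cb).
have sub t : t \in `[b, 0] -> `|t| <= `|b|.
  rewrite in_itv /= => /andP[t0 tb].
  by rewrite ler0_norm// ltr0_norm// lerN2.
have [c cb E] : exists2 c, c \in `[b, 0] & g 0 - g b = derive1 g c * (0 - b).
  apply: MVT_segment => // [|t tb|]; [exact: ltW| |exact: cont sub].
  by apply/der/sub; exact: subset_itv_oo_cc tb.
have E' : g b - g 0 = derive1 g c * b by move: (derive1 g c) E => d E; lra.
have -> : g b - g 0 - b * m = (derive1 g c - m) * b by rewrite E' mulrBl (mulrC b).
rewrite normrM ler_wpM2r//.
by have [] := H c (sub _ cb).
Qed.

(** Shared by [complex.Re] and [complex.Im], so that the real mean value theorem is applied once for
    both parts of a complex function. *)
Definition real_component (T : R[i] -> R) : Prop := forall v f z, has_partial v f z ->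
  derivable (fun t => T (slice v f z t)) 0 1 /\
  derive1 (fun t => T (slice v f z t)) 0 = T (partial v f z).

Lemma slice_mean_value (T : R[i] -> R) f z v (b m e : R) :
  real_component T ->
  (forall t, `|t| <= `|b| -> has_partial v f (z + t%:C * v) /\
     `|T (partial v f (z + t%:C * v)) - m| <= e) ->
  `|T (f (z + b%:C * v)) - T (f z) - b * m| <= e * `|b|.
Proof.
move=> TP H.
have := @mean_value_bound (fun t => T (slice v f z t)) b m e.
rewrite /slice mul0r addr0; apply => t /H[hp le].
have [d1 d2] := TP _ _ _ hp.
have E : (fun u : R => T (f (z + (u + t)%:C * v))) =
    (fun u => T (slice v f (z + t%:C * v) u)).
  apply/funext => u; congr (T (f _)); rewrite rmorphD /= mulrDl.
  by rewrite -addrA (addrC (t%:C * v)).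
have [|d3 d4] := @derivable_shift (fun u => T (f (z + u%:C * v))) t.
  by rewrite E.
by split=> //; rewrite d4 E d2.
Qed.

(** The path from [z] to [w] has one corner [z1]: a horizontal leg, then a vertical one. Continuity
    of both partials at [z] makes each leg linear up to [e / 2] times its length. *)
Lemma C1_increment (T : R[i] -> R) f z :
  {morph T : x y / x - y} ->
  (forall w, `|T w| <= `|complex.Re w| + `|complex.Im w|) ->
  real_component T ->
  (\forall w \near (z : R[i]^o), has_partial 1 f w /\ has_partial 'i%C f w) ->
  continuous_pt (partial 1 f) z -> continuous_pt (partial 'i%C f) z ->
  forall e : R, 0 < e -> \forall w \near (z : R[i]^o),
    `|T (f w) - T (f z) - complex.Re (w - z) * T (partial 1 f z)
       - complex.Im (w - z) * T (partial 'i%C f z)|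
    <= e * (`|complex.Re (w - z)| + `|complex.Im (w - z)|).
Proof.
move=> TB Tle TP hp c1 ci e e0.
have e4 : 0 < e / 4 by rewrite divr_gt0.
move/continuous_ptP : c1 => /(_ _ e4) c1; move/continuous_ptP : ci => /(_ _ e4) ci.
have [d d0 dP] := (nbhs_box z _).1 (filterI hp (filterI c1 ci)).
apply/nbhs_box; exists d => // w wr wi.
have Tlt u v : `|complex.Re (u - v)| < e / 4 /\ `|complex.Im (u - v)| < e / 4 ->
    `|T u - T v| <= e / 2.
  by rewrite -TB => -[a b]; apply: le_trans (Tle _) _; lra.
set h := complex.Re (w - z) in wr *; set k := complex.Im (w - z) in wi *.
pose z1 := z + h%:C * 1.
have wE : w = z1 + k%:C * 'i%C.
  rewrite /z1 mulr1 -addrA; apply/eqP; rewrite -subr_eq0 opprD addrA subr_eq0.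
  by rewrite /h /k; case: (w - z) => a b; apply/eqP; rewrite mulrC; simpc.
have near1 (t : R) : `|t| <= `|h| -> has_partial 1 f (z + t%:C * 1) /\
     `|T (partial 1 f (z + t%:C * 1)) - T (partial 1 f z)| <= e / 2.
  move=> th; have E : z + t%:C * 1 - z = t%:C by rewrite mulr1 addrAC subrr add0r.
  have [] := dP (z + t%:C * 1); rewrite ?E /= ?normr0//.
    exact: le_lt_trans th wr.
  move=> [p1 _] [p2 _]; split; first exact: p1.
  exact: (Tlt (partial 1 f (z + t%:C * 1)) (partial 1 f z) p2).
have neari (t : R) : `|t| <= `|k| -> has_partial 'i%C f (z1 + t%:C * 'i%C) /\
     `|T (partial 'i%C f (z1 + t%:C * 'i%C)) - T (partial 'i%C f z)| <= e / 2.
  move=> tk; have E : z1 + t%:C * 'i%C - z = h%:C + t%:C * 'i%C.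
    by rewrite /z1 mulr1; move: (t%:C * _) => x; ring.
  have [] := dP (z1 + t%:C * 'i%C).
  - by rewrite E ReD ReZ /= mulr0 addr0.
  - by rewrite E ImD ImZ /= mulr1 add0r; exact: le_lt_trans tk wi.
  move=> [_ p1] [_ p2]; split; first exact: p1.
  exact: (Tlt (partial 'i%C f (z1 + t%:C * 'i%C)) (partial 'i%C f z) p2).
have B1 := slice_mean_value TP near1.
have B2 := slice_mean_value TP neari.
have -> : T (f w) - T (f z) - h * T (partial 1 f z) - k * T (partial 'i%C f z) =
    (T (f (z1 + k%:C * 'i%C)) - T (f z1) - k * T (partial 'i%C f z)) +
    (T (f (z + h%:C * 1)) - T (f z) - h * T (partial 1 f z)).
  by rewrite wE /z1; ring.
apply: le_trans (ler_normD _ _) _; apply: le_trans (lerD B2 B1) _.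
have := normr_ge0 h; have := normr_ge0 k; nra.
Qed.

(** The whole first-order remainder [r] is put into the quotient belonging to [w - z]; the other
    quotient stays constant. *)
Lemma C1_cdiff f z :
  (\forall w \near (z : R[i]^o), has_partial 1 f w /\ has_partial 'i%C f w) ->
  continuous_pt (partial 1 f) z -> continuous_pt (partial 'i%C f) z ->
  cdiff f z (del f z) (delbar f z).
Proof.
move=> hp c1 ci.
pose r w := f w - f z - (w - z) * del f z - cj (w - z) * delbar f z.
have rE w : r w = f w - f z - (complex.Re (w - z))%:C * partial 1 f z
    - (complex.Im (w - z))%:C * partial 'i%C f z.
  rewrite /r /del /delbar.
  have -> : cj (w - z) = (complex.Re (w - z))%:C - 'i%C * (complex.Im (w - z))%:C.
    by case: (w - z) => a b; apply/eqP; rewrite eq_complex /=; apply/andP; split; apply/eqP; ring.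
  have {1}-> : w - z = (complex.Re (w - z))%:C + 'i%C * (complex.Im (w - z))%:C.
    by case: (w - z) => a b; apply/eqP; rewrite eq_complex /=; apply/andP; split; apply/eqP; ring.
  have ii : 'i%C * 'i%C = -1 :> R[i] by rewrite -expr2 sqr_i.
  have n2 : (2 : R[i]) != 0 by rewrite pnatr_eq0.
  move: (complex.Re (w - z))%:C (complex.Im (w - z))%:C (partial 1 f z) (partial 'i%C f z) ii.
  move: 'i%C => i h k p q ii.
  have E : (2 : R[i]) / 2 = 1 by rewrite divff.
  have -> : f w - f z - (h + i * k) * ((p - i * q) / 2) - (h - i * k) * ((p + i * q) / 2) =
    f w - f z - h * p * (2 / 2) + (i * i) * k * q * (2 / 2) by ring.
  by rewrite E ii; ring.
(* Division by zero gives zero, which is exactly the value that this quotient must take at [z]. *)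
have E0 : r z / (z - z) = 0 by rewrite /r !subrr cj0 !mul0r !subr0 mul0r.
have small e : 0 < e -> \forall w \near (z : R[i]^o), `|r w / (w - z)| <= e%:C.
  move=> e0; have e4 : 0 < e / 4 by rewrite divr_gt0.
  have normRe w : `|complex.Re w| <= `|complex.Re w| + `|complex.Im w| by rewrite lerDl.
  have normIm w : `|complex.Im w| <= `|complex.Re w| + `|complex.Im w| by rewrite lerDr.
  have ReP : real_component (@complex.Re R) by move=> v g y [].
  have ImP : real_component (@complex.Im R) by move=> v g y [].
  have K1 := C1_increment (@ReB R) normRe ReP hp c1 ci e4.
  have K2 := C1_increment (@ImB R) normIm ImP hp c1 ci e4.
  suff key w : `|complex.Re (f w) - complex.Re (f z) - complex.Re (w - z) * complex.Re (partial 1 f z)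
       - complex.Im (w - z) * complex.Re (partial 'i%C f z)|
    <= e / 4 * (`|complex.Re (w - z)| + `|complex.Im (w - z)|) ->
    `|complex.Im (f w) - complex.Im (f z) - complex.Re (w - z) * complex.Im (partial 1 f z)
       - complex.Im (w - z) * complex.Im (partial 'i%C f z)|
    <= e / 4 * (`|complex.Re (w - z)| + `|complex.Im (w - z)|) ->
    `|r w / (w - z)| <= e%:C.
    by apply: filterS2 K1 K2 => w; exact: key.
  have [->|wz] := eqVneq w z.
    move=> _ _; rewrite E0 normr0.
    by have : 0%:C <= e%:C :> R[i] by rewrite lecR ltW.
  rewrite normrM normfV ler_pdivrMr ?normr_gt0 ?subr_eq0// => k1 k2.
  apply: (le_trans (normc_le_ReIm _)).
  rewrite rE !ReB !ImB !ReZ !ImZ.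
  have n1 := normc_ge_Re (w - z); have n2 := normc_ge_Im (w - z).
  have [m mE] : exists m : R, `|w - z| = m%:C by rewrite normc_def; eexists.
  rewrite mE -rmorphM /= lecR.
  rewrite mE !lecR ReB ImB in n1 n2.
  rewrite ReB ImB in k1 k2.
  by apply: le_trans (lerD k1 k2) _; nra.
have := @cdiffI R f z (fun w => del f z + r w / (w - z)) (fun=> delbar f z).
rewrite E0 addr0; apply.
- apply/continuous_ptP => e e0.
  have e2 : 0 < e / 2 by rewrite divr_gt0.
  suff key w : `|r w / (w - z)| <= (e / 2)%:C ->
     `|complex.Re ((del f z + r w / (w - z)) - (del f z + r z / (z - z)))| < e /\
     `|complex.Im ((del f z + r w / (w - z)) - (del f z + r z / (z - z)))| < e.
    by apply: filterS (small _ e2) => w; exact: key.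
  rewrite E0 addr0 addrAC subrr add0r => H.
  have H1 := le_trans (normc_ge_Re _) H; have H2 := le_trans (normc_ge_Im _) H.
  by rewrite !lecR in H1 H2; split; lra.
- exact: continuous_pt_cst.
apply: nearc => w; rewrite /linearized.
have [->|wz] := eqVneq w z; first by rewrite subrr cj0 !mul0r !addr0.
rewrite mulrDr [_ * (r w / _)]mulrCA divff ?subr_eq0// mulr1 /r.
move: (cj (w - z)) => x; ring.
Qed.

(** [Ck] with differentiability in the sense of [cdiff] at each order, which makes the closure
    properties algebraic. Passing from [Ck] costs one order, harmless for smooth functions. *)
Fixpoint Dk (k : nat) (U : set R[i]^o) f : Prop :=
  (forall z, U z -> cdiff f z (del f z) (delbar f z)) /\
  if k is k'.+1 then Dk k' U (partial 1 f) /\ Dk k' U (partial 'i%C f) else True.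

Lemma Dk_cdiff k (U : set R[i]^o) f z : Dk k U f -> U z ->
  cdiff f z (del f z) (delbar f z).
Proof. by case: k => [|k] [H _]; exact: H. Qed.

Lemma Dk_Ck k (U : set R[i]^o) f : Dk k U f -> Ck k U f.
Proof.
elim: k f => [|k IH] f [fU]; first by split=> // z /fU /cdiff_continuous.
move=> [D1 Di]; split=> [z /fU /cdiff_continuous//|].
split; [|exact: (IH _ D1)|exact: (IH _ Di)].
by move=> z /fU H; have [? _] := cdiff_partial 1 H; have [? _] := cdiff_partial 'i%C H.
Qed.

Lemma Ck_Dk k (U : set R[i]^o) f : open U -> Ck k.+1 U f -> Dk k U f.
Proof.
move=> oU.
have C0 n g : Ck n U g -> forall z, U z -> continuous_pt g z by case: n => [|n] [H _].
have base n g : Ck n.+1 U g -> forall z, U z -> cdiff g z (del g z) (delbar g z).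
  move=> [_ [hp c1 ci]] z Uz; apply: C1_cdiff.
  - by apply: (@filterS _ _ _ U); [exact: hp|exact: open_nbhs_nbhs].
  - exact: C0 c1 _ Uz.
  - exact: C0 ci _ Uz.
elim: k f => [|k IH] f H; first by split=> //; exact: base H.
split; first exact: base H.
by case: H => _ [_ c1 ci]; exact: (conj (IH _ c1) (IH _ ci)).
Qed.

Lemma DkS k (U : set R[i]^o) f : Dk k.+1 U f -> Dk k U f.
Proof.
elim: k f => [|k IH] f; first by case.
by move=> [H [H1 H2]]; exact: (conj H (conj (IH _ H1) (IH _ H2))).
Qed.

Lemma Dk_sub k (U V : set R[i]^o) f : V `<=` U -> Dk k U f -> Dk k V f.
Proof.
move=> VU; elim: k f => [|k IH] f [H H']; first by split=> // z /VU/H.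
split; first by move=> z /VU/H.
by case: H' => H1 H2; exact: (conj (IH _ H1) (IH _ H2)).
Qed.

Lemma Dk_eq k (U : set R[i]^o) f g : open U -> (forall z, U z -> f z = g z) ->
  Dk k U f -> Dk k U g.
Proof.
move=> oU; have nU z : U z -> \forall w \near (z : R[i]^o), U w.
  by move=> Uz; exact: open_nbhs_nbhs.
have G f' g' : (forall z, U z -> f' z = g' z) ->
    (forall z, U z -> cdiff f' z (del f' z) (delbar f' z)) ->
    (forall z, U z -> cdiff g' z (del g' z) (delbar g' z)) /\
    forall v z, U z -> partial v f' z = partial v g' z.
  move=> fg H.
  have H' z : U z -> cdiff g' z (del f' z) (delbar f' z).
    by move=> Uz; apply: cdiff_near (H z Uz); apply: filterS (nU z Uz) => w /fg.
  split=> [z Uz|v z Uz]; first by have [-> ->] := cdiff_del (H' z Uz); exact: H'.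
  have [_ ->] := cdiff_partial v (H z Uz).
  by have [_ ->] := cdiff_partial v (H' z Uz).
elim: k f g => [|k IH] f g fg [H H']; have [G1 G2] := G _ _ fg H.
  exact: (conj G1 I).
split; first exact: G1.
by case: H' => H1 H2; split; [apply: IH H1|apply: IH H2]; exact: G2.
Qed.

Lemma Dk_partial k (U : set R[i]^o) f v : Dk k.+1 U f -> v = 1 \/ v = 'i%C ->
  Dk k U (partial v f).
Proof. by move=> [_ [H1 H2]] [->|->]. Qed.

Lemma Dk0I (U : set R[i]^o) f (a b : R[i] -> R[i]) :
  (forall z, U z -> cdiff f z (a z) (b z)) -> Dk 0 U f.
Proof.
move=> H; split; last by [].
by move=> z Uz; have [-> ->] := cdiff_del (H z Uz); exact: H.
Qed.

(** The inductive step of the closure properties: the rules for [cdiff] supply [a] and [b], and it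
    remains to write [v a + cj v b], for both directions, as a function already known to be of class
    [k]. *)
Lemma DkSI k (U : set R[i]^o) f (a b : R[i] -> R[i]) : open U ->
  (forall z, U z -> cdiff f z (a z) (b z)) ->
  (forall v, v = 1 \/ v = 'i%C -> exists2 g, Dk k U g &
     forall z, U z -> g z = v * a z + cj v * b z) ->
  Dk k.+1 U f.
Proof.
move=> oU H D; split; first by case: (Dk0I H).
have P v z : U z -> v * a z + cj v * b z = partial v f z.
  by move=> Uz; have [_ ->] := cdiff_partial v (H z Uz).
have Q v : v = 1 \/ v = 'i%C -> Dk k U (partial v f).
  move=> /D[g Dg gE]; apply: (Dk_eq oU _ Dg) => z Uz.
  by rewrite (gE z Uz) P.
by split; apply: Q; [left|right].
Qed.

Lemma Dk_cst k (U : set R[i]^o) (c : R[i]) : open U -> Dk k U (fun=> c).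
Proof.
move=> oU; elim: k c => [|k IH] c.
  by apply: (@Dk0I _ _ (fun=> 0) (fun=> 0)) => z _; exact: cdiff_cst.
apply: (@DkSI _ _ _ (fun=> 0) (fun=> 0) oU) => [z _|v _]; first exact: cdiff_cst.
by exists (fun=> 0); [exact: IH|move=> z _; rewrite !mulr0 addr0].
Qed.

Lemma Dk_id k (U : set R[i]^o) : open U -> Dk k U id.
Proof.
move=> oU; case: k => [|k].
  by apply: (@Dk0I _ _ (fun=> 1) (fun=> 0)) => z _; exact: cdiff_id.
apply: (@DkSI _ _ _ (fun=> 1) (fun=> 0) oU) => [z _|v _]; first exact: cdiff_id.
by exists (fun=> v); [exact: Dk_cst|move=> z _; rewrite mulr0 addr0 mulr1].
Qed.

Lemma Dk_D k (U : set R[i]^o) f g : open U -> Dk k U f -> Dk k U g ->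
  Dk k U (fun z => f z + g z).
Proof.
move=> oU Df Dg.
have H m : Dk m U f -> Dk m U g -> forall z, U z ->
    cdiff (fun z => f z + g z) z (del f z + del g z) (delbar f z + delbar g z).
  by move=> Df' Dg' z Uz; apply: cdiffD; [exact: Dk_cdiff Df' Uz|exact: Dk_cdiff Dg' Uz].
elim: k f g H Df Dg => [|k IH] f g H Df Dg; first exact: Dk0I (H _ Df Dg).
apply: (DkSI oU (H _ Df Dg)) => v vE.
exists (fun z => partial v f z + partial v g z).
  apply: IH (Dk_partial Df vE) (Dk_partial Dg vE).
  by move=> m Df' Dg' z Uz; apply: cdiffD; [exact: Dk_cdiff Df' Uz|exact: Dk_cdiff Dg' Uz].
move=> z Uz; have [_ ->] := cdiff_partial v (Dk_cdiff Df Uz).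
by have [_ ->] := cdiff_partial v (Dk_cdiff Dg Uz); ring.
Qed.

Lemma Dk_conj k (U : set R[i]^o) f : open U -> Dk k U f ->
  Dk k U (fun z => cj (f z)).
Proof.
move=> oU; elim: k f => [|k IH] f Df;
  have H z (Uz : U z) := cdiff_conj (Dk_cdiff Df Uz).
  exact: Dk0I H.
apply: (DkSI oU H) => v vE.
exists (fun z => cj (partial v f z)); first exact: (IH _ (Dk_partial Df vE)).
move=> z Uz; have [_ ->] := cdiff_partial v (Dk_cdiff Df Uz).
by rewrite cjD !cjM cjK addrC.
Qed.

Lemma Dk_M k (U : set R[i]^o) f g : open U -> Dk k U f -> Dk k U g ->
  Dk k U (fun z => f z * g z).
Proof.
move=> oU; elim: k f g => [|k IH] f g Df Dg;
  have H z (Uz : U z) := cdiffM (Dk_cdiff Df Uz) (Dk_cdiff Dg Uz).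
  exact: Dk0I H.
apply: (DkSI oU H) => v vE.
exists (fun z => partial v f z * g z + f z * partial v g z).
  apply: (Dk_D oU (IH _ _ (Dk_partial Df vE) (DkS Dg))).
  exact: (IH _ _ (DkS Df) (Dk_partial Dg vE)).
move=> z Uz; have [_ ->] := cdiff_partial v (Dk_cdiff Df Uz).
by have [_ ->] := cdiff_partial v (Dk_cdiff Dg Uz); ring.
Qed.

Lemma Dk_V k (U : set R[i]^o) f : open U -> (forall z, U z -> f z != 0) ->
  Dk k U f -> Dk k U (fun z => (f z)^-1).
Proof.
move=> oU f0; elim: k => [|k IH] Df;
  have H z (Uz : U z) := cdiffV (f0 z Uz) (Dk_cdiff Df Uz).
  exact: Dk0I H.
apply: (DkSI oU H) => v vE.
have IH' := IH (DkS Df).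
exists (fun z => (-1 * partial v f z) * ((f z)^-1 * (f z)^-1)).
  apply: (Dk_M oU _ (Dk_M oU IH' IH')).
  exact: (Dk_M oU (Dk_cst _ _ oU) (Dk_partial Df vE)).
move=> z Uz; have [_ ->] := cdiff_partial v (Dk_cdiff Df Uz).
by rewrite expr2 invfM; ring.
Qed.

Lemma Dk_comp k (U V : set R[i]^o) f F : open U -> open V ->
  (forall z, U z -> V (F z)) -> Dk k U F -> Dk k V f ->
  Dk k U (fun z => f (F z)).
Proof.
move=> oU oV FV; elim: k f => [|k IH] f DF Df;
  have H z (Uz : U z) := cdiff_comp (Dk_cdiff DF Uz) (Dk_cdiff Df (FV z Uz)).
  exact: Dk0I H.
apply: (DkSI oU H) => v vE.
have DP u (uE : u = 1 \/ u = 'i%C) : Dk k U (fun z => partial u f (F z)).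
  exact: (IH _ (DkS DF) (Dk_partial Df uE)).
have D1 := DP 1 (or_introl erefl); have Di := DP 'i%C (or_intror erefl).
have DFv := Dk_partial DF vE.
have C c : Dk k U (fun=> c) by exact: Dk_cst.
(* [del f] and [delbar f] are written through the two partials, since the induction hypothesis
   speaks of these. *)
exists (fun z =>
    (partial 1 f (F z) + (- 'i%C) * partial 'i%C f (F z)) * 2^-1 * partial v F z +
    (partial 1 f (F z) + 'i%C * partial 'i%C f (F z)) * 2^-1 * cj (partial v F z)).
  apply: (Dk_D oU).
    exact: (Dk_M oU (Dk_M oU (Dk_D oU D1 (Dk_M oU (C _) Di)) (C _)) DFv).
  exact: (Dk_M oU (Dk_M oU (Dk_D oU D1 (Dk_M oU (C _) Di)) (C _)) (Dk_conj oU DFv)).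
move=> z Uz; have [_ ->] := cdiff_partial v (Dk_cdiff DF Uz).
rewrite cjD !cjM cjK /del /delbar mulNr.
move: (partial 1 f _) (partial 'i%C f _) (cj v) => p q v'; ring.
Qed.

End ContinuouslyDifferentiable.

(** * Germs of smooth functions and the rules for [del] and [delbar] *)

Section SmoothAt.
Variable R : realType.
Implicit Types (w z v : R[i]) (f g F : R[i] -> R[i]).

Lemma near_open (P : R[i] -> Prop) z : (\forall w \near (z : R[i]^o), P w) ->
  exists2 V : set R[i]^o, open V /\ V z & forall w, V w -> P w.
Proof.
move=> H; exists (interior (P : set R[i]^o)); last exact: (@interior_subset _ (P : set R[i]^o)).
by split; [exact: open_interior|exact: H].
Qed.

Lemma smooth_atP f z : smooth_at f z <->
  exists2 U : set R[i]^o, open U /\ U z & forall k, Dk k U f.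
Proof.
split; first by move=> [U [oU Uz H]]; exists U => // k; apply: Ck_Dk.
by move=> [U [oU Uz] H]; exists U; split=> // k; exact: Dk_Ck (H k).
Qed.

Lemma smooth_eq f g z : (\forall w \near (z : R[i]^o), f w = g w) ->
  smooth_at f z -> smooth_at g z.
Proof.
move=> fg /smooth_atP[U [oU Uz] H]; apply/smooth_atP.
have [V [oV Vz] VP] := near_open fg.
exists (U `&` V); first by split; [exact: openI|].
move=> k; apply: (@Dk_eq _ _ _ f); first exact: openI.
  by move=> w [_ /VP].
by apply: Dk_sub (H k) => w [].
Qed.

Lemma smooth_near f z : smooth_at f z ->
  \forall w \near (z : R[i]^o), smooth_at f w.
Proof.
move=> /smooth_atP[U [oU Uz] H].
apply: filterS (open_nbhs_nbhs (conj oU Uz)) => w Uw.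
by apply/smooth_atP; exists U.
Qed.

Lemma smooth_cdiff f z : smooth_at f z -> cdiff f z (del f z) (delbar f z).
Proof. by move=> /smooth_atP[U [oU Uz] /(_ 0%N) H]; exact: Dk_cdiff H Uz. Qed.

Lemma smooth_continuous f z : smooth_at f z -> continuous_pt f z.
Proof. by move=> /smooth_cdiff/cdiff_continuous. Qed.

Lemma smooth_partial v f z : v = 1 \/ v = 'i%C -> smooth_at f z ->
  smooth_at (partial v f) z.
Proof.
move=> vE /smooth_atP[U oU H]; apply/smooth_atP; exists U => // k.
exact: Dk_partial (H k.+1) vE.
Qed.

Lemma smooth_cst c z : smooth_at (fun=> c : R[i]) z.
Proof.
apply/smooth_atP; exists setT; first by split; [exact: openT|].
by move=> k; apply: Dk_cst; exact: openT.
Qed.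

Lemma smooth_id z : smooth_at (@id R[i]) z.
Proof.
apply/smooth_atP; exists setT; first by split; [exact: openT|].
by move=> k; apply: Dk_id; exact: openT.
Qed.

Lemma smooth_common f g z : smooth_at f z -> smooth_at g z ->
  exists2 U : set R[i]^o, open U /\ U z & forall k, Dk k U f /\ Dk k U g.
Proof.
move=> /smooth_atP[U [oU Uz] H] /smooth_atP[V [oV Vz] H'].
exists (U `&` V); first by split; [exact: openI|].
by move=> k; split; [apply: Dk_sub (H k) => w []|apply: Dk_sub (H' k) => w []].
Qed.

Lemma smoothD f g z : smooth_at f z -> smooth_at g z ->
  smooth_at (fun w => f w + g w) z.
Proof.
move=> sf sg; have [U [oU Uz] H] := smooth_common sf sg.
apply/smooth_atP; exists U => // k; exact: Dk_D oU (H k).1 (H k).2.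
Qed.

Lemma smoothM f g z : smooth_at f z -> smooth_at g z ->
  smooth_at (fun w => f w * g w) z.
Proof.
move=> sf sg; have [U [oU Uz] H] := smooth_common sf sg.
apply/smooth_atP; exists U => // k; exact: Dk_M oU (H k).1 (H k).2.
Qed.

Lemma smoothN f z : smooth_at f z -> smooth_at (fun w => - f w) z.
Proof.
move=> sf; apply: (smooth_eq _ (smoothM (smooth_cst (-1) z) sf)).
by apply: nearc => w; rewrite mulN1r.
Qed.

Lemma smoothB f g z : smooth_at f z -> smooth_at g z ->
  smooth_at (fun w => f w - g w) z.
Proof. by move=> sf sg; exact: smoothD sf (smoothN sg). Qed.

Lemma smooth_cj f z : smooth_at f z -> smooth_at (fun w => cj (f w)) z.
Proof.
move=> /smooth_atP[U [oU Uz] H].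
apply/smooth_atP; exists U => // k; exact: Dk_conj oU (H k).
Qed.

Lemma smoothV f z : f z != 0 -> smooth_at f z ->
  smooth_at (fun w => (f w)^-1) z.
Proof.
move=> fz sf; have cf := smooth_continuous sf.
have f0 : \forall w \near (z : R[i]^o), f w != 0.
  exact: (@cvgr_neq0 _ R[i]^o R[i]^o _ _ f (f z) cf fz).
move: sf f0 => /smooth_atP[U [oU Uz] H] /near_open[V [oV Vz] VP].
apply/smooth_atP; exists (U `&` V); first by split; [exact: openI|].
move=> k; apply: Dk_V; [exact: openI|by move=> w [_ /VP]|].
by apply: Dk_sub (H k) => w [].
Qed.

Lemma smooth_comp f F z : smooth_at F z -> smooth_at f (F z) ->
  smooth_at (fun w => f (F w)) z.
Proof.
move=> sF; have cF := smooth_continuous sF.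
move: sF => /smooth_atP[U [oU Uz] H] /smooth_atP[V [oV Vz] H'].
have := cF _ (open_nbhs_nbhs (conj oV Vz)) => /near_open[W [oW Wz] WP].
apply/smooth_atP; exists (U `&` W); first by split; [exact: openI|].
move=> k; apply: (@Dk_comp _ _ _ V); [exact: openI|exact: oV| | |exact: H'].
  by move=> w [_ /WP].
by apply: Dk_sub (H k) => w [].
Qed.

Lemma smooth_big (op : R[i] -> R[i] -> R[i]) (x0 : R[i]) (I : Type) (r : seq I)
    (P : pred I) (F : I -> R[i] -> R[i]) z :
  (forall f g, smooth_at f z -> smooth_at g z -> smooth_at (fun w => op (f w) (g w)) z) ->
  (forall i, P i -> smooth_at (F i) z) ->
  smooth_at (fun w => \big[op/x0]_(i <- r | P i) F i w) z.
Proof.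
move=> sop H; elim: r => [|i r IH].
  by apply: (smooth_eq _ (smooth_cst x0 z)); apply: nearc => w; rewrite big_nil.
case Pi : (P i); [apply: (smooth_eq _ (sop _ _ (H i Pi) IH))|apply: (smooth_eq _ IH)];
  by apply: nearc => w; rewrite big_cons Pi.
Qed.

Lemma smooth_sum (I : Type) (r : seq I) (P : pred I) (F : I -> R[i] -> R[i]) z :
  (forall i, P i -> smooth_at (F i) z) ->
  smooth_at (fun w => \sum_(i <- r | P i) F i w) z.
Proof. by move=> H; apply: (@smooth_big +%R 0 I r P F z) H => f g; exact: smoothD. Qed.

Lemma smooth_prod (I : Type) (r : seq I) (P : pred I) (F : I -> R[i] -> R[i]) z :
  (forall i, P i -> smooth_at (F i) z) ->
  smooth_at (fun w => \prod_(i <- r | P i) F i w) z.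
Proof. by move=> H; apply: (@smooth_big *%R 1 I r P F z) H => f g; exact: smoothM. Qed.

Lemma smooth_del f z : smooth_at f z -> smooth_at (del f) z.
Proof.
move=> sf; apply: smoothM; last exact: smooth_cst.
apply: smoothB; first exact: (smooth_partial (or_introl erefl) sf).
exact: smoothM (smooth_cst _ _) (smooth_partial (or_intror erefl) sf).
Qed.

Lemma smooth_delbar f z : smooth_at f z -> smooth_at (delbar f) z.
Proof.
move=> sf; apply: smoothM; last exact: smooth_cst.
apply: smoothD; first exact: (smooth_partial (or_introl erefl) sf).
exact: smoothM (smooth_cst _ _) (smooth_partial (or_intror erefl) sf).
Qed.

Lemma del_eq f g z : smooth_at f z -> (\forall w \near (z : R[i]^o), f w = g w) ->
  del g z = del f z /\ delbar g z = delbar f z.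
Proof. by move=> sf fg; exact: cdiff_del (cdiff_near fg (smooth_cdiff sf)). Qed.

Lemma del_cst c z : del (fun=> c : R[i]) z = 0 /\ delbar (fun=> c) z = 0.
Proof. exact: cdiff_del (cdiff_cst c z). Qed.

Lemma del_id z : del (@id R[i]) z = 1 /\ delbar (@id R[i]) z = 0.
Proof. exact: cdiff_del (cdiff_id z). Qed.

Lemma delD f g z : smooth_at f z -> smooth_at g z ->
  del (fun w => f w + g w) z = del f z + del g z /\
  delbar (fun w => f w + g w) z = delbar f z + delbar g z.
Proof.
by move=> sf sg; exact: cdiff_del (cdiffD (smooth_cdiff sf) (smooth_cdiff sg)).
Qed.

Lemma delM f g z : smooth_at f z -> smooth_at g z ->
  del (fun w => f w * g w) z = del f z * g z + f z * del g z /\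
  delbar (fun w => f w * g w) z = delbar f z * g z + f z * delbar g z.
Proof.
by move=> sf sg; exact: cdiff_del (cdiffM (smooth_cdiff sf) (smooth_cdiff sg)).
Qed.

Lemma delZ c f z : smooth_at f z ->
  del (fun w => c * f w) z = c * del f z /\
  delbar (fun w => c * f w) z = c * delbar f z.
Proof.
move=> sf; have [-> ->] := delM (smooth_cst c z) sf; have [-> ->] := del_cst c z.
by rewrite !mul0r !add0r.
Qed.

Lemma delN f z : smooth_at f z ->
  del (fun w => - f w) z = - del f z /\ delbar (fun w => - f w) z = - delbar f z.
Proof.
move=> sf; have E : \forall w \near (z : R[i]^o), -1 * f w = - f w.
  by apply: nearc => w; rewrite mulN1r.
have [-> ->] := del_eq (smoothM (smooth_cst (-1) z) sf) E.
by have [-> ->] := delZ (-1) sf; rewrite !mulN1r.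
Qed.

Lemma delB f g z : smooth_at f z -> smooth_at g z ->
  del (fun w => f w - g w) z = del f z - del g z /\
  delbar (fun w => f w - g w) z = delbar f z - delbar g z.
Proof.
move=> sf sg; have [-> ->] := delD sf (smoothN sg).
by have [-> ->] := delN sg.
Qed.

Lemma del_cj f z : smooth_at f z ->
  del (fun w => cj (f w)) z = cj (delbar f z) /\
  delbar (fun w => cj (f w)) z = cj (del f z).
Proof. by move=> sf; exact: cdiff_del (cdiff_conj (smooth_cdiff sf)). Qed.

Lemma del_comp f F z : smooth_at F z -> smooth_at f (F z) ->
  del (fun w => f (F w)) z =
    del F z * del f (F z) + cj (delbar F z) * delbar f (F z) /\
  delbar (fun w => f (F w)) z =
    delbar F z * del f (F z) + cj (del F z) * delbar f (F z).
Proof.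
by move=> sF sf; exact: cdiff_del (cdiff_comp (smooth_cdiff sF) (smooth_cdiff sf)).
Qed.

Lemma partial_cj v f z : smooth_at f z ->
  partial v (fun w => cj (f w)) z = cj (partial v f z).
Proof.
move=> sf; have H := smooth_cdiff sf.
have [_ ->] := cdiff_partial v H; have [_ ->] := cdiff_partial v (cdiff_conj H).
by rewrite cjD !cjM cjK addrC.
Qed.

Lemma partial_eq v f g z : smooth_at f z ->
  (\forall w \near (z : R[i]^o), f w = g w) -> partial v g z = partial v f z.
Proof.
move=> sf fg; have H := smooth_cdiff sf.
by have [_ ->] := cdiff_partial v H; have [_ ->] := cdiff_partial v (cdiff_near fg H).
Qed.

Lemma near_near (P : R[i] -> Prop) z : (\forall w \near (z : R[i]^o), P w) ->
  \forall w \near (z : R[i]^o), \forall u \near (w : R[i]^o), P u.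
Proof.
move=> /near_open[V [oV Vz] VP].
apply: filterS (open_nbhs_nbhs (conj oV Vz)) => w Vw.
by apply: filterS (open_nbhs_nbhs (conj oV Vw)) => u /VP.
Qed.

End SmoothAt.

(** * First and second order conditions at a minimum *)

Section MinimumTest.
Variable R : realType.

(** Since [g' 0 = 0], a negative [l] makes [g'] negative just to the right of [0]; the mean value
    theorem then produces a value of [g] below [g 0]. *)
Lemma second_derivative_min (g g' : R -> R) (l : R) :
  (\forall t \near (0 : R), derivable g t 1 /\ derive1 g t = g' t) ->
  derivable g' 0 1 -> derive1 g' 0 = l ->
  (\forall t \near (0 : R), g 0 <= g t) -> g' 0 = 0 /\ 0 <= l.
Proof.
move=> dg dg' gl gmin.
have /nbhs_ballP[d /= d0 dP] : \forall t \near (0 : R),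
    (derivable g t 1 /\ derive1 g t = g' t) /\ g 0 <= g t by exact: filterI.
have ball0 t : `|t| < d -> (derivable g t 1 /\ derive1 g t = g' t) /\ g 0 <= g t.
  by move=> td; apply: dP; rewrite /ball /= sub0r normrN.
have mvt (b : R) : 0 < b -> b < d ->
    exists2 c, 0 < c < b & g b - g 0 = g' c * b.
  move=> b0 bd.
  have sub (t : R) : 0 <= t <= b -> `|t| < d.
    by move=> /andP[t0 tb]; rewrite ger0_norm// (le_lt_trans tb).
  have [|t tb||c cb E] := @MVT _ g g' 0 b.
  - exact: b0.
  - have [|[dt gt] _] := ball0 t.
      by apply: sub; move: tb; rewrite in_itv /= => /andP[? ?]; rewrite !ltW.
    by rewrite -gt derive1E; exact: derivableP.
  - apply: derivable_within_continuous => t tb.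
    have [|[dt gt] _ //] := ball0 t.
    by apply: sub; move: tb; rewrite in_itv.
  by exists c; [move: cb; rewrite in_itv|rewrite E subr0].
have g0 : g' 0 = 0.
  have [[d1 <-] _] := ball0 0 ltac:(by rewrite normr0).
  have sub (t : R) : t \in `]- d, d[ -> `|t| < d.
    by rewrite in_itv /= => /andP[t0 t1]; rewrite ltr_norml t0.
  have md : - d <= d by rewrite ge0_cp// ltW.
  have z0 : (0 : R) \in `]- d, d[ by rewrite in_itv /= oppr_lt0 d0.
  have D t : t \in `]- d, d[ -> derivable g t 1 by move=> /sub/ball0[[]].
  have M t : t \in `]- d, d[ -> g 0 <= g t by move=> /sub/ball0[].
  by have H := derive1_at_min md D z0 M; rewrite derive1E derive_val.
split=> //.
rewrite leNgt; apply/negP => l0.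
have Q : h^-1 *: ((g' \o shift 0) (h *: 1) - g' 0) @[h --> 0^'] --> l.
  by rewrite -gl derive1E; exact: dg'.
have nl0 : 0 < - l by rewrite oppr_gt0.
move/cvgrPdist_lt : Q => /(_ _ nl0) /nbhs_ballP[e /= e0 eP].
(* Below [e] the difference quotient of [g'] is within [- l] of [l], hence negative; below [d]
   minimality and the mean value theorem are available. *)
pose b := Num.min e d / 2.
have m0 : 0 < Num.min e d by rewrite lt_min e0.
have b0 : 0 < b by rewrite divr_gt0.
have bm : b < Num.min e d by rewrite /b; lra.
move: bm; rewrite lt_min => /andP[be bd].
have [c /andP[c0 cb] E] := mvt b b0 bd.
have [_ gb] : (derivable g b 1 /\ derive1 g b = g' b) /\ g 0 <= g b.
  by apply: ball0; rewrite ger0_norm// ltW.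
have : `|l - c^-1 *: ((g' \o shift 0) (c *: 1) - g' 0)| < - l.
  apply: eP; last by rewrite /= gt_eqF.
  by rewrite /ball /= sub0r normrN ger0_norm ?(lt_trans cb)// ltW.
rewrite /= /shift /= addr0 g0 subr0 [c *: 1]mulr1 ltr_norml => /andP[H _].
have H2 : c^-1 *: g' c < 0 by lra.
have g'c : g' c < 0 by rewrite -(pmulr_rlt0 _ (x := c^-1)) ?invr_gt0.
have : g' c * b < 0 by rewrite pmulr_llt0.
by rewrite -E subr_lt0 ltNge gb.
Qed.

Implicit Types (z v w : R[i]) (u f g : R[i] -> R[i]).

Lemma Re_partial_min v u z : v = 1 \/ v = 'i%C -> smooth_at u z ->
  (\forall w \near (z : R[i]^o), complex.Re (u z) <= complex.Re (u w)) ->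
  complex.Re (partial v u z) = 0 /\ 0 <= complex.Re (partial v (partial v u) z).
Proof.
move=> vE su um.
have su' := smooth_partial vE su.
have [[d _] dE] := cdiff_partial v (smooth_cdiff su').
have := @second_derivative_min (fun t => complex.Re (slice v u z t))
  (fun t => complex.Re (slice v (partial v u) z t))
  (complex.Re (partial v (partial v u) z)).
rewrite /slice mul0r addr0; apply.
- have H : \forall w \near (z : R[i]^o), has_partial v u w.
    by apply: filterS (smooth_near su) => w /smooth_cdiff/(cdiff_partial v)[].
  apply: filterS (near_line v H) => t [dt _].
  have E : (fun s : R => complex.Re (u (z + (s + t)%:C * v))) =
      (fun s => complex.Re (slice v u (z + t%:C * v) s)).
    apply/funext => s; congr (complex.Re (u _)); rewrite rmorphD /= mulrDl.
    by rewrite -addrA (addrC (t%:C * v)).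
  have [|d3 d4] := @derivable_shift _ (fun s => complex.Re (u (z + s%:C * v))) t.
    by rewrite E.
  by split=> //; rewrite d4 E.
- exact: d.
- by [].
- exact: (near_line v um).
Qed.

(** [del (delbar u)] is a quarter of the Laplacian plus a multiple of ['i] by mixed partials, which
    are real because [u] is real near [z]. Its real part therefore sees only the two pure second
    derivatives. *)
Lemma smooth_min u z : smooth_at u z ->
  (\forall w \near (z : R[i]^o), 0 <= u w) -> u z = 0 ->
  [/\ del u z = 0, delbar u z = 0 & 0 <= complex.Re (del (delbar u) z)].
Proof.
move=> su u0 uz.
have ur : \forall w \near (z : R[i]^o), u w = cj (u w).
  by apply: filterS u0 => w; case: (u w) => a b; rewrite lecE /= => /andP[/eqP -> _]; rewrite /cj /= oppr0.
have pr v w : v = 1 \/ v = 'i%C -> smooth_at u w ->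
    (\forall x \near (w : R[i]^o), u x = cj (u x)) -> partial v u w = cj (partial v u w).
  by move=> vE sw Hw; rewrite -[RHS](partial_cj v sw); rewrite (partial_eq v sw Hw).
have ppr v v' : v = 1 \/ v = 'i%C -> v' = 1 \/ v' = 'i%C ->
    partial v (partial v' u) z = cj (partial v (partial v' u) z).
  move=> vE vE'; have sp := smooth_partial vE' su.
  rewrite -[RHS](partial_cj v sp) (partial_eq v sp)//.
  by apply: filterS2 (smooth_near su) (near_near ur) => w; exact: pr.
have Im0 (x : R[i]) : x = cj x -> complex.Im x = 0.
  by case: x => a b [/eqP]; rewrite -subr_eq0 opprK -mulr2n mulrn_eq0 /= => /eqP.
have um : \forall w \near (z : R[i]^o), complex.Re (u z) <= complex.Re (u w).
  by apply: filterS u0 => w; rewrite uz lecE => /andP[_].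
have o1 : (1 : R[i]) = 1 \/ (1 : R[i]) = 'i%C by left.
have oi : ('i%C : R[i]) = 1 \/ ('i%C : R[i]) = 'i%C by right.
have [r1 q1] := Re_partial_min o1 su um.
have [ri qi] := Re_partial_min oi su um.
have eta (x : R[i]) : complex.Re x = 0 -> complex.Im x = 0 -> x = 0.
  by case: x => a b /= -> ->.
have p1 : partial 1 u z = 0 by apply: eta r1 (Im0 _ (pr _ _ o1 su ur)).
have pi' : partial 'i%C u z = 0 by apply: eta ri (Im0 _ (pr _ _ oi su ur)).
split; rewrite ?[del u z]/del ?[delbar u z]/delbar ?p1 ?pi' ?mulr0 ?subr0 ?addr0 ?mul0r//.
have sp1 := smooth_partial o1 su; have spi := smooth_partial oi su.
have E : del (delbar u) z = (partial 1 (partial 1 u) z + 'i%C * partial 1 (partial 'i%C u) z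
   - 'i%C * partial 'i%C (partial 1 u) z + partial 'i%C (partial 'i%C u) z) / 4.
  have P v : partial v (delbar u) z = (partial v (partial 1 u) z + 'i%C * partial v (partial 'i%C u) z) / 2.
    have C c := smooth_cdiff (smooth_cst c z).
    have := cdiff_partial v (cdiffM (cdiffD (smooth_cdiff sp1)
       (cdiffM (smooth_cdiff (smooth_cst 'i%C z)) (smooth_cdiff spi)))
       (smooth_cdiff (smooth_cst 2^-1 z))) => -[_].
    change (delbar u) with (fun w => (partial 1 u w + 'i%C * partial 'i%C u w) * 2^-1) => ->.
    have [_ ->] := cdiff_partial v (smooth_cdiff sp1).
    have [_ ->] := cdiff_partial v (smooth_cdiff spi).
    have [-> ->] := del_cst 'i%C z; have [-> ->] := del_cst (2^-1 : R[i]) z.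
    rewrite !mul0r !mulr0 !addr0 !add0r; move: (cj v) => v'.
    move: (del (partial 1 u) z) (delbar (partial 1 u) z) (del (partial 'i%C u) z) (delbar (partial 'i%C u) z) => a b c d.
    move: ('i%C : R[i]) (2^-1 : R[i]) => i h; ring.
  rewrite {1}/del !P.
  have ii : 'i%C * 'i%C = -1 :> R[i] by rewrite -expr2 sqr_i.
  have -> : (4 : R[i]) = 2 * 2 by rewrite -natrM.
  rewrite invfM.
  move: (partial 1 (partial 1 u) z) (partial 1 (partial 'i%C u) z)
    (partial 'i%C (partial 1 u) z) (partial 'i%C (partial 'i%C u) z) => a b c d.
  have -> : ((a + 'i%C * b) / 2 - 'i%C * ((c + 'i%C * d) / 2)) / 2 =
     (a + 'i%C * b - 'i%C * c - ('i%C * 'i%C) * d) * (2^-1 * 2^-1) by ring.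
  by rewrite ii; ring.
rewrite E.
have -> : (4 : R[i])^-1 = (4^-1 : R)%:C by rewrite -[4]/(4%:R) -(rmorph_nat (real_complex R)) fmorphV.
rewrite mulrC ReZ mulr_ge0 ?invr_ge0//.
have Imr v v' : v = 1 \/ v = 'i%C -> v' = 1 \/ v' = 'i%C ->
    complex.Im (partial v (partial v' u) z) = 0.
  by move=> vE vE'; exact: Im0 (ppr _ _ vE vE').
move: q1 qi (Imr _ _ o1 oi) (Imr _ _ oi o1).
move: (partial 1 (partial 1 u) z) (partial 1 (partial 'i%C u) z)
  (partial 'i%C (partial 1 u) z) (partial 'i%C (partial 'i%C u) z).
by move=> [? ?] [? ?] [? ?] [? ?] /=; lra.
Qed.

End MinimumTest.

(** * The mixed derivative of a logarithm *)

Section LogCurvature.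
Variable R : realType.
Implicit Types (z w : R[i]) (f g F : R[i] -> R[i]).

(* [lcurv f] is the mixed derivative of [log f], without the logarithm. *)
Definition lcurv f z : R[i] :=
  (f z * del (delbar f) z - del f z * delbar f z) / f z ^+ 2.

Lemma lcurv_eq f g z : smooth_at f z -> (\forall w \near (z : R[i]^o), f w = g w) ->
  lcurv g z = lcurv f z.
Proof.
move=> sf fg; rewrite /lcurv; have [-> ->] := del_eq sf fg.
rewrite -(nbhs_singleton fg).
have E : \forall w \near (z : R[i]^o), delbar f w = delbar g w.
  by apply: filterS2 (smooth_near sf) (near_near fg) => w sw /(del_eq sw)[_ ->].
by have [-> _] := del_eq (smooth_delbar sf) E.
Qed.

Lemma deldelbarM f g z : smooth_at f z -> smooth_at g z ->
  del (delbar (fun w => f w * g w)) z =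
  del (delbar f) z * g z + delbar f z * del g z + del f z * delbar g z +
  f z * del (delbar g) z.
Proof.
move=> sf sg.
have E : \forall w \near (z : R[i]^o),
    delbar f w * g w + f w * delbar g w = delbar (fun w => f w * g w) w.
  by apply: filterS2 (smooth_near sf) (smooth_near sg) => w fw /(delM fw)[_ ->].
have sb := smooth_delbar sf; have sb' := smooth_delbar sg.
have [-> _] := del_eq (smoothD (smoothM sb sg) (smoothM sf sb')) E.
have [-> _] := delD (smoothM sb sg) (smoothM sf sb').
have [-> _] := delM sb sg; have [-> _] := delM sf sb'.
by rewrite !addrA.
Qed.

Lemma lcurvM f g z : smooth_at f z -> smooth_at g z -> f z != 0 -> g z != 0 ->
  lcurv (fun w => f w * g w) z = lcurv f z + lcurv g z.
Proof.
move=> sf sg f0 g0; rewrite /lcurv deldelbarM//.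
have [-> ->] := delM sf sg.
move: (f z) (g z) (del f z) (delbar f z) (del g z) (delbar g z) (del (delbar f) z)
  (del (delbar g) z) f0 g0 => a b a1 a2 b1 b2 a3 b3 a0 b0.
by field; rewrite a0 b0.
Qed.

(** This is the maximum principle used throughout. [g - f] has the minimum [0] at [z], so values and
    first derivatives of [f] and [g] agree there, and the two sides differ by the mixed derivative
    of [g - f] divided by [f z]. *)
Lemma lcurv_le f g z : smooth_at f z -> smooth_at g z ->
  (\forall w \near (z : R[i]^o), f w <= g w) -> f z = g z -> 0 < f z ->
  complex.Re (lcurv f z) <= complex.Re (lcurv g z).
Proof.
move=> sf sg fg fgz f0.
have sb := smoothB sg sf.
have [||e1 e2 e3] := smooth_min sb.
- by apply: filterS fg => w; rewrite subr_ge0.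
- by rewrite fgz subrr.
move: e1 e2; have [-> ->] := delB sg sf => /subr0_eq e1 /subr0_eq e2.
have E : \forall w \near (z : R[i]^o),
    delbar g w - delbar f w = delbar (fun w => g w - f w) w.
  by apply: filterS2 (smooth_near sf) (smooth_near sg) => w fw gw; have [_ ->] := delB gw fw.
have [E1 _] := del_eq (smoothB (smooth_delbar sg) (smooth_delbar sf)) E.
move: e3; rewrite E1; have [-> _] := delB (smooth_delbar sg) (smooth_delbar sf) => e3.
rewrite -subr_ge0 -ReB /lcurv -fgz e1 e2 -mulrBl.
have -> : f z * del (delbar g) z - del f z * delbar f z -
   (f z * del (delbar f) z - del f z * delbar f z) =
   f z * (del (delbar g) z - del (delbar f) z).
  move: (f z) (del f z) (delbar f z) (del (delbar g) z) (del (delbar f) z).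
  by move=> a b c d e; ring.
move: (f z) f0 (del (delbar g) z - del (delbar f) z) e3 => p p0 d d0.
have r0 : 0 < complex.Re p by move: p0; rewrite ltcE => /andP[].
have -> : p * d / p ^+ 2 = (complex.Re p)^-1%:C * d.
  have -> : (complex.Re p)^-1%:C = p^-1.
    rewrite fmorphV; congr (_^-1).
    by move: p0; case: (p) => a b; rewrite ltcE /= => /andP[/eqP -> _].
  by rewrite expr2 invfM mulrACA divff ?mul1r 1?mulrC// gt_eqF.
by rewrite ReZ mulr_ge0 ?invr_ge0// ltW.
Qed.

(** For holomorphic [F] only [cj (del F)] times [delbar f] survives in the [delbar] of the
    composite; the hypothesis on [delbar (del F)] says that this factor [cj (del F)] is killed by
    [del]. *)
Lemma lcurv_comp f F z : smooth_at F z -> smooth_at f (F z) ->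
  (\forall w \near (z : R[i]^o), delbar F w = 0) -> delbar (del F) z = 0 ->
  lcurv (fun w => f (F w)) z = del F z * cj (del F z) * lcurv f (F z).
Proof.
move=> sF sf hol dF; have cF := smooth_continuous sF.
have sfn : \forall w \near (z : R[i]^o), smooth_at f (F w) by exact: cF (smooth_near sf).
have E : \forall w \near (z : R[i]^o),
    cj (del F w) * delbar f (F w) = delbar (fun w => f (F w)) w.
  apply: filterS3 (smooth_near sF) sfn hol => w sFw sfw h0.
  by have [_ ->] := del_comp sFw sfw; rewrite h0 mul0r add0r.
have s1 := smooth_cj (smooth_del sF).
have s2 : smooth_at (fun w => delbar f (F w)) z.
  exact: (@smooth_comp _ (delbar f) _ _ sF (smooth_delbar sf)).
rewrite /lcurv; have [-> _] := del_eq (smoothM s1 s2) E.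
have [-> _] := delM s1 s2; have [-> _] := del_cj (smooth_del sF).
have [-> _] := @del_comp _ (delbar f) _ _ sF (smooth_delbar sf).
have [-> ->] := del_comp sF sf.
rewrite dF (nbhs_singleton hol) cj0 !mul0r !addr0 !add0r.
move: (f (F z)) (del F z) (cj (del F z)) (del f (F z)) (delbar f (F z)) (del (delbar f) (F z)).
by move=> a b c d e g; ring.
Qed.

End LogCurvature.

(** * Exponential, local logarithms, and barrier functions of the real part *)

Section ExpLog.
Variable R : realType.
Implicit Types (z w : R[i]) (f g F : R[i] -> R[i]).

(** As [2 Re (w - z) = (w - z) + cj (w - z)], half the real difference quotient serves in both
    directions. *)
Lemma cdiff_real (g : R -> R) (l : R) z : is_derive (complex.Re z) 1 g l ->
  cdiff (fun w => (g (complex.Re w))%:C) z (l / 2)%:C (l / 2)%:C.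
Proof.
move=> gl; have [dg gE] := gl.
pose x := complex.Re z.
pose k (y : R) := if y == x then l else (g y - g x) / (y - x).
pose phi w := (k (complex.Re w) / 2)%:C.
have ck : continuous_pt phi z.
  apply/continuous_ptP => e e0.
  have Q : h^-1 *: ((g \o shift x) (h *: 1) - g x) @[h --> 0^'] --> l.
    by rewrite -gE; exact: dg.
  move/cvgrPdist_lt : Q => /(_ _ e0) /nbhs_ballP[d /= d0 dP].
  apply/nbhs_box; exists d => [//|w wr _].
  rewrite /phi /= subrr normr0; split=> //.
  rewrite /k -/x eqxx; case: eqVneq => [_|wx]; first by rewrite subrr normr0.
  have wx0 : complex.Re w - x != 0 by rewrite subr_eq0.
  have : `|l - (complex.Re w - x)^-1 *: ((g \o shift x) ((complex.Re w - x) *: 1) - g x)| < e.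
    apply: dP => //; rewrite /ball /= sub0r normrN.
    by move: wr; rewrite ReB.
  rewrite /= /shift /= [_ *: 1]mulr1 subrK [_ *: _]mulrC distrC => H.
  rewrite -mulrBl normrM (ger0_norm (_ : 0 <= 2^-1 :> R)) ?invr_ge0//.
  apply: le_lt_trans H; rewrite ler_piMr//; lra.
have E : phi z = (l / 2)%:C by rewrite /phi /k eqxx.
rewrite -E; apply: cdiffI => //; apply: nearc => w; rewrite /linearized.
have EE : (w - z) + cj (w - z) = (2 * (complex.Re w - x))%:C.
  rewrite /x; case: (w) => a b; case: (z) => c d; apply/eqP; rewrite eq_complex /=.
  by apply/andP; split; apply/eqP; ring.
rewrite -addrA -mulrDl EE /phi -rmorphM -rmorphD; congr (_%:C).
rewrite /k -/x; case: eqVneq => [->|wx]; first by rewrite subrr mulr0 mul0r addr0.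
by field; rewrite subr_eq0.
Qed.

Lemma cdiff_cexp z : cdiff (@cexp R) z (cexp z) 0.
Proof.
set x := complex.Re z; set y := complex.Im z.
have D1 := cdiff_real (is_derive_expR x : is_derive (complex.Re z) 1 expR (expR x)).
(* [Im w] is [Re (- 'i w)], so that the cosine and the sine also become functions of a real part. *)
have Dm : cdiff (fun w => - 'i%C * w) z (- 'i%C) 0.
  have := cdiffM (cdiff_cst (- 'i%C) z) (cdiff_id z).
  by rewrite !mul0r mulr1 mulr0 !add0r.
have yE : complex.Re (- 'i%C * z) = y.
  by rewrite /y; case: (z) => a b /=; ring.
have Dc := cdiff_comp Dm (cdiff_real (is_derive_cos (complex.Re (- 'i%C * z)))).
have Ds := cdiff_comp Dm (cdiff_real (is_derive_sin (complex.Re (- 'i%C * z)))).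
have := cdiffM D1 (cdiffD Dc (cdiffM (cdiff_cst 'i%C z) Ds)).
rewrite yE cj0 cjN cji opprK !mul0r !add0r !addr0.
set A := (X in cdiff _ _ X _); set B := (X in cdiff _ _ _ X).
have reE (u : R) : (u / 2)%:C = u%:C * 2^-1.
  by rewrite rmorphM fmorphV rmorph_nat.
have ii : 'i%C * 'i%C = -1 :> R[i] by rewrite -expr2 sqr_i.
have cE : cexp z = (expR x)%:C * ((cos y)%:C + 'i%C * (sin y)%:C).
  rewrite /cexp -/x -/y; congr (_ * _); apply/eqP; rewrite eq_complex /=.
  by apply/andP; split; apply/eqP; ring.
have -> : A = cexp z.
  rewrite /A cE !reE rmorphN /=.
  move: (expR x)%:C (cos y)%:C (sin y)%:C ('i%C : R[i]) ii => e c s i ii.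
  have h2 : (2^-1 + 2^-1 : R[i]) = 1 by rewrite [RHS]splitr div1r.
  move: (2^-1 : R[i]) h2 => h h2.
  have -> : e * h * (c + i * s) + e * (- i * (- s * h) + i * (- i * (c * h))) =
    e * (h + - (i * i) * h) * c + e * (h + h) * i * s by ring.
  by rewrite ii opprK mul1r h2; ring.
have -> : B = 0.
  rewrite /B !reE rmorphN /=.
  move: (expR x)%:C (cos y)%:C (sin y)%:C ('i%C : R[i]) ii => e c s i ii.
  move: (2^-1 : R[i]) => h.
  have -> : e * h * (c + i * s) + e * (i * (- s * h) + i * (i * (c * h))) =
    e * h * c * (1 + i * i) by ring.
  by rewrite ii subrr mulr0.
apply: cdiff_near; apply: nearc => w.
have -> : complex.Re (- 'i%C * w) = complex.Im w by case: (w) => a b /=; ring.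
rewrite /cexp; congr (_ * _); apply/eqP; rewrite eq_complex /=.
by apply/andP; split; apply/eqP; ring.
Qed.

Lemma smooth_cexp z : smooth_at (@cexp R) z.
Proof.
apply/smooth_atP; exists setT; first by split; [exact: openT|].
elim=> [|k IH]; first exact: (Dk0I (fun z _ => cdiff_cexp z)).
apply: (DkSI openT (fun z _ => cdiff_cexp z)) => v _.
exists (fun w => v * cexp w); first exact: (Dk_M openT (Dk_cst _ _ openT) IH).
by move=> w _; rewrite mulr0 addr0.
Qed.

Lemma del_cexp z : del (@cexp R) z = cexp z /\ delbar (@cexp R) z = 0.
Proof. exact: cdiff_del (cdiff_cexp z). Qed.

Lemma cexp_neq0 z : cexp z != 0.
Proof.
rewrite /cexp mulf_neq0//.
  by rewrite eq_complex /= negb_and gt_eqF ?expR_gt0.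
rewrite eq_complex /= -sqrf_eq0 -(sqrf_eq0 (sin _)).
apply/negP => /andP[/eqP c0 /eqP s0].
by have := cos2Dsin2 (complex.Im z); rewrite c0 s0 addr0 => /eqP; rewrite eq_sym oner_eq0.
Qed.

Lemma cexpD z w : cexp (z + w) = cexp z * cexp w.
Proof.
rewrite /cexp ReD ImD expRD cosD sinD; apply/eqP; rewrite eq_complex /=.
by apply/andP; split; apply/eqP; ring.
Qed.

Lemma cexp_norm2 z : cexp z * cj (cexp z) = (expR (complex.Re z) ^+ 2)%:C.
Proof.
have := cos2Dsin2 (complex.Im z); rewrite /cexp cjM cj_real.
move: (expR _) (cos _) (sin _) => e c s H.
apply/eqP; rewrite eq_complex /=; apply/andP; split; apply/eqP; last by ring.
transitivity (e ^+ 2 * (c ^+ 2 + s ^+ 2)); first by ring.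
by rewrite H mulr1.
Qed.

Lemma del_cj_cexp z : del (fun w => cj (cexp w : R[i])) z = 0 /\
  delbar (fun w => cj (cexp w : R[i])) z = cj (cexp z).
Proof.
by have [-> ->] := del_cj (smooth_cexp z); have [-> ->] := del_cexp z; rewrite cj0.
Qed.

Lemma lcurv_comp_cexp f z : smooth_at f (cexp z) ->
  lcurv (fun w => f (cexp w)) z = (expR (complex.Re z) ^+ 2)%:C * lcurv f (cexp z).
Proof.
move=> sf; have [de _] := del_cexp z.
have hol : \forall w \near (z : R[i]^o), delbar (@cexp R) w = 0.
  by apply: nearc => w; have [_ ->] := del_cexp w.
have hol' : delbar (del (@cexp R)) z = 0.
  have E1 : \forall w \near (z : R[i]^o), cexp w = del (@cexp R) w.
    by apply: nearc => w; have [-> _] := del_cexp w.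
  by have [_ ->] := del_eq (smooth_cexp z) E1; have [_ ->] := del_cexp z.
by rewrite (lcurv_comp (smooth_cexp z) sf hol hol') de cexp_norm2.
Qed.

Lemma near_Re_lt0 z : complex.Re z < 0 -> \forall w \near (z : R[i]^o), complex.Re w < 0.
Proof.
move=> z0; apply/nbhs_box; exists (- complex.Re z); first by rewrite oppr_gt0.
by move=> w; rewrite ReB ltr_norml => /andP[_ h] _; lra.
Qed.

(** The logarithm is [2 Re z], which is harmonic: the factor that carries [theta] from the disk to
    the half-plane adds nothing to the maximum principle. *)
Lemma lcurv_cexp2 z : lcurv (fun w => cexp w * cj (cexp w : R[i])) z = 0.
Proof.
have e0 := cexp_neq0 z.
rewrite (lcurvM (smooth_cexp z) (smooth_cj (smooth_cexp z)) e0) ?cj_eq0//.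
rewrite /lcurv; have [-> ->] := del_cexp z; have [-> ->] := del_cj_cexp z.
have E1 : \forall w \near (z : R[i]^o), (fun=> 0 : R[i]) w = delbar (@cexp R) w.
  by apply: nearc => w; have [_ ->] := del_cexp w.
have E2 : \forall w \near (z : R[i]^o), cj (cexp w) = delbar (fun w => cj (cexp w : R[i])) w.
  by apply: nearc => w; have [_ ->] := del_cj_cexp w.
have [-> _] := del_eq (smooth_cst 0 z) E1.
have [-> _] := del_eq (smooth_cj (smooth_cexp z)) E2.
have [-> _] := del_cst (0 : R[i]) z; have [-> _] := del_cj_cexp z.
by rewrite !mulr0 !mul0r subrr !mul0r addr0.
Qed.

(* The principal branch, only used on the right half-plane. *)
Definition clog (w : R[i]) : R[i] :=
  (ln (complex.Re (w * cj w)) / 2)%:C + 'i%C * (atan (complex.Re (w * (complex.Re w)^-1%:C * - 'i%C)))%:C.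

(** The argument of [atan] in [clog w] is [Im w / Re w], for an exponential the tangent of [Im z];
    the hypothesis is the range on which [atan] inverts it. *)
Lemma clog_cexp z : `|complex.Im z| < pi / 2 -> clog (cexp z) = z.
Proof.
move=> zi; have zi' : complex.Im z \in `]- (pi / 2), pi / 2[ by rewrite in_itv /= -ltr_norml.
have c0 : 0 < cos (complex.Im z) by exact: cos_gt0_pihalf.
rewrite /clog cexp_norm2 [complex.Re _%:C]/= lnXn ?expR_gt0// expRK.
have -> : complex.Re (cexp z * (complex.Re (cexp z))^-1%:C * - 'i%C) = tan (complex.Im z).
  rewrite /cexp /tan /=; have e0 := expR_gt0 (complex.Re z).
  by field; rewrite !gt_eqF.
rewrite tanK//; case: (z) => a b /=; apply/eqP; rewrite eq_complex /=.
by apply/andP; split; apply/eqP; rewrite ?mulr2n; field.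
Qed.

Lemma cexp_clog w : 0 < complex.Re w -> cexp (clog w) = w.
Proof.
case: w => a b /= a0; rewrite /cexp.
have E1 : complex.Re (clog (a +i* b)%C) = ln (a ^+ 2 + b ^+ 2) / 2.
  by rewrite /clog /=; rewrite !(mul0r, mulr0, subr0, addr0, mul1r, mulrN, opprK).
have E2 : complex.Im (clog (a +i* b)%C) = atan (b / a).
  by rewrite /clog /=; rewrite !(mul0r, mulr0, subr0, addr0, mul1r, mulrN, opprK, add0r, oppr0, mulr1).
have n0 : 0 < a ^+ 2 + b ^+ 2 by rewrite ltr_wpDr ?sqr_ge0 ?exprn_gt0.
have cE : cos (atan (b / a)) = a / Num.sqrt (a ^+ 2 + b ^+ 2).
  rewrite cos_atan.
  have -> : 1 + (b / a) ^+ 2 = (a ^+ 2 + b ^+ 2) / a ^+ 2 by field; rewrite gt_eqF.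
  by rewrite sqrtrM ?ltW// sqrtrV ?sqr_ge0// sqrtr_sqr gtr0_norm// invfM invrK mulrC.
have sE : sin (atan (b / a)) = b / Num.sqrt (a ^+ 2 + b ^+ 2).
  have := atanK (b / a); rewrite /tan cE => /(canRL (divfK _)) ->.
    by rewrite mulrA divfK// gt_eqF.
  by apply: mulf_neq0; rewrite ?invr_eq0 gt_eqF ?sqrtr_gt0.
have eE : expR (ln (a ^+ 2 + b ^+ 2) / 2) = Num.sqrt (a ^+ 2 + b ^+ 2).
  apply/eqP; rewrite -(eqrXn2 (n := 2)) ?expR_ge0 ?sqrtr_ge0// sqr_sqrtr ?ltW//.
  by rewrite -expRM_natl mulrC divfK ?pnatr_eq0// lnK.
rewrite E1 E2 cE sE eE; have s0 : Num.sqrt (a ^+ 2 + b ^+ 2) != 0 by rewrite gt_eqF// sqrtr_gt0.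
apply/eqP; rewrite eq_complex /=; apply/andP; split; apply/eqP; field; exact: s0.
Qed.

(** With [D = F u - F w], the equation [u - w = D p + cj D q] and its conjugate form a linear system
    in [D] and [cj D]. Its determinant [d] equals [a * cj a] at [w], hence is nonzero nearby, and
    solving for [D] gives the quotients of [F]. *)
Lemma cdiff_inverse f F w a : continuous_pt F w ->
  (\forall u \near (w : R[i]^o), f (F u) = u) -> cdiff f (F w) a 0 -> a != 0 ->
  cdiff F w a^-1 0.
Proof.
move=> cF fF [p [q [cp cq pE qE H]]] a0.
pose d u := p (F u) * cj (p (F u)) - q (F u) * cj (q (F u)).
have cp' := continuous_pt_comp cF cp; have cq' := continuous_pt_comp cF cq.
have cd : continuous_pt d w.
  have c1 := continuous_ptM cp' (continuous_pt_conj cp').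
  have c2 := continuous_ptM cq' (continuous_pt_conj cq').
  have := continuous_ptD c1 (continuous_ptM (continuous_pt_cst (-1) w) c2).
  by apply: continuous_pt_near; apply: nearc => u; rewrite mulN1r.
have dE : d w = a * cj a by rewrite /d pE qE mul0r subr0.
have dw0 : d w != 0 by rewrite dE mulf_neq0// cj_eq0.
have cV := continuous_ptV dw0 cd.
have d0 : \forall u \near (w : R[i]^o), d u != 0.
  exact: (@cvgr_neq0 _ R[i]^o R[i]^o _ _ d (d w) cd dw0).
have := @cdiffI R F w (fun u => cj (p (F u)) * (d u)^-1) (fun u => -1 * q (F u) * (d u)^-1).
rewrite qE pE mulr0 mul0r dE invfM mulrCA divff ?cj_eq0// mulr1; apply.
- exact: continuous_ptM (continuous_pt_conj cp') cV.
- exact: continuous_ptM (continuous_ptM (continuous_pt_cst _ _) cq') cV.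
have Fw : f (F w) = w := nbhs_singleton fF.
have H' : \forall u \near (w : R[i]^o), linearized f (F w) p q (F u) by exact: cF H.
suff key u : f (F u) = u -> linearized f (F w) p q (F u) -> d u != 0 ->
    linearized F w (fun u => cj (p (F u)) * (d u)^-1) (fun u => -1 * q (F u) * (d u)^-1) u.
  by apply: filterS3 fF H' d0 => u; exact: key.
rewrite /linearized => E1 E2 du0.
have -> : u - w = (F u - F w) * p (F u) + cj (F u - F w) * q (F u).
  rewrite -[u in LHS]E1 E2 Fw.
  by move: (_ * p _) (_ * q _) => x y; ring.
rewrite (cjD (_ * _)) 2!cjM cjK; move: du0; rewrite /d.
move: (cj (F u - F w)) (p (F u)) (q (F u)) (cj (p (F u))) (cj (q (F u))) => D' P Q P' Q' du0.
by field.
Qed.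

(** Differentiating the formula of [clog] serves only to obtain continuity; the derivative itself
    comes from [clog] being a right inverse of [cexp]. *)
Lemma cdiff_clog w : 0 < complex.Re w -> cdiff clog w w^-1 0.
Proof.
move=> w0.
have wn0 : w != 0 by apply: contraTneq w0 => ->; rewrite ltxx.
have m0 : 0 < complex.Re (w * cj w).
  by move: w0; case: (w) => a b /= a0; rewrite mulrN opprK ltr_wpDr ?mulr_gt0// -expr2 sqr_ge0.
have Dw := cdiff_id w; have Dcw := cdiff_conj Dw.
have D1 := cdiff_comp (cdiffM Dw Dcw) (cdiff_real (is_derive1_ln m0)).
have is_id : is_derive (complex.Re w) 1 (@id R) 1 by exact: is_derive_id.
have w0' : complex.Re w != 0 by rewrite gt_eqF.
have DV : cdiff (fun u => ((complex.Re u)^-1)%:C) w (- (complex.Re w) ^- 2 / 2)%:C (- (complex.Re w) ^- 2 / 2)%:C.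
  apply: cdiff_real; have := @is_deriveV R id (complex.Re w) 1 1 w0' is_id.
  by rewrite [_ *: 1]mulr1.
have Du := cdiffM (cdiffM Dw DV) (cdiff_cst (- 'i%C) w).
have D2 := cdiff_comp Du (cdiff_real (is_derive1_atan (complex.Re (w * (complex.Re w)^-1%:C * - 'i%C)))).
have := cdiffD (cdiffM D1 (cdiff_cst (2^-1%:C : R[i]) w)) (cdiffM (cdiff_cst 'i%C w) D2).
move=> /cdiff_continuous D.
have cl : continuous_pt clog w.
  by apply: continuous_pt_near D; apply: nearc => u; rewrite /clog rmorphM.
have pos : \forall u \near (w : R[i]^o), cexp (clog u) = u.
  apply/nbhs_box; exists (complex.Re w) => // u ur _; apply: cexp_clog.
  by move: ur; rewrite ReB ltr_norml => /andP[]; lra.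
have E := cexp_clog w0.
by have := cdiff_inverse cl pos (cdiff_cexp (clog w)); rewrite E; exact.
Qed.

Lemma smooth_clog w : 0 < complex.Re w -> smooth_at clog w.
Proof.
move=> w0.
have pos : \forall u \near (w : R[i]^o), 0 < complex.Re u.
  apply/nbhs_box; exists (complex.Re w) => // u ur _.
  by move: ur; rewrite ReB ltr_norml => /andP[]; lra.
have [V [oV Vw] VP] := near_open pos.
have H u (Vu : V u) := cdiff_clog (VP u Vu).
apply/smooth_atP; exists V; first by split.
case=> [|k]; first exact: Dk0I H.
apply: (DkSI oV H) => v _; exists (fun u => v * u^-1).
  apply: (Dk_M oV (Dk_cst _ _ oV)); apply: (Dk_V oV _ (Dk_id _ oV)) => u /VP u0.
  by apply: contraTneq u0 => ->; rewrite ltxx.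
by move=> u _; rewrite mulr0 addr0.
Qed.

Lemma local_log z0 : exists L : R[i] -> R[i],
  [/\ \forall z \near (z0 : R[i]^o), L (cexp z) = z,
      \forall w \near (cexp z0 : R[i]^o), cexp (L w) = w,
      smooth_at L (cexp z0) &
      \forall w \near (cexp z0 : R[i]^o), del L w = w^-1 /\ delbar L w = 0].
Proof.
set w0 := cexp z0; have w00 : w0 != 0 by exact: cexp_neq0.
pose q w := w0^-1 * w.
have sq w : smooth_at q w by exact: smoothM (smooth_cst _ _) (smooth_id _).
have q1 : q w0 = 1 by rewrite /q mulVf.
have pos : \forall w \near (w0 : R[i]^o), 0 < complex.Re (q w).
  have /continuous_ptP/(_ 1 ltr01) := smooth_continuous (sq w0).
  by apply: filterS => w []; rewrite q1 ReB /= ltr_norml => /andP[]; lra.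
exists (fun w => z0 + clog (q w)); split.
- apply/nbhs_box; exists (pi / 2); first by rewrite divr_gt0 ?pi_gt0.
  move=> z _ zi; have -> : q (cexp z) = cexp (z - z0).
    have {1}-> : z = (z - z0) + z0 by rewrite subrK.
    by rewrite cexpD /q -/w0 [w0^-1 * _]mulrC -mulrA divff// mulr1.
  by rewrite clog_cexp// addrC subrK.
- by apply: filterS pos => w w1; rewrite cexpD cexp_clog// /q mulrA divff// mul1r.
- apply: (smoothD (smooth_cst _ _)); apply: (@smooth_comp _ clog q _ (sq _)).
  by apply: smooth_clog; rewrite q1.
apply: filterS pos => w w1.
have sc := @smooth_comp _ clog q _ (sq w) (smooth_clog w1).
have [-> ->] := delD (smooth_cst z0 w) sc; have [-> ->] := del_cst z0 w.
have [-> ->] := del_comp (sq w) (smooth_clog w1).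
have [-> ->] := cdiff_del (cdiff_clog w1).
have [-> ->] := delZ w0^-1 (smooth_id w); have [-> ->] := del_id w.
rewrite !mulr0 !mul0r !addr0 !add0r mulr1; split=> //.
by rewrite -invfM /q mulrA divff// mul1r.
Qed.

Lemma smooth_Re z : smooth_at (fun w => (complex.Re w)%:C : R[i]) z.
Proof.
apply: (smooth_eq _ (smoothM (smoothD (smooth_id z) (smooth_cj (smooth_id z))) (smooth_cst 2^-1 z))).
apply: nearc => -[a b]; apply/eqP; rewrite /cj eq_complex.
have -> : (2^-1 : R[i]) = (2^-1 : R)%:C by rewrite fmorphV rmorph_nat.
by rewrite /=; apply/andP; split; apply/eqP; field.
Qed.

Lemma del_Re z : del (fun w => (complex.Re w)%:C : R[i]) z = 2^-1 /\
  delbar (fun w => (complex.Re w)%:C : R[i]) z = 2^-1.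
Proof.
have D : cdiff (fun w => (complex.Re w)%:C : R[i]) z (1 / 2)%:C (1 / 2)%:C.
  by apply: (@cdiff_real id); exact: is_derive_id.
by have [-> ->] := cdiff_del D; rewrite div1r fmorphV rmorph_nat.
Qed.

Definition affine_Re (a b : R) (w : R[i]) : R[i] := (a + b * complex.Re w)%:C.

Lemma affine_ReE a b w : affine_Re a b w = a%:C + b%:C * (complex.Re w)%:C.
Proof. by rewrite /affine_Re rmorphD rmorphM. Qed.

Lemma smooth_affine_Re a b z : smooth_at (affine_Re a b) z.
Proof.
apply: (smooth_eq _ (smoothD (smooth_cst a%:C z) (smoothM (smooth_cst b%:C z) (smooth_Re z)))).
by apply: nearc => w; rewrite affine_ReE.
Qed.

Lemma del_affine_Re a b z : del (affine_Re a b) z = b%:C / 2 /\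
  delbar (affine_Re a b) z = b%:C / 2.
Proof.
have sb := smoothM (smooth_cst b%:C z) (smooth_Re z).
have [||-> ->] := @del_eq _ (fun w => a%:C + b%:C * (complex.Re w)%:C) (affine_Re a b) z.
- exact: smoothD (smooth_cst _ _) sb.
- by apply: nearc => w; rewrite affine_ReE.
have [-> ->] := delD (smooth_cst a%:C z) sb; have [-> ->] := del_cst (a%:C : R[i]) z.
have [-> ->] := delZ b%:C (smooth_Re z); have [-> ->] := del_Re z.
by rewrite !add0r.
Qed.

(** The logarithm of a positive affine function of [Re z] is concave. In the Higgs estimate this
    negative term is the cost of the cut-off; for flat sections it is the strict superharmonicity of
    the comparison function. *)
Lemma lcurv_affine_Re a b z : 
  lcurv (affine_Re a b) z = (- (b / (a + b * complex.Re z)) ^+ 2 / 4)%:C.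
Proof.
rewrite /lcurv; have [-> ->] := del_affine_Re a b z.
have E : \forall w \near (z : R[i]^o), (fun=> b%:C / 2 : R[i]) w = delbar (affine_Re a b) w.
  by apply: nearc => w; have [_ ->] := del_affine_Re a b w.
have [-> _] := del_eq (smooth_cst _ z) E.
have [-> _] := del_cst (b%:C / 2 : R[i]) z.
have -> : (2 : R[i]) = (2 : R)%:C by rewrite rmorph_nat.
rewrite mulr0 sub0r /affine_Re -!fmorphV -!(rmorphM, rmorphN, rmorphXn) -?fmorphV -?rmorphM /=.
congr (_%:C); rewrite exprMn exprVn.
have -> : (4 : R) = 2 * 2 by rewrite -natrM.
rewrite (invfM 2 2); move: ((a + b * complex.Re z) ^- 2) (2^-1 : R) => x y.
by ring.
Qed.

Lemma smoothX f n z : smooth_at f z -> smooth_at (fun w => f w ^+ n) z.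
Proof.
move=> sf; elim: n => [|n IH].
  by apply: (smooth_eq _ (smooth_cst 1 z)); apply: nearc => w; rewrite expr0.
by apply: (smooth_eq _ (smoothM sf IH)); apply: nearc => w; rewrite exprS.
Qed.

Lemma lcurvX f n z : smooth_at f z -> f z != 0 ->
  lcurv (fun w => f w ^+ n) z = n%:R * lcurv f z.
Proof.
move=> sf f0; elim: n => [|n IH].
  have E : \forall w \near (z : R[i]^o), (fun=> 1 : R[i]) w = f w ^+ 0.
    by apply: nearc => w; rewrite expr0.
  rewrite (lcurv_eq (smooth_cst 1 z) E) /lcurv.
  have E' : \forall w \near (z : R[i]^o), (fun=> 0 : R[i]) w = delbar (fun=> 1 : R[i]) w.
    by apply: nearc => w; have [_ ->] := del_cst (1 : R[i]) w.
  have [-> _] := del_eq (smooth_cst 0 z) E'.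
  have [-> _] := del_cst (0 : R[i]) z; have [-> _] := del_cst (1 : R[i]) z.
  by rewrite mulr0 !mul0r subrr mul0r.
have E : \forall w \near (z : R[i]^o), f w * f w ^+ n = f w ^+ n.+1.
  by apply: nearc => w; rewrite exprS.
rewrite (lcurv_eq (smoothM sf (smoothX n sf)) E) (lcurvM sf (smoothX n sf) f0).
  by rewrite IH -natr1 mulrDl mul1r addrC.
by rewrite expf_neq0.
Qed.

End ExpLog.

(** * Linear algebra in the fibers *)

Section FiberAlgebra.
Variables (R : realType) (X : set R[i]^o) (E : pvhs X).
Implicit Types (x : R[i]) (p q : int).

Local Notation ps := (hodge_types E).

Definition hproj p x (v : E x) : E x :=
  sumv_pi (\sum_(i <- ps) hodge E i x)%VS p v.

Definition hsign p : R[i] := (-1) ^ (weight E - p).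

Definition weil x (v : E x) : E x := \sum_(p <- ps) hsign p *: hproj p v.

Definition hform x (v w : E x) : R[i] := hodge_metric v w.

Lemma hsign_sqr p : hsign p * hsign p = 1.
Proof. by rewrite /hsign -exprzMl ?unitrN1// mulrNN mulr1 exp1rz. Qed.

Lemma hsign_pred p : hsign (p - 1) = - hsign p.
Proof.
rewrite /hsign (_ : weight E - (p - 1) = weight E - p + 1); last by ring.
by rewrite exprzDr ?unitrN1// expr1z mulrN1.
Qed.

Lemma hsign_succ p : hsign (p + 1) = - hsign p.
Proof. by have := hsign_pred (p + 1); rewrite (_ : p + 1 - 1 = p) => [->|]; [rewrite opprK|ring]. Qed.

Lemma cj_hsign p : cj (hsign p) = hsign p.
Proof.
have := hsign_sqr p => /eqP; rewrite -expr2 sqrf_eq1 => /orP[] /eqP ->.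
  exact: cj1.
by rewrite cjN cj1.
Qed.

Lemma hproj_in p x (v : E x) : hproj p v \in hodge E p x.
Proof. exact: memv_sum_pi. Qed.

Lemma hprojD p x (v w : E x) : hproj p (v + w) = hproj p v + hproj p w.
Proof. exact: linearD. Qed.

Lemma hprojZ p x (c : R[i]) (v : E x) : hproj p (c *: v) = c *: hproj p v.
Proof. exact: linearZ. Qed.

Lemma hproj0 p x : hproj p (0 : E x) = 0.
Proof. exact: linear0. Qed.

Lemma hproj_sum p x (I : Type) (r : seq I) (P : pred I) (F : I -> E x) :
  hproj p (\sum_(i <- r | P i) F i) = \sum_(i <- r | P i) hproj p (F i).
Proof. exact: linear_sum. Qed.

Lemma sum_hproj x (v : E x) : X x -> \sum_(p <- ps) hproj p v = v.
Proof.
move=> Xx; apply: sumv_pi_uniq_sum; first by rewrite filter_predT hodge_types_uniq.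
by rewrite hodge_full// memvf.
Qed.

Local Notation Q := (pairing E).

Lemma QDl x (u v w : E x) : Q x (u + v) w = Q x u w + Q x v w.
Proof. exact: linearDl. Qed.
Lemma QZl x c (u w : E x) : Q x (c *: u) w = c * Q x u w.
Proof. exact: linearZl_LR. Qed.
Lemma QZr x c (u w : E x) : Q x u (c *: w) = cj c * Q x u w.
Proof. exact: linearZr_LR. Qed.
Lemma Q0l x (w : E x) : Q x 0 w = 0.
Proof. exact: linear0l. Qed.
Lemma Qsuml x (I : Type) (r : seq I) (P : pred I) (F : I -> E x) w :
  Q x (\sum_(i <- r | P i) F i) w = \sum_(i <- r | P i) Q x (F i) w.
Proof. exact: linear_sumlz. Qed.
Lemma Qsumr x (I : Type) (r : seq I) (P : pred I) (F : I -> E x) w :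
  Q x w (\sum_(i <- r | P i) F i) = \sum_(i <- r | P i) Q x w (F i).
Proof. exact: linear_sumr. Qed.
Lemma QC x (v w : E x) : Q x v w = cj (Q x w v).
Proof. by rewrite (@hermitian_subproof _ _ _ _ (Q x)) expr0 mul1r. Qed.

Lemma Q_hproj x (v w : E x) p : X x -> w \in hodge E p x ->
  Q x v w = Q x (hproj p v) w.
Proof.
move=> Xx wp; have [pps|/(hodge_out Xx) p0] := boolP (p \in ps); last first.
  move: wp; rewrite p0 memv0 => /eqP ->.
  by rewrite QC Q0l [RHS]QC Q0l.
rewrite -{1}(sum_hproj v Xx) Qsuml (bigD1_seq p) ?hodge_types_uniq//=.
rewrite big1 ?addr0// => i ip.
exact: (hodge_orthogonal Xx ip (hproj_in _ _)).
Qed.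

(** By [Q_hproj], the Hodge norm of [u] is, up to signs, the sum of the [Q x u (hproj p u)]; a
    vector pairing to zero with everything thus contradicts positivity. *)
Lemma pairing_nondeg x (u : E x) : X x -> (forall w, Q x u w = 0) -> u = 0.
Proof.
move=> Xx u0; apply/eqP; apply/negPn/negP => /(hodge_pos Xx).
rewrite /hodge_form big1 ?ltxx// => p _.
by rewrite -[sumv_pi _ p u]/(hproj p u) -Q_hproj ?hproj_in// u0 mulr0.
Qed.

(** An element of [E^p] sees only the [E^p]-component of [w], and with such components [v] and
    [hproj p v] pair equally; nondegeneracy concludes. *)
Lemma hproj_id p x (v : E x) : X x -> v \in hodge E p x -> hproj p v = v.
Proof.
move=> Xx vp; apply/esym/eqP; rewrite -subr_eq0; apply/eqP.
apply: (pairing_nondeg Xx) => w.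
have up : v - hproj p v \in hodge E p x by rewrite memvB ?hproj_in.
rewrite QC (Q_hproj _ Xx up) -QC -[- hproj p v]scaleN1r QDl QZl.
by rewrite (Q_hproj v Xx (hproj_in p w)) mulN1r subrr.
Qed.

Lemma hproj_eq0 p q x (v : E x) : X x -> v \in hodge E p x -> q != p ->
  hproj q v = 0.
Proof.
move=> Xx vp qp; apply: (pairing_nondeg Xx) => w.
rewrite QC (Q_hproj _ Xx (hproj_in q v)) -QC.
rewrite -(Q_hproj v Xx (hproj_in q w)).
by rewrite QC (hodge_orthogonal Xx qp (hproj_in q w) vp) cj0.
Qed.

Lemma weilD x (v w : E x) : weil (v + w) = weil v + weil w.
Proof. by rewrite /weil -big_split; apply: eq_bigr => p _; rewrite hprojD scalerDr. Qed.

Lemma weilZ x (c : R[i]) (v : E x) : weil (c *: v) = c *: weil v.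
Proof.
rewrite /weil scaler_sumr; apply: eq_bigr => p _.
by rewrite hprojZ !scalerA mulrC.
Qed.

Lemma hproj_weil p x (v : E x) : X x -> hproj p (weil v) = hsign p *: hproj p v.
Proof.
move=> Xx; rewrite /weil hproj_sum.
have [pps|pps] := boolP (p \in ps).
  rewrite (bigD1_seq p) ?hodge_types_uniq//= hprojZ (hproj_id Xx (hproj_in _ _)).
  rewrite big1 ?addr0// => i ip; rewrite hprojZ (hproj_eq0 Xx (hproj_in _ _)) ?scaler0//.
  by rewrite eq_sym.
have p0 w : hproj p w = 0 :> E x.
  by apply/eqP; rewrite -memv0 -(hodge_out Xx pps) hproj_in.
by rewrite p0 scaler0 big1// => i _; rewrite p0.
Qed.

Lemma weilK x (v : E x) : X x -> weil (weil v) = v.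
Proof.
move=> Xx; rewrite [LHS]/weil -[RHS](sum_hproj v Xx); apply: eq_bigr => p _.
by rewrite hproj_weil// scalerA hsign_sqr scale1r.
Qed.

Lemma weil_hodge p x (v : E x) : X x -> v \in hodge E p x -> weil v = hsign p *: v.
Proof.
move=> Xx vp; have [pps|/(hodge_out Xx) p0] := boolP (p \in ps); last first.
  by move: vp; rewrite p0 memv0 => /eqP ->; rewrite -[0](scale0r (0 : E x)) weilZ !scale0r scaler0.
rewrite /weil (bigD1_seq p) ?hodge_types_uniq//= (hproj_id Xx vp).
by rewrite big1 ?addr0// => i ip; rewrite (hproj_eq0 Xx vp)// scaler0.
Qed.

Lemma hform_weill x (v w : E x) : X x -> hform v w = Q x (weil v) w.
Proof.
move=> Xx; rewrite /hform /hodge_metric /hodge_form -{2}(sum_hproj w Xx) Qsumr.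
apply: eq_bigr => p _; rewrite (Q_hproj _ Xx (hproj_in _ _)) hproj_weil//.
by rewrite QZl.
Qed.

Lemma hformC x (v w : E x) : hform v w = cj (hform w v).
Proof.
rewrite /hform /hodge_metric /hodge_form.
apply: (big_ind2 (fun a b => a = cj b)) => [|a b c d -> ->|p _].
- by rewrite cj0.
- by rewrite cjD.
by rewrite [in LHS]QC -[(-1) ^ _]/(hsign p) cjM cj_hsign.
Qed.

Lemma hform_weilr x (v w : E x) : X x -> hform v w = Q x v (weil w).
Proof. by move=> Xx; rewrite hformC hform_weill// -QC. Qed.

Lemma hformDl x (u v w : E x) : X x -> hform (u + v) w = hform u w + hform v w.
Proof. by move=> Xx; rewrite !hform_weill// weilD QDl. Qed.

Lemma hformZl x c (u w : E x) : X x -> hform (c *: u) w = c * hform u w.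
Proof. by move=> Xx; rewrite !hform_weill// weilZ QZl. Qed.

Lemma hformDr x (u v w : E x) : X x -> hform u (v + w) = hform u v + hform u w.
Proof. by move=> Xx; rewrite hformC hformDl// cjD -!hformC. Qed.

Lemma hformZr x c (u w : E x) : X x -> hform u (c *: w) = cj c * hform u w.
Proof. by move=> Xx; rewrite hformC hformZl// cjM -hformC. Qed.

Lemma hform0l x (w : E x) : X x -> hform 0 w = 0.
Proof. by move=> Xx; rewrite -(scale0r (0 : E x)) hformZl// mul0r. Qed.

Lemma hform0r x (w : E x) : X x -> hform w 0 = 0.
Proof. by move=> Xx; rewrite hformC hform0l// cj0. Qed.

Lemma hformNl x (u w : E x) : X x -> hform (- u) w = - hform u w.
Proof. by move=> Xx; rewrite -scaleN1r hformZl// mulN1r. Qed.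

Lemma hformNr x (u w : E x) : X x -> hform u (- w) = - hform u w.
Proof. by move=> Xx; rewrite hformC hformNl// cjN -hformC. Qed.

Lemma hform_ge0 x (v : E x) : X x -> 0 <= hform v v.
Proof.
move=> Xx; have [->|v0] := eqVneq v 0; first by rewrite hform0l.
exact/ltW/(hodge_pos Xx v0).
Qed.

Lemma hform_eq0 x (v : E x) : X x -> (hform v v == 0) = (v == 0).
Proof.
move=> Xx; have [->|v0] := eqVneq v 0; first by rewrite hform0l// eqxx.
by apply/negbTE; have := hodge_pos Xx v0; rewrite lt_neqAle eq_sym => /andP[].
Qed.

Lemma hform_orth p q x (v w : E x) : X x -> v \in hodge E p x -> w \in hodge E q x ->
  p != q -> hform v w = 0.
Proof.
move=> Xx vp wq pq; rewrite hform_weill// (weil_hodge Xx vp) QZl.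
by rewrite (hodge_orthogonal Xx pq vp wq) mulr0.
Qed.

Lemma hform_CS x (v w : E x) : X x ->
  hform v w * cj (hform v w) <= hform v v * hform w w.
Proof.
move=> Xx; have [->|w0] := eqVneq w 0.
  by rewrite !hform0r// mul0r mulr0.
have W0 : 0 < hform w w by exact: (hodge_pos Xx w0).
have Wr : cj (hform w w) = hform w w by rewrite -hformC.
have := @hform_ge0 x (hform w w *: v - hform v w *: w) Xx.
have -> : hform (hform w w *: v - hform v w *: w) (hform w w *: v - hform v w *: w) =
    hform w w * (hform v v * hform w w - hform v w * cj (hform v w)).
  rewrite !hformDl// !hformDr// -!(scaleNr (hform v w) w) !hformZl// !hformZr// cjN Wr (hformC w v).
  by move: (hform v v) (hform w w) (hform v w) (cj (hform v w)) => a b c d; ring.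
by rewrite pmulr_rge0// subr_ge0.
Qed.

End FiberAlgebra.

(** * Smooth sections and the Chern connection *)

Section SmoothSections.
Variables (R : realType) (X : set R[i]^o) (E : pvhs X).
Implicit Types (x y : R[i]) (p q : int) (s t : section_of E).

Local Notation sms := (@section_smooth_at R E).

Lemma base_near x : X x -> \forall y \near (x : R[i]^o), X y.
Proof.
have [H _] := vb_smooth E; move=> /H[oc cx cX _].
exact: filterS cX (open_nbhs_nbhs (conj oc cx)).
Qed.

Lemma chart_near x : X x -> \forall y \near (x : R[i]^o), chart_dom E x y.
Proof.
have [H _] := vb_smooth E; move=> /H[oc cx cX _].
exact: (open_nbhs_nbhs (conj oc cx)).
Qed.

Lemma chart_base x y : X x -> chart_dom E x y -> X y.
Proof. by have [H _] := vb_smooth E; move=> /H[_ _ cX _] /cX. Qed.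

Lemma chart_center x : X x -> chart_dom E x x.
Proof. by have [H _] := vb_smooth E; move=> /H[_ ? _ _]. Qed.

Lemma frame_expand x y (v : E y) : X x -> chart_dom E x y ->
  v = \sum_k coord (frame E x y) k v *: frame_section x k y.
Proof.
have [H _] := vb_smooth E; move=> /H[_ _ _ bas] /bas b.
rewrite {1}(coord_basis b (memvf v)); apply: eq_bigr => k _.
by rewrite /frame_section (tnth_nth 0).
Qed.

Lemma frame_smooth x y k : X x -> chart_dom E x y -> sms (frame_section x k) y.
Proof.
move=> Xx xy; have Xy := chart_base Xx xy; have [_ H] := vb_smooth E.
by move=> j; apply: H => //; exact: chart_center.
Qed.

Lemma sms_eq s t x : (\forall y \near (x : R[i]^o), s y = t y) ->
  sms s x -> sms t x.
Proof.
move=> st H k; apply: smooth_eq (H k).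
by apply: filterS st => y st; rewrite /frame_coord st.
Qed.

Lemma sms_comb x (I : Type) (r : seq I) (P : pred I) (c : I -> R[i] -> R[i])
    (e : I -> section_of E) :
  (forall i, P i -> smooth_at (c i) x) -> (forall i, P i -> sms (e i) x) ->
  sms (fun y => \sum_(i <- r | P i) c i y *: e i y) x.
Proof.
move=> sc se k.
apply: (@smooth_eq _ (fun y => \sum_(i <- r | P i) c i y * frame_coord x k (e i) y)).
  apply: nearc => y; rewrite /frame_coord linear_sum; apply: eq_bigr => i _.
  by rewrite linearZ.
by apply: smooth_sum => i Pi; exact: smoothM (sc i Pi) (se i Pi k).
Qed.

Lemma smsZ f s x : smooth_at f x -> sms s x -> sms (fun y => f y *: s y) x.
Proof.
move=> sf ss k; apply: smooth_eq (smoothM sf (ss k)).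
by apply: nearc => y; rewrite /frame_coord linearZ.
Qed.

Lemma smsD s t x : sms s x -> sms t x -> sms (fun y => s y + t y) x.
Proof.
move=> ss st k; apply: smooth_eq (smoothD (ss k) (st k)).
by apply: nearc => y; rewrite /frame_coord linearD.
Qed.

Lemma smsN s x : sms s x -> sms (fun y => - s y) x.
Proof.
move=> ss; apply: sms_eq (smsZ (smooth_cst (-1) x) ss).
by apply: nearc => y; rewrite scaleN1r.
Qed.

Lemma smsB s t x : sms s x -> sms t x -> sms (fun y => s y - t y) x.
Proof. by move=> ss st; exact: smsD ss (smsN st). Qed.

(** Smoothness at [y] is tested in the frame centred at [y], smoothness at [x] in the one centred at
    [x]. Expanding [s] in the latter frame and using smoothness of the transition functions connects
    the two. *)
Lemma sms_near s x : X x -> sms s x -> \forall y \near (x : R[i]^o), sms s y.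
Proof.
move=> Xx ss.
have H k : \forall y \near (x : R[i]^o), smooth_at (frame_coord x k s) y.
  exact: smooth_near (ss k).
have H' : \forall y \near (x : R[i]^o), forall k, smooth_at (frame_coord x k s) y.
  exact: filter_forall H.
apply: filterS3 H' (near_near (chart_near Xx)) (chart_near Xx) => y sy cy xy.
apply: (@sms_eq (fun y => \sum_k frame_coord x k s y *: frame_section x k y)).
  by apply: filterS cy => z xz; rewrite -frame_expand.
by apply: sms_comb => // k _; exact: frame_smooth.
Qed.

Lemma sms_through x (v : E x) : X x -> exists2 s, sms s x & s x = v.
Proof.
move=> Xx; exists (fun y => \sum_k coord (frame E x x) k v *: frame_section x k y).
  apply: (@sms_comb _ _ _ _ (fun k y => coord (frame E x x) k v)) => k _.
    exact: smooth_cst.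
  exact: (frame_smooth k Xx (chart_center Xx)).
by rewrite -frame_expand//; exact: chart_center.
Qed.

Lemma smooth_det n (A : R[i] -> 'M[R[i]]_n) x :
  (forall i j, smooth_at (fun y => A y i j) x) -> smooth_at (fun y => \det (A y)) x.
Proof.
move=> sA; apply: smooth_sum => g _; apply: smoothM; first exact: smooth_cst.
by apply: smooth_prod => i _; exact: sA.
Qed.

Lemma smooth_cofactor n (A : R[i] -> 'M[R[i]]_n) i j x :
  (forall i j, smooth_at (fun y => A y i j) x) ->
  smooth_at (fun y => cofactor (A y) i j) x.
Proof.
move=> sA; apply: smoothM; first exact: smooth_cst.
apply: smooth_det => k l.
by apply: smooth_eq (sA (lift i k) (lift j l)); apply: nearc => y; rewrite !mxE.
Qed.

Section Gram.
Variables (m : nat) (e : 'I_m -> section_of E).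

Definition gram y : 'M[R[i]]_m := \matrix_(i, j) pairing E y (e i y) (e j y).

(** A kernel vector gives an element of [E^p] pairing to zero with [E^p], hence with every type. It
    vanishes by nondegeneracy, and so do its coefficients in the basis. *)
Lemma gram_unit p y : X y -> basis_of (hodge E p y) [tuple e i y | i < m] ->
  gram y \in unitmx.
Proof.
move=> Xy b; rewrite -row_free_unit -kermx_eq0; apply/eqP/row_matrixP => k.
rewrite row0; set a := row k _.
have aG : a *m gram y = 0 by rewrite /a -row_mul mulmx_ker row0.
pose u := \sum_i a 0 i *: e i y.
have eP i : e i y \in hodge E p y.
  by rewrite -[e i y](tnth_mktuple (fun i => e i y)); exact: basis_mem b (mem_tnth _ _).
have up : u \in hodge E p y by apply: memv_suml => i _; exact: memvZ.
have ue j : pairing E y u (e j y) = 0.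
  have := congr1 (fun M : 'rV_m => M 0 j) aG; rewrite [LHS]mxE [RHS]mxE => <-.
  by rewrite Qsuml; apply: eq_bigr => i _; rewrite QZl [gram _ _ _]mxE.
have u0 : u = 0.
  apply: (pairing_nondeg Xy) => w.
  rewrite QC (Q_hproj _ Xy up) -QC.
  rewrite {1}(coord_basis b (hproj_in p w)) Qsumr big1// => i _.
  by rewrite QZr (nth_map i) ?size_enum_ord// nth_ord_enum ue mulr0.
apply/rowP => i; rewrite [RHS]mxE.
have /freeP := basis_free b; apply.
rewrite -[RHS]u0; apply: eq_bigr => j _.
by rewrite -tnth_nth tnth_mktuple.
Qed.

Lemma hproj_gram p y (v : E y) : X y -> basis_of (hodge E p y) [tuple e i y | i < m] ->
  hproj p v = \sum_i (\sum_j pairing E y v (e j y) *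
    ((\det (gram y))^-1 * cofactor (gram y) i j)) *: e i y.
Proof.
move=> Xy b; have U := gram_unit Xy b.
have eP i : e i y \in hodge E p y.
  by rewrite -[e i y](tnth_mktuple (fun i => e i y)); exact: basis_mem b (mem_tnth _ _).
pose a : 'rV_m := \row_i coord [tuple e i y | i < m] i (hproj p v).
have vE : hproj p v = \sum_i a 0 i *: e i y.
  rewrite {1}(coord_basis b (hproj_in p v)); apply: eq_bigr => i _.
  by rewrite mxE -tnth_nth tnth_mktuple.
pose b' : 'rV_m := \row_j pairing E y v (e j y).
have aG : a *m gram y = b'.
  apply/rowP => j; rewrite [LHS]mxE [RHS]mxE (Q_hproj v Xy (eP j)) vE Qsuml.
  by apply: eq_bigr => i _; rewrite QZl [gram _ _ _]mxE.
have aE : a = b' *m invmx (gram y) by rewrite -aG mulmxK.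
rewrite vE; apply: eq_bigr => i _; congr (_ *: _).
rewrite aE mxE; apply: eq_bigr => j _.
by rewrite [b' _ _]mxE /invmx U !mxE.
Qed.

End Gram.

(** A smooth subbundle is given by local frames. The projection is [Q]-orthogonal, so its
    coordinates solve the Gram system of such a frame, and cofactors divided by the determinant
    exhibit them as smooth functions. *)
Lemma hproj_smooth p s x : X x -> sms s x -> sms (fun y => hproj p (s y)) x.
Proof.
move=> Xx ss; have [m [e [se b]]] := @hodge_smooth R X E p x Xx.
have sG i j : smooth_at (fun y => gram e y i j) x.
  apply: smooth_eq (pairing_smooth Xx (se i) (se j)).
  by apply: nearc => y; rewrite mxE.
pose c i y := \sum_j pairing E y (s y) (e j y) *
    ((\det (gram e y))^-1 * cofactor (gram e y) i j).
apply: (@sms_eq (fun y => \sum_i c i y *: e i y)).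
  by apply: filterS2 (base_near Xx) b => y Xy b; rewrite (hproj_gram _ Xy b).
apply: sms_comb => i _; last exact: se.
apply: smooth_sum => j _; apply: smoothM; first exact: pairing_smooth.
apply: smoothM; last exact: smooth_cofactor.
apply: smoothV; last exact: smooth_det.
by have := gram_unit Xx (nbhs_singleton b); rewrite unitmxE unitfE.
Qed.

Lemma weil_smooth s x : X x -> sms s x -> sms (fun y => weil (s y)) x.
Proof.
move=> Xx ss; apply: (@sms_comb x _ _ _ (fun p y => hsign E p)) => p _.
  exact: smooth_cst.
exact: hproj_smooth.
Qed.

Lemma hform_smooth s t x : X x -> sms s x -> sms t x ->
  smooth_at (fun y => hform (s y) (t y)) x.
Proof. by move=> Xx ss st; exact: hodge_form_smooth. Qed.

End SmoothSections.

(** * Splitting of the flat connection into Chern connection, Higgs field and adjoint *)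

Section Derivations.
Variables (R : realType) (X : set R[i]^o) (E : pvhs X).
Implicit Types (x y : R[i]) (p q : int) (s t : section_of E).

Local Notation sms := (@section_smooth_at R E).
Local Notation operator := (section_of E -> section_of E).
Local Notation delta_type := ((R[i] -> R[i]) -> R[i] -> R[i]).

Section OneDerivation.
Variables (delta : delta_type) (D : operator).
Hypothesis HD : is_derivation X delta D.

Lemma der_smooth s x : X x -> sms s x -> sms (D s) x.
Proof. by move=> Xx ss; have [] := HD Xx ss ss. Qed.

Lemma der_eq s t x : X x -> sms s x -> (\forall y \near (x : R[i]^o), s y = t y) ->
  D s x = D t x.
Proof. by move=> Xx ss st; have [_ H _ _] := HD Xx ss (sms_eq st ss); exact: H. Qed.

Lemma derD s t x : X x -> sms s x -> sms t x ->
  D (fun y => s y + t y) x = D s x + D t x.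
Proof. by move=> Xx ss st; have [] := HD Xx ss st. Qed.

Lemma derZ f s x : X x -> smooth_at f x -> sms s x ->
  D (fun y => f y *: s y) x = delta f x *: s x + f x *: D s x.
Proof. by move=> Xx sf ss; have [_ _ _ H] := HD Xx ss ss; exact: H. Qed.

Hypothesis delta_cst : forall c x, delta (fun=> c) x = 0.

Lemma derZc c s x : X x -> sms s x -> D (fun y => c *: s y) x = c *: D s x.
Proof.
by move=> Xx ss; rewrite (derZ Xx (smooth_cst c x) ss) delta_cst scale0r add0r.
Qed.

Lemma der0 x : X x -> D (fun=> 0) x = 0.
Proof.
move=> Xx; have [s ss _] := @sms_through _ _ E x 0 Xx.
rewrite -[RHS](scale0r (D s x)) -(derZc 0 Xx ss).
by apply/esym/(der_eq Xx (smsZ (smooth_cst 0 x) ss)); apply: nearc => y; rewrite scale0r.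
Qed.

Lemma derB s t x : X x -> sms s x -> sms t x ->
  D (fun y => s y - t y) x = D s x - D t x.
Proof.
move=> Xx ss st; have st' := smsZ (smooth_cst (-1) x) st.
rewrite -[- D t x]scaleN1r -(derZc (-1) Xx st) -(derD Xx ss st').
by apply/esym/(der_eq Xx (smsD ss st')); apply: nearc => y; rewrite scaleN1r.
Qed.

Lemma der_sum x (I : Type) (r : seq I) (e : I -> section_of E) : X x ->
  (forall i, sms (e i) x) ->
  D (fun y => \sum_(i <- r) e i y) x = \sum_(i <- r) D (e i) x.
Proof.
move=> Xx se.
have ss r' : sms (fun y => \sum_(i <- r') e i y) x.
  apply: sms_eq (@sms_comb _ _ E x I r' xpredT (fun _ _ => 1) e _ _) => [|i _|i _].
  - by apply: nearc => y; apply: eq_bigr => i _; rewrite scale1r.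
  - exact: smooth_cst.
  - exact: se.
elim: r => [|i r IH].
  rewrite big_nil -[RHS](der0 Xx); apply: der_eq => //.
  by apply: nearc => y; rewrite big_nil.
rewrite big_cons -IH -(derD Xx (se i) (ss r)); apply: der_eq => //.
by apply: nearc => y; rewrite big_cons.
Qed.

End OneDerivation.

(** Applied with [d1 = d2]: for [a + b = 1] the result is a derivation with the same symbol, for
    [a + b = 0] an operator linear over functions. *)
Lemma is_derivation_comb (d1 d2 d : delta_type) (D1 D2 : operator) a b :
  is_derivation X d1 D1 -> is_derivation X d2 D2 ->
  (forall f x, d f x = a * d1 f x + b * d2 f x) ->
  is_derivation X d (fun s y => a *: D1 s y + b *: D2 s y).
Proof.
move=> H1 H2 dE x Xx s t ss st; split.
- by apply: smsD; apply: smsZ; [exact: smooth_cst|exact: (der_smooth H1)|exact: smooth_cst|exact: (der_smooth H2)].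
- by move=> e; rewrite (der_eq H1 Xx ss e) (der_eq H2 Xx ss e).
- by rewrite (derD H1)// (derD H2)// !scalerDr addrACA.
move=> f sf; rewrite (derZ H1)// (derZ H2)// dE !scalerDr scalerDl !scalerA.
by rewrite (mulrC a (f x)) (mulrC b (f x)) -!scalerA addrACA -scalerDr.
Qed.

Definition weil_conj (D : operator) : operator :=
  fun s y => weil (D (fun z => weil (s z)) y).

Lemma is_derivation_weil_conj (d : delta_type) (D : operator) :
  is_derivation X d D -> is_derivation X d (weil_conj D).
Proof.
move=> H x Xx s t ss st; have ws := weil_smooth Xx ss; have wt := weil_smooth Xx st.
split.
- exact: weil_smooth Xx (der_smooth H Xx ws).
- move=> e; congr (weil _); apply: (der_eq H Xx ws).
  by apply: filterS e => y ->.
- rewrite /weil_conj -weilD -(derD H Xx ws wt); congr (weil _).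
  apply/esym/(der_eq H Xx (smsD ws wt)).
  by apply: nearc => y; rewrite weilD.
move=> f sf; rewrite /weil_conj -[s x in RHS](weilK _ Xx) -(weilZ (d f x) (weil (s x))) -(weilZ (f x)) -weilD.
have /= <- := derZ H Xx sf ws; congr (weil _).
apply/esym/(der_eq H Xx (smsZ sf ws)).
by apply: nearc => y; rewrite weilZ.
Qed.

(** Over [X] the Weil operator is an involution; [half_sum] and [half_diff] are the parts of [D]
    that commute and anticommute with it. *)
Definition half_sum (D : operator) : operator :=
  fun s y => 2^-1 *: D s y + 2^-1 *: weil_conj D s y.
Definition half_diff (D : operator) : operator :=
  fun s y => 2^-1 *: D s y + (- 2^-1) *: weil_conj D s y.

Lemma is_derivation_half_sum (d : delta_type) (D : operator) :
  is_derivation X d D -> is_derivation X d (half_sum D).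
Proof.
move=> H; apply: (is_derivation_comb H (is_derivation_weil_conj H)) => f x.
by rewrite -mulrDl -div1r -splitr mul1r.
Qed.

Lemma is_derivation_half_diff (d : delta_type) (D : operator) :
  is_derivation X d D -> is_derivation X (fun _ _ => 0) (half_diff D).
Proof.
move=> H; apply: (is_derivation_comb H (is_derivation_weil_conj H)) => f x.
by rewrite mulNr subrr.
Qed.

(* [dd], [db] are the (1,0)- and (0,1)-parts of the Chern connection, [th] is
   the Higgs field and [ts] its adjoint; conjugation by the Weil operator
   changes the sign of the last two only. *)
Definition dd : operator := half_sum (nabla (conn E)).
Definition th : operator := half_diff (nabla (conn E)).
Definition db : operator := half_sum (nablabar (conn E)).
Definition ts : operator := half_diff (nablabar (conn E)).

Let D1 : is_derivation X (@del R) (nabla (conn E)) := (connP E).1.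
Let D2 : is_derivation X (@delbar R) (nablabar (conn E)) := (connP E).2.

Lemma dd_der : is_derivation X (@del R) dd.
Proof. exact: is_derivation_half_sum D1. Qed.
Lemma th_der : is_derivation X (fun _ _ => 0) th.
Proof. exact: is_derivation_half_diff D1. Qed.
Lemma db_der : is_derivation X (@delbar R) db.
Proof. exact: is_derivation_half_sum D2. Qed.
Lemma ts_der : is_derivation X (fun _ _ => 0) ts.
Proof. exact: is_derivation_half_diff D2. Qed.

Let del_c c x : del (fun=> c : R[i]) x = 0 := (del_cst c x).1.
Let delbar_c c x : delbar (fun=> c : R[i]) x = 0 := (del_cst c x).2.

Lemma nabla_dd s y : nabla (conn E) s y = dd s y + th s y.
Proof.
rewrite /dd /th /half_sum /half_diff addrACA -!scalerDl -div1r -splitr subrr.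
by rewrite scale1r scale0r addr0.
Qed.

Lemma nablabar_db s y : nablabar (conn E) s y = db s y + ts s y.
Proof.
rewrite /db /ts /half_sum /half_diff addrACA -!scalerDl -div1r -splitr subrr.
by rewrite scale1r scale0r addr0.
Qed.

Lemma weil_conj_flat s x : X x -> sms s x ->
  weil_conj (nabla (conn E)) (weil_conj (nablabar (conn E)) s) x =
  weil_conj (nablabar (conn E)) (weil_conj (nabla (conn E)) s) x.
Proof.
move=> Xx ss; rewrite /weil_conj; congr (weil _).
have ws := weil_smooth Xx ss.
have K t : \forall y \near (x : R[i]^o), t y = weil (weil (t y)).
  by apply: filterS (base_near E Xx) => y Xy; rewrite weilK.
rewrite -(der_eq D1 Xx (der_smooth D2 Xx ws) (K _)).
rewrite -(der_eq D2 Xx (der_smooth D1 Xx ws) (K _)).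
exact: conn_flat.
Qed.

Lemma comb_comp (A A' B B' : operator) (d e : delta_type) a b c f s x :
  is_derivation X d A -> is_derivation X d A' ->
  is_derivation X e B -> is_derivation X e B' ->
  (forall c x, d (fun=> c) x = 0) -> X x -> sms s x ->
  a *: A (fun y => c *: B s y + f *: B' s y) x +
  b *: A' (fun y => c *: B s y + f *: B' s y) x =
  (a * c) *: A (B s) x + (a * f) *: A (B' s) x +
  ((b * c) *: A' (B s) x + (b * f) *: A' (B' s) x).
Proof.
move=> HA HA' HB HB' d0 Xx ss.
have sB := der_smooth HB Xx ss; have sB' := der_smooth HB' Xx ss.
have sc := smsZ (smooth_cst c x) sB; have sf := smsZ (smooth_cst f x) sB'.
rewrite (derD HA Xx sc sf) (derD HA' Xx sc sf).
rewrite !(derZc HA d0 _ Xx) ?(derZc HA' d0 _ Xx)//.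
by rewrite !scalerDr !scalerA.
Qed.

(** The even part of flatness under conjugation by the Weil operator. The pair [nabla], [nablabar]
    and its conjugate are both flat, and in the sum of the two relations the mixed compositions
    cancel. *)
Lemma dd_db_comm s x : X x -> sms s x ->
  dd (db s) x + th (ts s) x = db (dd s) x + ts (th s) x.
Proof.
move=> Xx ss.
have C1 := is_derivation_weil_conj D1; have C2 := is_derivation_weil_conj D2.
rewrite {1}/dd {1}/db {1}/th {1}/ts /half_sum /half_diff.
rewrite !(comb_comp _ _ _ _ D1 C1 D2 C2 del_c Xx ss).
rewrite {1}/dd {1}/db {1}/th {1}/ts /half_sum /half_diff.
rewrite !(comb_comp _ _ _ _ D2 C2 D1 C1 delbar_c Xx ss).
rewrite (weil_conj_flat Xx ss) (conn_flat Xx ss) mulrNN !(mulNr, mulrN) !scaleNr.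
have K (V : zmodType) (a b c d : V) :
    a + b + (c + d) + (a - b + (- c + d)) = (a + a) + (d + d).
  by rewrite addrACA (addrACA a) subrr addr0 (addrACA c) subrr add0r.
by rewrite !K.
Qed.

(** The odd part: here the two flatness relations are subtracted. *)
Lemma th_db_comm s x : X x -> sms s x ->
  th (db s) x + dd (ts s) x = db (th s) x + ts (dd s) x.
Proof.
move=> Xx ss.
have C1 := is_derivation_weil_conj D1; have C2 := is_derivation_weil_conj D2.
rewrite {1}/dd {1}/db {1}/th {1}/ts /half_sum /half_diff.
rewrite !(comb_comp _ _ _ _ D1 C1 D2 C2 del_c Xx ss).
rewrite {1}/dd {1}/db {1}/th {1}/ts /half_sum /half_diff.
rewrite !(comb_comp _ _ _ _ D2 C2 D1 C1 delbar_c Xx ss).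
rewrite (weil_conj_flat Xx ss) (conn_flat Xx ss) !(mulNr, mulrN) !scaleNr.
have K (V : zmodType) (a b c d : V) :
    a + b + (- c - d) + (a - b + (c - d)) = (a + a) + (- d - d).
  by rewrite addrACA (addrACA a) subrr addr0 (addrACA (- c)) addNr add0r.
have K' (V : zmodType) (a b c d : V) :
    a - b + (c - d) + (a + b + (- c - d)) = (a + a) + (- d - d).
  by rewrite addrACA (addrACA a) addNr addr0 (addrACA c) subrr add0r.
by rewrite K K'.
Qed.

Definition in_hodge p s x := \forall y \near (x : R[i]^o), s y \in hodge E p y.

(* The Weil operator is [hsign p] on [E^p], so conjugating by it changes the
   sign of the component of [D s] in the neighbouring [E^q]. *)
Lemma nabla_split p s x (D : operator) (d : delta_type) q :
  is_derivation X d D -> (forall c x, d (fun=> c) x = 0) -> X x -> sms s x ->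
  in_hodge p s x -> hsign E q = - hsign E p ->
  D s x \in (hodge E p x + hodge E q x)%VS ->
  half_sum D s x \in hodge E p x /\ half_diff D s x \in hodge E q x.
Proof.
move=> HD d0 Xx ss sp pq /memv_addP[a ap [b bq ab]].
have E1 : weil_conj D s x = a - b.
  rewrite /weil_conj -(der_eq HD Xx (smsZ (smooth_cst (hsign E p) x) ss)); last first.
    by apply: filterS2 (base_near E Xx) sp => y Xy yp; rewrite (weil_hodge Xy yp).
  rewrite (derZc HD d0 _ Xx ss) ab scalerDr weilD !weilZ (weil_hodge Xx ap) (weil_hodge Xx bq).
  by rewrite pq !scalerA mulrN hsign_sqr scale1r scaleN1r.
rewrite /half_sum /half_diff E1 ab !scalerDr !scalerN !scaleNr opprK.
rewrite addrACA subrr addr0 (addrACA _ _ (- _)) subrr add0r.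
by split; apply: memvD; exact: memvZ.
Qed.

Lemma hodge_type_ops p s x : X x -> sms s x -> in_hodge p s x ->
  [/\ dd s x \in hodge E p x, th s x \in hodge E (p - 1) x,
      db s x \in hodge E p x & ts s x \in hodge E (p + 1) x].
Proof.
move=> Xx ss sp; have [g1 g2] := griffiths Xx ss sp.
have [a1 a2] := nabla_split D1 del_c Xx ss sp (hsign_pred E p) g1.
by have [a3 a4] := nabla_split D2 delbar_c Xx ss sp (hsign_succ E p) g2.
Qed.

Lemma hodge_type_ops_near p s x : X x -> sms s x -> in_hodge p s x ->
  [/\ in_hodge p (dd s) x, in_hodge (p - 1) (th s) x,
      in_hodge p (db s) x & in_hodge (p + 1) (ts s) x].
Proof.
move=> Xx ss sp.
have H : \forall y \near (x : R[i]^o), [/\ dd s y \in hodge E p y,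
    th s y \in hodge E (p - 1) y, db s y \in hodge E p y & ts s y \in hodge E (p + 1) y].
  apply: filterS3 (base_near E Xx) (sms_near Xx ss) (near_near sp) => y.
  exact: hodge_type_ops.
by split; apply: filterS H => y [].
Qed.

(** The odd identity equates the commutator of [th] and [db], with values in [E^(p-1)], to that of
    [ts] and [dd], with values in [E^(p+1)]. These pieces meet only in zero. *)
Lemma th_db_hodge p s x : X x -> sms s x -> in_hodge p s x ->
  th (db s) x = db (th s) x.
Proof.
move=> Xx ss sp; have [h1 h2 h3 h4] := hodge_type_ops_near Xx ss sp.
have s1 := der_smooth dd_der Xx ss; have s2 := der_smooth th_der Xx ss.
have s3 := der_smooth db_der Xx ss; have s4 := der_smooth ts_der Xx ss.
have [_ A1 _ _] := hodge_type_ops Xx s3 h3.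
have [_ _ A2 _] := hodge_type_ops Xx s2 h2.
have [A3 _ _ _] := hodge_type_ops Xx s4 h4.
have [_ _ _ A4] := hodge_type_ops Xx s1 h1.
have e : th (db s) x - db (th s) x = ts (dd s) x - dd (ts s) x.
  by apply/eqP; rewrite subr_eq addrAC eq_sym subr_eq eq_sym th_db_comm// addrC.
have B1 : th (db s) x - db (th s) x \in hodge E (p - 1) x by exact: memvB.
have B2 : th (db s) x - db (th s) x \in hodge E (p + 1) x by rewrite e; exact: memvB.
apply/eqP; rewrite -subr_eq0 -(hproj_id Xx B1) (hproj_eq0 Xx B2)//.
by rewrite lt_eqF// ltrD2l.
Qed.

Lemma th_db s x : X x -> sms s x -> th (db s) x = db (th s) x.
Proof.
move=> Xx ss.
have sp p : sms (fun y => hproj p (s y)) x by exact: hproj_smooth.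
have e : \forall y \near (x : R[i]^o), \sum_(p <- hodge_types E) hproj p (s y) = s y.
  by apply: filterS (base_near E Xx) => y Xy; rewrite sum_hproj.
have swap (A B : operator) (da dB : delta_type) : is_derivation X da A ->
    is_derivation X dB B -> (forall c x, da (fun=> c) x = 0) ->
    (forall c x, dB (fun=> c) x = 0) ->
    A (B s) x = \sum_(p <- hodge_types E) A (B (fun y => hproj p (s y))) x.
  move=> HA HB a0 b0.
  rewrite -(der_sum HA a0 _ Xx (fun p => der_smooth HB Xx (sp p))).
  have e' : \forall y \near (x : R[i]^o), B s y =
      \sum_(p <- hodge_types E) B (fun y => hproj p (s y)) y.
    apply: filterS3 (base_near E Xx) (sms_near Xx ss) (near_near e) => y Xy sy ey.
    have spy p : sms (fun y => hproj p (s y)) y by exact: hproj_smooth.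
    rewrite -(der_sum HB b0 _ Xy spy); apply: (der_eq HB Xy sy).
    by apply: filterS ey => z ->.
  exact: (der_eq HA Xx (der_smooth HB Xx ss) e').
rewrite (swap _ _ _ _ th_der db_der (fun _ _ => erefl) delbar_c).
rewrite (swap _ _ _ _ db_der th_der delbar_c (fun _ _ => erefl)).
apply: eq_bigr => p _; apply: (th_db_hodge Xx (sp p)).
by apply: nearc => y; exact: hproj_in.
Qed.

(** The form can be written as [Q (C s, t)] or as [Q (s, C t)]. Differentiating both expressions
    with the flat pairing gives two formulas: their average is metric compatibility, their
    difference is adjointness of [th] and [ts]. *)
Lemma del_hform s t x : X x -> sms s x -> sms t x ->
  del (fun y => hform (s y) (t y)) x = hform (dd s x) (t x) + hform (s x) (db t x) /\
  hform (th s x) (t x) = hform (s x) (ts t x).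
Proof.
move=> Xx ss st; have ws := weil_smooth Xx ss; have wt := weil_smooth Xx st.
have E1 : del (fun y => hform (s y) (t y)) x =
    hform (weil_conj (nabla (conn E)) s x) (t x) + hform (s x) (nablabar (conn E) t x).
  have [-> _] := @del_eq _ (fun y => pairing E y (weil (s y)) (t y)) (fun y => hform (s y) (t y)) x
    (pairing_smooth Xx ws st) (filterS (fun y Xy => esym (hform_weill (s y) (t y) Xy)) (base_near E Xx)).
  have [-> _] := pairing_flat Xx ws st.
  by rewrite !hform_weill// /weil_conj weilK.
have E2 : del (fun y => hform (s y) (t y)) x =
    hform (nabla (conn E) s x) (t x) + hform (s x) (weil_conj (nablabar (conn E)) t x).
  have [-> _] := @del_eq _ (fun y => pairing E y (s y) (weil (t y))) (fun y => hform (s y) (t y)) x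
    (pairing_smooth Xx ss wt) (filterS (fun y Xy => esym (hform_weilr (s y) (t y) Xy)) (base_near E Xx)).
  have [-> _] := pairing_flat Xx ss wt.
  by rewrite !hform_weilr// /weil_conj weilK.
have cj2 : cj (2^-1) = 2^-1 :> R[i].
  have -> : (2^-1 : R[i]) = (2^-1 : R)%:C by rewrite fmorphV rmorph_nat.
  exact: cj_real.
rewrite /dd /db /th /ts /half_sum /half_diff.
rewrite !(hformDl, hformDr, hformZl, hformZr)// cjN cj2.
move: E1; rewrite E2; set a := hform _ _; set b := hform _ _; set c := hform _ _; set d := hform _ _.
move=> e; have h2 : (2^-1 + 2^-1 : R[i]) = 1 by rewrite [RHS]splitr div1r.
move: (2^-1 : R[i]) h2 => h h2; split.
  rewrite -[LHS]mul1r -h2 mulrDl {1}e; ring.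
have -> : h * a + - h * c = h * (a + b) - h * b - h * c by ring.
by rewrite e; ring.
Qed.

Lemma th_ts s t x : X x -> sms s x -> sms t x ->
  hform (th s x) (t x) = hform (s x) (ts t x).
Proof. by move=> Xx ss st; have [] := del_hform Xx ss st. Qed.

Lemma delbar_hform s t x : X x -> sms s x -> sms t x ->
  delbar (fun y => hform (s y) (t y)) x = hform (db s x) (t x) + hform (s x) (dd t x).
Proof.
move=> Xx ss st.
have [_ ->] := @del_eq _ (fun y => cj (hform (t y) (s y))) (fun y => hform (s y) (t y)) x
  (smooth_cj (hform_smooth Xx st ss)) (nearc _ (fun y => esym (hformC (s y) (t y)))).
have [_ ->] := del_cj (hform_smooth Xx st ss).
have [-> _] := del_hform Xx st ss.
by rewrite cjD -!hformC addrC.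
Qed.

End Derivations.

(** * The Higgs field on vectors, and the curvature of Hodge norms of sections *)

Section CurvatureIdentities.
Variables (R : realType) (X : set R[i]^o) (E : pvhs X).
Implicit Types (x y : R[i]) (p q : int) (s t e f : section_of E).

Local Notation sms := (@section_smooth_at R E).
Local Notation dd := (@dd R X E).
Local Notation db := (@db R X E).
Local Notation th := (@th R X E).
Local Notation ts := (@ts R X E).

Let del_c c x : del (fun=> c : R[i]) x = 0 := (del_cst c x).1.
Let delbar_c c x : delbar (fun=> c : R[i]) x = 0 := (del_cst c x).2.
Let HD := @dd_der R X E.
Let HT := @th_der R X E.
Let HB := @db_der R X E.
Let HS := @ts_der R X E.

(** The vector is extended with constant coordinates in the frame centred at [x]; for an operator
    linear over functions every smooth extension gives the same value, by [tensorE]. *)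
Definition tensor_at (A : section_of E -> section_of E) x (v : E x) : E x :=
  \sum_k coord (frame E x x) k v *: A (frame_section x k) x.

Lemma tensorE (A : section_of E -> section_of E) s x :
  is_derivation X (fun _ _ => 0) A -> X x -> sms s x -> A s x = tensor_at A (s x).
Proof.
move=> HA Xx ss; have cx := chart_center E Xx.
have fs k := frame_smooth k Xx cx.
have se : \forall y \near (x : R[i]^o),
    s y = \sum_k frame_coord x k s y *: frame_section x k y.
  by apply: filterS (chart_near E Xx) => y xy; exact: frame_expand.
have sk k : sms (fun y => frame_coord x k s y *: frame_section x k y) x.
  exact: smsZ (ss k) (fs k).
rewrite (der_eq HA Xx ss se) (der_sum HA (fun _ _ => erefl) _ Xx sk).
by apply: eq_bigr => k _; rewrite (derZ HA Xx (ss k) (fs k)) scale0r add0r.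
Qed.

Definition theta := tensor_at th.
Definition tstar := tensor_at ts.

Lemma thetaE s x : X x -> sms s x -> th s x = theta (s x).
Proof. exact: tensorE HT. Qed.

Lemma tstarE s x : X x -> sms s x -> ts s x = tstar (s x).
Proof. exact: tensorE HS. Qed.

Lemma tensor_atD A x (v w : E x) : tensor_at A (v + w) = tensor_at A v + tensor_at A w.
Proof.
rewrite /tensor_at -big_split; apply: eq_bigr => k _.
by rewrite linearD scalerDl.
Qed.

Lemma tensor_at0 A x : tensor_at A (0 : E x) = 0.
Proof. by rewrite /tensor_at big1// => k _; rewrite linear0 scale0r. Qed.

Lemma tensor_at_sum A x (I : Type) (r : seq I) (F : I -> E x) :
  tensor_at A (\sum_(i <- r) F i) = \sum_(i <- r) tensor_at A (F i).
Proof.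
elim: r => [|i r IH]; first by rewrite !big_nil tensor_at0.
by rewrite !big_cons tensor_atD IH.
Qed.

Lemma sms_through_hodge p x (v : E x) : X x -> v \in hodge E p x ->
  exists s, [/\ sms s x, in_hodge p s x & s x = v].
Proof.
move=> Xx vp; have [s ss sv] := sms_through v Xx.
exists (fun y => hproj p (s y)); split.
- exact: hproj_smooth.
- by apply: nearc => y; exact: hproj_in.
by rewrite sv hproj_id.
Qed.

Lemma theta_hodge p x (v : E x) : X x -> v \in hodge E p x ->
  theta v \in hodge E (p - 1) x.
Proof.
move=> Xx vp; have [s [ss sp <-]] := sms_through_hodge Xx vp.
by rewrite -thetaE//; have [] := hodge_type_ops Xx ss sp.
Qed.

Lemma tstar_hodge p x (v : E x) : X x -> v \in hodge E p x ->
  tstar v \in hodge E (p + 1) x.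
Proof.
move=> Xx vp; have [s [ss sp <-]] := sms_through_hodge Xx vp.
by rewrite -tstarE//; have [] := hodge_type_ops Xx ss sp.
Qed.

Lemma theta_adj x (v w : E x) : X x -> hform (theta v) w = hform v (tstar w).
Proof.
move=> Xx; have [s ss <-] := sms_through v Xx; have [t st <-] := sms_through w Xx.
by rewrite -thetaE// -tstarE// th_ts.
Qed.

Lemma tstar_adj x (v w : E x) : X x -> hform (tstar v) w = hform v (theta w).
Proof. by move=> Xx; rewrite hformC -theta_adj// -hformC. Qed.

Lemma deldelbar_hform s x : X x -> sms s x ->
  del (delbar (fun y => hform (s y) (s y))) x =
  hform (dd (db s) x) (s x) + hform (db s x) (db s x) +
  (hform (dd s x) (dd s x) + hform (s x) (db (dd s) x)).
Proof.
move=> Xx ss; have sd := der_smooth HD Xx ss; have sb := der_smooth HB Xx ss.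
have e : \forall y \near (x : R[i]^o), hform (db s y) (s y) + hform (s y) (dd s y) =
    delbar (fun y => hform (s y) (s y)) y.
  by apply: filterS2 (base_near E Xx) (sms_near Xx ss) => y Xy sy; rewrite delbar_hform.
have s1 := hform_smooth Xx sb ss; have s2 := hform_smooth Xx ss sd.
have [-> _] := del_eq (smoothD s1 s2) e; have [-> _] := delD s1 s2.
by have [-> _] := del_hform Xx sb ss; have [-> _] := del_hform Xx ss sd.
Qed.

(** The conditions at the single point [x] stand in for holomorphy of [f]. The curvature term
    [db (dd f)] is then the commutator of [theta] and [tstar], and adjointness turns it into a
    difference of squared norms. *)
Lemma lcurv_hform f x : X x -> sms f x -> db f x = 0 -> dd (db f) x = 0 ->
  let n := hform (f x) (f x) in let g := dd f x in
  lcurv (fun y => hform (f y) (f y)) x =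
  (n * (hform g g + (hform (tstar (f x)) (tstar (f x)) - hform (theta (f x)) (theta (f x))))
   - hform g (f x) * cj (hform g (f x))) / n ^+ 2.
Proof.
move=> Xx sf bf dbf n g; rewrite /lcurv deldelbar_hform// bf dbf !hform0l// !add0r.
have [-> _] := del_hform Xx sf sf; rewrite delbar_hform// bf hform0l// hform0r// addr0 add0r.
rewrite -/n -/g -hformC; congr ((n * (_ + _) - _) / _).
have := dd_db_comm Xx sf; rewrite dbf add0r => E1.
have st := der_smooth HT Xx sf; have ss := der_smooth HS Xx sf.
have -> : db (dd f) x = theta (tstar (f x)) - tstar (theta (f x)).
  by rewrite -(thetaE Xx sf) -(tstarE Xx sf) -(thetaE Xx ss) -(tstarE Xx st) E1 addrK.
by rewrite hformDr// hformNr// -(tstar_adj (f x) (tstar (f x)) Xx) -(theta_adj (f x) (theta (f x)) Xx).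
Qed.

(* Take [e = s - z dd s - zbar db s + z zbar db (dd s)] for a section [s] of
   [E^p] through [v]; then [db e] is [zbar] times a smooth section. *)
Lemma adapted_section p x (v : E x) : X x -> v \in hodge E p x ->
  exists e, [/\ sms e x, in_hodge p e x, e x = v, dd e x = 0 &
    [/\ db e x = 0, dd (db e) x = 0, db (th e) x = 0 & dd (db (th e)) x = 0]].
Proof.
move=> Xx vp; have [s [ss sp sv]] := sms_through_hodge Xx vp.
pose z y := y - x; pose zb y := cj (y - x).
have sz y : smooth_at z y by exact: smoothB (smooth_id y) (smooth_cst x y).
have szb y : smooth_at zb y by exact: smooth_cj (sz y).
have dz y : del z y = 1 /\ delbar z y = 0.
  have [-> ->] := delB (smooth_id y) (smooth_cst x y).
  by have [-> ->] := del_id y; have [-> ->] := del_cst x y; rewrite !subr0.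
have dzb y : del zb y = 0 /\ delbar zb y = 1.
  by have [-> ->] := del_cj (sz y); have [-> ->] := dz y; rewrite cj0 cj1.
have z0 : z x = 0 by rewrite /z subrr.
have zb0 : zb x = 0 by rewrite /zb subrr cj0.
pose r := db (dd s).
pose e y := s y - z y *: dd s y - zb y *: db s y + (z y * zb y) *: r y.
have opS y : X y -> sms s y -> [/\ sms (dd s) y, sms (db s) y & sms r y].
  move=> Xy sy; have h1 := der_smooth HD Xy sy; have h2 := der_smooth HB Xy sy.
  by have h3 := der_smooth HB Xy h1; split.
have parts y : X y -> sms s y -> [/\ sms (fun y => z y *: dd s y) y,
    sms (fun y => zb y *: db s y) y & sms (fun y => (z y * zb y) *: r y) y].
  move=> Xy sy; have [h1 h2 h3] := opS y Xy sy.
  split; [exact: smsZ (sz y) h1|exact: smsZ (szb y) h2|].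
  exact: smsZ (smoothM (sz y) (szb y)) h3.
have se y : X y -> sms s y -> sms e y.
  move=> Xy sy; have [h1 h2 h3] := parts y Xy sy.
  exact: smsD (smsB (smsB sy h1) h2) h3.
have derE (A : section_of E -> section_of E) da y : is_derivation X da A ->
    (forall c x, da (fun=> c) x = 0) -> X y -> sms s y ->
    A e y = A s y - (da z y *: dd s y + z y *: A (dd s) y)
      - (da zb y *: db s y + zb y *: A (db s) y)
      + (da (fun y => z y * zb y) y *: r y + (z y * zb y) *: A r y).
  move=> HA a0 Xy sy; have [h1 h2 h3] := parts y Xy sy.
  have [k1 k2 k3] := opS y Xy sy.
  rewrite (derD HA Xy (smsB (smsB sy h1) h2) h3) (derB HA a0 Xy (smsB sy h1) h2).
  rewrite (derB HA a0 Xy sy h1) (derZ HA Xy (sz y) k1) (derZ HA Xy (szb y) k2).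
  by rewrite (derZ HA Xy (smoothM (sz y) (szb y)) k3).
(* This is [db e] divided by [zb]: in [db e], the term [db s] cancels against the derivative of
   [zb], and [z r] against the derivative of [z zb]. *)
pose t y := z y *: db r y - db (db s) y.
have [s1 s2 s3] := opS x Xx ss.
have st : sms t x by exact: smsB (smsZ (sz x) (der_smooth HB Xx s3)) (der_smooth HB Xx s2).
have bE : \forall y \near (x : R[i]^o), zb y *: t y = db e y.
  apply: filterS2 (base_near E Xx) (sms_near Xx ss) => y Xy sy.
  rewrite (derE _ _ y HB delbar_c Xy sy).
  have [_ ->] := delM (sz y) (szb y); have [_ ->] := dz y; have [_ ->] := dzb y.
  rewrite scale0r add0r mul0r add0r mulr1 scale1r /t scalerBr scalerA (mulrC (zb y)) -/r.
  move: (z y *: r y) (db s y) ((z y * zb y) *: db r y) (zb y *: db (db s) y) => a b c d.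
  have -> : b - a - (b + d) = - a - d by rewrite opprD addrACA subrr add0r.
  by rewrite addrACA addNr add0r addrC.
(* Since [th] commutes with [db] and is linear over functions, [db (th e)] also acquires the factor
   [zb]. *)
have thE : \forall y \near (x : R[i]^o), zb y *: th t y = db (th e) y.
  apply: filterS3 (base_near E Xx) (filterI (sms_near Xx ss) (sms_near Xx st)) (near_near bE) => y Xy [sy ty] bEy.
  rewrite -(th_db Xy (se y Xy sy)) -(der_eq HT Xy (smsZ (szb y) ty) bEy).
  by rewrite (derZ HT Xy (szb y) ty) scale0r add0r.
have ddz u : sms u x -> dd (fun y => zb y *: u y) x = 0.
  move=> su; rewrite (derZ HD Xx (szb x) su); have [-> _] := dzb x.
  by rewrite zb0 !scale0r addr0.
have [h1 _ h3 _] := hodge_type_ops_near Xx ss sp.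
have [_ _ h4 _] := hodge_type_ops_near Xx s1 h1.
exists e; split.
- exact: se.
- apply: filterS3 (filterI sp h1) h3 h4 => y [k1 k2] k3 k4.
  by rewrite /e; apply: memvD; [apply: memvB; [apply: memvB|]|]; rewrite ?memvZ.
- by rewrite /e z0 zb0 mul0r !scale0r !subr0 addr0.
- rewrite (derE _ _ x HD del_c Xx ss).
  have [-> _] := delM (sz x) (szb x); have [-> _] := dz x; have [-> _] := dzb x.
  by rewrite z0 zb0 !(mul0r, mulr0, scale0r, scale1r, addr0, add0r) subrr subr0 ?addr0.
split.
- by rewrite -(nbhs_singleton bE) zb0 scale0r.
- by rewrite -(der_eq HD Xx (smsZ (szb x) st) bE) ddz.
- by rewrite -(nbhs_singleton thE) zb0 scale0r.
- rewrite -(der_eq HD Xx (smsZ (szb x) (der_smooth HT Xx st)) thE).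
  by rewrite (ddz _ (der_smooth HT Xx st)).
Qed.

(** Flatness reads [dd s = - th s] and [db s = - ts s], so every derivative of the norm is expressed
    by [theta] and [tstar]. The first formula feeds the gradient bound, the second is
    subharmonicity. *)
Lemma lcurv_flat s x : X x -> sms s x ->
  (\forall y \near (x : R[i]^o), nabla (conn E) s y = 0 /\ nablabar (conn E) s y = 0) ->
  del (fun y => hform (s y) (s y)) x = - (hform (theta (s x)) (s x) *+ 2) /\
  (s x != 0 -> 0 <= lcurv (fun y => hform (s y) (s y)) x).
Proof.
move=> Xx ss flat.
have st := der_smooth HT Xx ss; have sss := der_smooth HS Xx ss.
have flat' : \forall y \near (x : R[i]^o), dd s y = - th s y /\ db s y = - ts s y.
  apply: filterS flat => y [e1 e2]; split; apply/eqP; rewrite -addr_eq0.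
    by rewrite -nabla_dd e1.
  by rewrite -nablabar_db e2.
have [fd fb] := nbhs_singleton flat'.
have d1 : del (fun y => hform (s y) (s y)) x = - (hform (theta (s x)) (s x) *+ 2).
  have [-> _] := del_hform Xx ss ss.
  by rewrite fd fb hformNl// hformNr// -th_ts// thetaE// -opprD mulr2n.
split=> // sx0.
have bE : \forall y \near (x : R[i]^o), - 2 * hform (s y) (th s y) =
    delbar (fun y => hform (s y) (s y)) y.
  apply: filterS3 (base_near E Xx) (sms_near Xx ss) flat' => y Xy sy [fdy fby].
  rewrite delbar_hform// fdy fby hformNl// hformNr// tstarE// thetaE// tstar_adj//.
  by rewrite mulNr mulr_natl mulr2n opprD.
have bE' : delbar (fun y => hform (s y) (s y)) x = - 2 * hform (s x) (theta (s x)).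
  by rewrite -(nbhs_singleton bE) thetaE.
have dbt : db (th s) x = - theta (tstar (s x)).
  rewrite -th_db//.
  have fb' : \forall y \near (x : R[i]^o), (-1) *: ts s y = db s y.
    by apply: filterS flat' => y [_ ->]; rewrite scaleN1r.
  rewrite -(der_eq HT Xx (smsZ (smooth_cst (-1) x) sss) fb').
  by rewrite (derZ HT Xx (smooth_cst (-1) x) sss) scale0r add0r scaleN1r thetaE// tstarE.
have ddE : del (delbar (fun y => hform (s y) (s y))) x =
    2 * (hform (theta (s x)) (theta (s x)) + hform (tstar (s x)) (tstar (s x))).
  have sh := hform_smooth Xx ss st.
  have [-> _] := del_eq (smoothM (smooth_cst (-2) x) sh) bE.
  have [-> _] := delZ (-2) sh; have [-> _] := del_hform Xx ss st.
  rewrite fd dbt thetaE// hformNl// hformNr//.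
  by rewrite -(tstar_adj (s x) (tstar (s x)) Xx) -opprD mulrNN.
rewrite /lcurv d1 bE' ddE.
have CS1 := hform_CS (theta (s x)) (s x) Xx.
have CS2 := hform_CS (s x) (tstar (s x)) Xx.
move: CS2; rewrite -theta_adj// => CS2.
rewrite (hformC (s x) (theta (s x))).
have n0 : 0 < hform (s x) (s x) by exact: (hodge_pos Xx sx0).
apply: divr_ge0; last by rewrite exprn_ge0// ltW.
(* The numerator is twice the sum of the Cauchy-Schwarz defects of the pairs [(theta s, s)] and
   [(s, tstar s)], which by adjointness have the same inner product. *)
have -> : hform (s x) (s x) * (2 * (hform (theta (s x)) (theta (s x)) + hform (tstar (s x)) (tstar (s x)))) -
    - (hform (theta (s x)) (s x) *+ 2) * (- 2 * cj (hform (theta (s x)) (s x))) =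
  2 * ((hform (theta (s x)) (theta (s x)) * hform (s x) (s x) - hform (theta (s x)) (s x) * cj (hform (theta (s x)) (s x))) +
       (hform (s x) (s x) * hform (tstar (s x)) (tstar (s x)) - hform (theta (s x)) (s x) * cj (hform (theta (s x)) (s x)))).
  move: (hform (s x) (s x)) (hform (theta (s x)) (theta (s x))) (hform (tstar (s x)) (tstar (s x)))
    (cj (hform (theta (s x)) (s x))) (hform (theta (s x)) (s x)) => a b c d e; rewrite -mulr_natl; ring.
by rewrite mulr_ge0// addr_ge0// subr_ge0.
Qed.

End CurvatureIdentities.

(** * The Ahlfors estimate for the Higgs field *)

Section AttainedSupremum.
Variable R : realType.

(* The sets [V t] are only upper semicontinuous in [t]: if no value reached the
   supremum [S], compactness would keep all of them below some [s < S]. *)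
Lemma sup_attained (T Y : topologicalType) (K : set T) (V : T -> set R) :
  compact K -> (exists2 t, K t & V t !=set0) ->
  (forall t r, K t -> V t r -> r <= 1) ->
  (forall t0, K t0 -> exists (C : set Y) (rho : T -> Y -> R),
     [/\ compact C,
         forall c m, C c -> rho t0 c < m ->
           \forall t \near t0 & y \near c, rho t y < m,
         \forall t \near t0, forall r, V t r -> exists2 c, C c & r = rho t c &
         forall c, C c -> V t0 (rho t0 c)]) ->
  exists t0 r0, [/\ K t0, V t0 r0 & forall t r, K t -> V t r -> r <= r0].
Proof.
move=> cK [t1 Kt1 [r1 Vr1]] bnd loc.
pose A := [set r | exists2 t, K t & V t r].
have hA : has_sup A.
  split; first by exists r1; exists t1.
  by exists 1 => r [t Kt Vr]; exact: bnd Vr.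
pose S := sup A.
have leS t r : K t -> V t r -> r <= S.
  by move=> Kt Vr; apply: ub_le_sup; [case: hA|exists t].
have [[t [r [Kt Vr rS]]]|no] := pselect (exists t r, [/\ K t, V t r & r = S]).
  by exists t, r; split=> // t' r' Kt' Vr'; rewrite rS; exact: leS Vr'.
have ltS t r : K t -> V t r -> r < S.
  move=> Kt Vr; rewrite lt_neqAle (leS _ _ Kt Vr) andbT.
  by apply/eqP => rS; apply: no; exists t, r.
have ncK := (compact_near_coveringP K).1 cK.
(* Compactness is used twice: along [K], with [s] tending to [S] from the left, and inside along the
   parameter set [C] of the fibers near [t0]. *)
have key : \forall s \near S^'-, K `<=` (fun t => forall r, V t r -> r < s).
  apply: (ncK _ _ (fun s t => forall r, V t r -> r < s)) => t0 Kt0.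
  have [C [rho [cC cont near0 val]]] := loc t0 Kt0.
  have ncC := (compact_near_coveringP C).1 cC.
  have H : \forall ts \near (filter_prod (nbhs t0) S^'-), C `<=` (fun c => rho ts.1 c < ts.2).
    apply: (ncC _ _ (fun ts c => rho ts.1 c < ts.2)) => c Cc.
    have rS := ltS _ _ Kt0 (val c Cc).
    pose m := (rho t0 c + S) / 2.
    have m1 : rho t0 c < m by rewrite /m; lra.
    have m2 : m < S by rewrite /m; lra.
    have [[P Q] /= [Pt Qc] PQ] := cont c m Cc m1.
    exists (Q, [set ts : T * R | P ts.1 /\ m < ts.2]).
      split=> //=; exists (P, [set s | m < s]); first by split=> //=; exact: nbhs_left_gt.
      by move=> [t s] /= [].
    move=> [y [t s]] /= [Qy [Pt' ms]]; apply: lt_trans ms.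
    exact: (PQ (t, y)).
  have [[P Q] /= [Pt Qc] PQ] := H.
  exists ([set t | P t /\ forall r, V t r -> exists2 c, C c & r = rho t c], Q).
    by split=> //=; exact: filterI.
  move=> [t s] /= [[Pt' Vt] Qs] r /Vt[c Cc ->].
  exact: (PQ (t, s)).
have [s [sS Ks]] : exists s, s < S /\ K `<=` (fun t => forall r, V t r -> r < s).
  have sl : \forall s \near S^'-, s < S by exact: nbhs_left_lt.
  have [s [? ?]] := filter_ex (filterI sl key).
  by exists s.
have : S <= s.
  by apply: ge_sup => [|r [t Kt Vr]]; [exists r1; exists t1|exact/ltW/(Ks t Kt)].
by rewrite leNgt sS.
Qed.

Definition crect (a b c d : R) : set R[i]^o :=
  [set z : R[i] | a <= complex.Re z <= b /\ c <= complex.Im z <= d].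

Lemma crect_compact a b c d : compact (crect a b c d).
Proof.
have cf : continuous (fun p : R * R => (p.1 +i* p.2)%C : R[i]^o).
  move=> [x y] A /nbhs_box[e e0 eA].
  apply: (@filterS _ _ _ (fun p : R * R => `|p.1 - x| < e /\ `|p.2 - y| < e)).
    by move=> [u v] /= [h1 h2]; apply: eA.
  exists (ball x e, ball y e); first by split; exact: nbhsx_ballx.
  by move=> [u v] /= [] /=; rewrite /ball /= distrC => ? ; rewrite distrC.
have -> : crect a b c d = (fun p : R * R => (p.1 +i* p.2)%C : R[i]^o) @` (`[a, b] `*` `[c, d]).
  apply/seteqP; split => [[x y] /= [h1 h2]|_ [[x y] /= [h1 h2] <-]].
    by exists (x, y).
  by split; [move: h1|move: h2]; rewrite /= in_itv.
apply: continuous_compact; first exact: continuous_subspaceT.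
by apply: compact_setX; exact: segment_compact.
Qed.

Section HermitianForms.
Variable n : nat.
Local Notation Y := 'rV[R[i]^o]_n.
Implicit Types (H G : 'I_n -> 'I_n -> R[i] -> R[i]) (t : R[i]) (c : Y).

(** The squared norm of a vector with coordinates [c] in a local frame, [H] being the matrix of the
    form; the compactness argument needs continuity jointly in point and coordinates. *)
Definition quad H t c : R[i] := \sum_k \sum_l c ord0 k * cj (c ord0 l) * H k l t.

Lemma quad_continuous H t c : (forall k l, continuous_pt (H k l) t) ->
  {for ((t : R[i]^o), c), continuous (fun p : R[i]^o * Y => quad H p.1 p.2 : R[i]^o)}.
Proof.
move=> cH.
have csum (F : 'I_n -> R[i]^o * Y -> R[i]^o) :
    (forall k, {for ((t : R[i]^o), c), continuous (F k)}) ->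
    {for ((t : R[i]^o), c), continuous (fun p => \sum_k F k p)}.
  move=> cF; elim: (index_enum _) => [|k r IH].
    have -> : (fun p => \sum_(k <- [::]) F k p) = (fun=> 0).
      by apply/funext => p; rewrite big_nil.
    exact: cvg_cst.
  have -> : (fun p => \sum_(k <- k :: r) F k p) = (fun p => F k p + \sum_(k <- r) F k p).
    by apply/funext => p; rewrite big_cons.
  exact: (@cvgD _ R[i]^o _ _ _ _ _ _ _ (cF k) IH).
apply: (csum _) => k; apply: (csum _) => l.
have cc j : {for ((t : R[i]^o), c), continuous (fun p : R[i]^o * Y => p.2 ord0 j)}.
  by apply: (@continuous_comp _ _ _ snd (fun M : Y => M ord0 j)); [exact: cvg_snd|exact: coord_continuous].
have ccjz (z : R[i]) : {for (z : R[i]^o), continuous (fun z : R[i]^o => cj z : R[i]^o)}.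
  exact: (continuous_pt_conj (@continuous_pt_id R z)).
have ccj j : {for ((t : R[i]^o), c), continuous (fun p : R[i]^o * Y => cj (p.2 ord0 j) : R[i]^o)}.
  apply: (@continuous_comp _ _ _ (fun p : R[i]^o * Y => p.2 ord0 j) (fun z : R[i]^o => cj z : R[i]^o)); first exact: cc.
  exact: (ccjz (c ord0 j : R[i])).
have cHt : {for ((t : R[i]^o), c), continuous (fun p : R[i]^o * Y => H k l p.1 : R[i]^o)}.
  by apply: (@continuous_comp _ _ _ fst (fun z : R[i]^o => H k l z : R[i]^o)); [exact: cvg_fst|exact: cH].
exact: (@cvgM _ _ _ _ _ _ _ _ (@cvgM _ _ _ _ _ _ _ _ (cc k) (ccj l)) cHt).
Qed.

Definition Re_quad H t c : R := complex.Re (quad H t c).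

Lemma Re_quad_continuous H t c : (forall k l, continuous_pt (H k l) t) ->
  {for ((t : R[i]^o), c), continuous (fun p : R[i]^o * Y => Re_quad H p.1 p.2)}.
Proof.
move=> cH; apply: (@continuous_comp _ _ _ (fun p : R[i]^o * Y => quad H p.1 p.2 : R[i]^o) (fun z : R[i]^o => complex.Re z)).
  exact: quad_continuous.
move=> A /nbhs_ballP[e /= e0 eA]; apply/nbhs_box; exists e => // w wr _.
by apply: eA; rewrite /ball /= distrC -ReB.
Qed.

(* A nonzero vector can be scaled so that its largest coordinate is [1]; this
   replaces the unit sphere by a finite union of products of compact sets. *)
Definition polydisc k : set Y :=
  [set c | forall j, (if j == k then [set 1] else crect (-1) 1 (-1) 1) (c ord0 j)].

Lemma polydiscs_compact : compact (\big[setU/set0]_(k < n) polydisc k).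
Proof.
apply: bigsetU_compact => k _.
apply: (@rV_compact R[i]^o n (fun j => if j == k then [set 1] else crect (-1) 1 (-1) 1)) => j.
by case: ifP => _; [exact: compact_set1|exact: crect_compact].
Qed.

Lemma normalize_row c : c != 0 -> exists2 a : R[i], a != 0 &
  (\big[setU/set0]_(k < n) polydisc k) (\row_k (a * c ord0 k)).
Proof.
move=> c0; have [k0 ck0] : exists k, c ord0 k != 0.
  apply/existsP; rewrite -negb_forall; apply: contra c0 => /forallP c0.
  by apply/eqP/rowP => k; rewrite mxE; apply/eqP.
pose f k : R := complex.Re (c ord0 k * cj (c ord0 k)).
have [k _ kmax] := @arg_maxP _ _ _ k0 xpredT f isT.
have fE j : c ord0 j * cj (c ord0 j) = (f j)%:C /\ 0 <= f j.
  rewrite /f; case: (c ord0 j) => x y; split.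
    by apply/eqP; rewrite eq_complex /= eqxx /=; apply/eqP; ring.
  by rewrite /= mulrN opprK -!expr2 addr_ge0 ?sqr_ge0.
have fk : 0 < f k.
  apply: lt_le_trans (kmax k0 isT); rewrite lt_neqAle (fE k0).2 andbT eq_sym.
  apply/eqP => e; have := (fE k0).1; rewrite e => /eqP.
  by rewrite mulf_eq0 cj_eq0 orbb (negbTE ck0).
have ck : c ord0 k != 0.
  by apply/eqP => e; move: fk; rewrite /f e mul0r ltxx.
exists (c ord0 k)^-1; first by rewrite invr_eq0.
rewrite -bigcup_seq; exists k; first exact: mem_index_enum.
move=> j; rewrite mxE.
case: ifPn => [/eqP ->|_]; first by rewrite mulVf.
have : f j <= f k by exact: kmax.
have : complex.Re (((c ord0 k)^-1 * c ord0 j) * cj ((c ord0 k)^-1 * c ord0 j)) = f j / f k.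
  rewrite cjM cjV.
  have -> : (c ord0 k)^-1 * c ord0 j * ((cj (c ord0 k))^-1 * cj (c ord0 j)) =
    (c ord0 j * cj (c ord0 j)) / (c ord0 k * cj (c ord0 k)).
    by rewrite invfM; move: (c ord0 j) (cj (c ord0 j)) (c ord0 k)^-1 (cj (c ord0 k))^-1 => x y z w; ring.
  by rewrite (fE j).1 (fE k).1 -fmorphV -rmorphM.
case: ((c ord0 k)^-1 * c ord0 j) => x y /= E le.
have {le E} E : x ^+ 2 + y ^+ 2 <= 1.
  have : f j / f k <= 1 by rewrite ler_pdivrMr// mul1r.
  by rewrite -E; lra.
have hx : x ^+ 2 <= 1 by apply: le_trans E; rewrite lerDl sqr_ge0.
have hy : y ^+ 2 <= 1 by apply: le_trans E; rewrite lerDr sqr_ge0.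
by rewrite /crect /=; split; apply/andP; split; nra.
Qed.

End HermitianForms.
End AttainedSupremum.

(** * The Hodge norm weighted by type *)

Section WeightedNorm.
Variables (R : realType) (X : set R[i]^o) (E : pvhs X).
Implicit Types (x : R[i]) (p : int).

Definition sqnorm x (v : E x) : R := complex.Re (hform v v).

Lemma hformE x (v : E x) : X x -> hform v v = (sqnorm v)%:C.
Proof.
move=> Xx; rewrite /sqnorm; have := hform_ge0 v Xx.
by case: (hform v v) => a b; rewrite lecE /= => /andP[/eqP ->].
Qed.

Lemma sqnorm_ge0 x (v : E x) : X x -> 0 <= sqnorm v.
Proof. by move=> Xx; have := hform_ge0 v Xx; rewrite hformE// lecR. Qed.

Lemma sqnorm_eq0 x (v : E x) : X x -> (sqnorm v == 0) = (v == 0).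
Proof. by move=> Xx; rewrite -hform_eq0// hformE// eq_complex /= eqxx andbT. Qed.

Lemma sqnorm_gt0 x (v : E x) : X x -> v != 0 -> 0 < sqnorm v.
Proof. by move=> Xx v0; rewrite lt_neqAle eq_sym sqnorm_eq0// v0 sqnorm_ge0. Qed.

Lemma sqnormZ x (a : R[i]) (v : E x) : X x ->
  sqnorm (a *: v) = complex.Re (a * cj a) * sqnorm v.
Proof.
move=> Xx; rewrite {1}/sqnorm hformZl// hformZr// hformE// mulrA.
by case: a => a b /=; rewrite /cj /=; ring.
Qed.

Lemma hform_parseval x (v w : E x) : X x ->
  hform v w = \sum_(p <- hodge_types E) hform (hproj p v) (hproj p w).
Proof.
move=> Xx; apply: eq_bigr => p _.
by rewrite hform_weill// (weil_hodge Xx (hproj_in p v)) QZl.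
Qed.

Lemma sqnorm_parseval x (v : E x) : X x ->
  sqnorm v = \sum_(p <- hodge_types E) sqnorm (hproj p v).
Proof.
move=> Xx; rewrite {1}/sqnorm hform_parseval//.
elim: (hodge_types E) => [|p r IH]; first by rewrite !big_nil.
by rewrite !big_cons ReD IH.
Qed.

(** The summand [1] leaves room for a shift of type: it makes the weight at least [1] on occurring
    types and still nonnegative at their neighbours. *)
Definition type_bound : R := 1 + \sum_(p <- hodge_types E) `|p%:~R|.

(* Strictly concave in [p]: the second difference is [-2]. *)
Definition type_weight p : R := type_bound ^+ 2 - p%:~R ^+ 2.

Lemma type_boundP p : p \in hodge_types E -> `|p%:~R| + 1 <= type_bound :> R.
Proof.
move=> pt; rewrite /type_bound addrC lerD2l (bigD1_seq p) ?hodge_types_uniq//=.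
by rewrite lerDl sumr_ge0.
Qed.

Lemma type_weight_ge1 p : p \in hodge_types E -> 1 <= type_weight p.
Proof.
move=> /type_boundP; rewrite /type_weight -[in X in _ -> X](@real_normK _ (p%:~R : R)) ?num_real//.
have := normr_ge0 (p%:~R : R); move: (`|_|) type_bound => a b; nra.
Qed.

Lemma type_weight_adj p : p \in hodge_types E ->
  0 <= type_weight (p + 1) /\ 0 <= type_weight (p - 1).
Proof.
move=> /type_boundP; rewrite /type_weight !rmorphD rmorphN /= rmorph1.
rewrite -lerBrDr ler_norml.
by move: (p%:~R : R) type_bound => a b /andP[h1 h2]; split; nra.
Qed.

Definition weighted_form x (v w : E x) : R[i] :=
  \sum_(p <- hodge_types E) (type_weight p)%:C * hform (hproj p v) (hproj p w).

Definition weighted_norm x (v : E x) : R :=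
  \sum_(p <- hodge_types E) type_weight p * sqnorm (hproj p v).

Lemma weighted_formE x (v : E x) : X x -> weighted_form v v = (weighted_norm v)%:C.
Proof.
move=> Xx; rewrite /weighted_norm rmorph_sum /=; apply: eq_bigr => p _.
by rewrite hformE// -rmorphM.
Qed.

Lemma weighted_norm_ge x (v : E x) : X x -> sqnorm v <= weighted_norm v.
Proof.
move=> Xx; rewrite sqnorm_parseval// /weighted_norm !big_seq.
by apply: ler_sum => p pt; rewrite ler_peMl ?sqnorm_ge0// type_weight_ge1.
Qed.

Lemma weighted_norm_le x (v : E x) : X x ->
  weighted_norm v <= type_bound ^+ 2 * sqnorm v.
Proof.
move=> Xx; rewrite sqnorm_parseval// mulr_sumr; apply: ler_sum => p _.
by rewrite ler_wpM2r ?sqnorm_ge0// gerBl sqr_ge0.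
Qed.

Lemma weighted_norm_hodge p x (v : E x) : X x -> v \in hodge E p x ->
  weighted_norm v = type_weight p * sqnorm v.
Proof.
move=> Xx vp; have [pt|pt] := boolP (p \in hodge_types E).
  rewrite /weighted_norm (bigD1_seq p) ?hodge_types_uniq//= hproj_id//.
  by rewrite big1 ?addr0// => q qp; rewrite (hproj_eq0 Xx vp qp) (eqP (_ : sqnorm 0 == 0)) ?mulr0// sqnorm_eq0.
move: vp; rewrite hodge_out// memv0 => /eqP ->.
have n0 : sqnorm (0 : E x) = 0 by apply/eqP; rewrite sqnorm_eq0.
by rewrite n0 mulr0 /weighted_norm big1// => q _; rewrite hproj0 n0 mulr0.
Qed.

Lemma tensor_atZ A x (c : R[i]) (v : E x) : tensor_at A (c *: v) = c *: tensor_at A v.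
Proof.
rewrite /tensor_at scaler_sumr; apply: eq_bigr => k _.
by rewrite linearZ scalerA.
Qed.

(** [theta] lowers the type by one, so the images of distinct components lie in distinct Hodge
    pieces and are orthogonal. *)
Lemma sqnorm_theta x (v : E x) : X x ->
  sqnorm (theta v) = \sum_(p <- hodge_types E) sqnorm (theta (hproj p v)).
Proof.
move=> Xx; rewrite {1}/sqnorm -{1 2}(sum_hproj v Xx) /theta !tensor_at_sum.
have E1 (r : seq int) : uniq r -> hform (\sum_(p <- r) tensor_at (@th R X E) (hproj p v))
    (\sum_(p <- r) tensor_at (@th R X E) (hproj p v)) =
    \sum_(p <- r) hform (tensor_at (@th R X E) (hproj p v)) (tensor_at (@th R X E) (hproj p v)).
  elim: r => [|p r IH]; first by rewrite !big_nil hform0l.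
  rewrite /= => /andP[pr ur].
  rewrite !big_cons hformDl// !hformDr// IH//.
  have Z : hform (tensor_at (@th R X E) (hproj p v)) (\sum_(q <- r) tensor_at (@th R X E) (hproj q v)) = 0.
    elim: r pr {IH ur} => [|q r IH]; first by rewrite big_nil hform0r.
    rewrite inE negb_or => /andP[pq pr]; rewrite big_cons hformDr// IH// addr0.
    apply: (hform_orth Xx (theta_hodge Xx (hproj_in p v)) (theta_hodge Xx (hproj_in q v))).
    by rewrite (inj_eq (addIr _)).
  have Z' : hform (\sum_(q <- r) tensor_at (@th R X E) (hproj q v)) (tensor_at (@th R X E) (hproj p v)) = 0.
    by rewrite hformC Z cj0.
  by rewrite Z Z' addr0 add0r.
rewrite E1 ?hodge_types_uniq//.
elim: (hodge_types E) => [|p r IH]; first by rewrite !big_nil.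
by rewrite !big_cons ReD IH.
Qed.

Lemma hform_comb x n (c : 'I_n -> R[i]) (u : 'I_n -> E x) : X x ->
  hform (\sum_k c k *: u k) (\sum_k c k *: u k) =
  \sum_k \sum_l c k * cj (c l) * hform (u k) (u l).
Proof.
move=> Xx.
have El w : hform (\sum_k c k *: u k) w = \sum_k c k * hform (u k) w.
  by apply: (big_ind2 (fun a b => hform a w = b)) => [|a b a' b' <- <-|k _];
    rewrite ?hform0l ?hformDl ?hformZl.
have Er w : hform w (\sum_k c k *: u k) = \sum_k cj (c k) * hform w (u k).
  by apply: (big_ind2 (fun a b => hform w a = b)) => [|a b a' b' <- <-|k _];
    rewrite ?hform0r ?hformDr ?hformZr.
rewrite El; apply: eq_bigr => k _; rewrite Er mulr_sumr.
by apply: eq_bigr => l _; rewrite mulrA.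
Qed.

Lemma weighted_form_comb x n (c : 'I_n -> R[i]) (u : 'I_n -> E x) : X x ->
  weighted_form (\sum_k c k *: u k) (\sum_k c k *: u k) =
  \sum_k \sum_l c k * cj (c l) * weighted_form (u k) (u l).
Proof.
move=> Xx; rewrite /weighted_form.
under eq_bigr => p _.
  rewrite hproj_sum; under eq_bigr do rewrite hprojZ.
  rewrite (hform_comb c (fun k => hproj p (u k)) Xx) mulr_sumr.
  under eq_bigr do rewrite mulr_sumr.
  over.
rewrite exchange_big; apply: eq_bigr => k _; rewrite exchange_big; apply: eq_bigr => l _.
rewrite mulr_sumr; apply: eq_bigr => p _; rewrite mulrCA; ring.
Qed.

Lemma weighted_form_smooth s t x : X x -> @section_smooth_at R E s x ->
  @section_smooth_at R E t x -> smooth_at (fun y => weighted_form (s y) (t y)) x.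
Proof.
move=> Xx ss st; apply: smooth_sum => p _; apply: smoothM; first exact: smooth_cst.
by apply: hform_smooth => //; exact: hproj_smooth.
Qed.

End WeightedNorm.

(** * Existence of a maximising vector over a strip *)

Section AhlforsEstimate.
Variable R : realType.

Lemma cexp_punctured_disk (z : R[i]) : complex.Re z < 0 -> punctured_disk (cexp z).
Proof.
move=> z0; have nE : `|cexp z| = (expR (complex.Re z))%:C.
  rewrite normc_def; congr (_%:C).
  have := cexp_norm2 z; case: (cexp z) => a b /= [E _].
  have -> : a ^+ 2 + b ^+ 2 = expR (complex.Re z) ^+ 2 by rewrite -E; ring.
  by rewrite sqrtr_sqr ger0_norm// expR_ge0.
by rewrite /punctured_disk /= nE !ltcR expR_gt0 expR_lt1.
Qed.

(** Translation by periods into [[0, 2 pi]], by induction on the number of periods needed.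
    Invariance is asked on one vertical line only, so that it applies both to [cexp] and to norms
    known to be periodic on the half-plane. *)
Lemma fundamental_strip (T : Type) (f : R[i] -> T) (z : R[i]) :
  (forall u, complex.Re u = complex.Re z -> f (u - two_pi_i R) = f u) ->
  exists z', [/\ complex.Re z' = complex.Re z, 0 <= complex.Im z' <= 2 * pi & f z' = f z].
Proof.
move=> shift; have pi0 : 0 < pi :> R by exact: pi_gt0.
have shift1 (u : R[i]) : complex.Re u = complex.Re z -> f (u + two_pi_i R) = f u.
  by move=> uz; rewrite -[LHS]shift ?addrK// ReD uz /= addr0.
suff H n (u : R[i]) : complex.Re u = complex.Re z ->
    - (2 * pi * n%:R) <= complex.Im u <= 2 * pi * n.+1%:R ->
    exists z', [/\ complex.Re z' = complex.Re z, 0 <= complex.Im z' <= 2 * pi & f z' = f u].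
  have [n nP] : exists n : nat, `|complex.Im z| / (2 * pi) < n%:R.
    by exists (Num.bound (`|complex.Im z| / (2 * pi))); apply: archi_boundP; rewrite divr_ge0// mulr_ge0// ltW.
  apply: (H n z erefl); move: nP; rewrite ltr_pdivrMr ?mulr_gt0// => nP.
  have E1 : n.+1%:R = n%:R + 1 :> R by rewrite natr1.
  rewrite E1; have := ler_norm (complex.Im z); have := ler_norm (- complex.Im z); rewrite normrN.
  move: nP; move: (n%:R : R) (complex.Im z) `|_| => m y t; move: pi pi0 => P P0 *.
  by apply/andP; split; nra.
elim: n u => [|n IH] u uz.
  by rewrite mulr0 oppr0 mulr1 => h; exists u.
have E1 : n.+1%:R = n%:R + 1 :> R by rewrite natr1.
have E2 : n.+2%:R = n%:R + 1 + 1 :> R by rewrite -E1 natr1.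
rewrite E1 E2 => /andP[h1 h2].
have [u0|u0] := ltP (complex.Im u) 0.
  have [||z' [e1 e2 e3]] := IH (u + two_pi_i R).
  - by rewrite ReD uz /= addr0.
  - by rewrite ImD /= E1; move: (n%:R : R) (ler0n R n) h1 h2 => m m0 h1 h2; apply/andP; split; nra.
  by exists z'; split=> //; rewrite e3 shift1.
have [u1|u1] := leP (complex.Im u) (2 * pi); first by exists u; rewrite u0 u1.
have [||z' [e1 e2 e3]] := IH (u - two_pi_i R).
- by rewrite ReB uz /= subr0.
- by rewrite ImB /= E1; move: (n%:R : R) (ler0n R n) h1 h2 => m m0 h1 h2; apply/andP; split; nra.
by exists z'; split=> //; rewrite e3 shift.
Qed.

Lemma cexp_fundamental_strip (z : R[i]) : exists z',
  [/\ complex.Re z' = complex.Re z, 0 <= complex.Im z' <= 2 * pi & cexp z' = cexp z].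
Proof. by apply: fundamental_strip => u _; exact: cexp_period. Qed.

Variable E : pvhs (@punctured_disk R).
Local Notation X := (@punctured_disk R).

(** With [N = W * sqnorm (theta v)] and [D] the weighted norm, the maximised function is
    [N / (N + D)]: it is increasing in [N / D] but bounded by [1] without any prior estimate. The
    conclusion is the comparison of [N / D], cross-multiplied. *)
Lemma weighted_max (a b : R) (W : R[i] -> R) : b < 0 ->
  (forall z, continuous_pt (fun z => (W z)%:C) z) ->
  (forall z, 0 <= W z) ->
  (exists z1 (v1 : E (cexp z1)), crect a b 0 (2 * pi) z1 /\ v1 != 0) ->
  exists z0 (v0 : E (cexp z0)), [/\ crect a b 0 (2 * pi) z0, v0 != 0 &
    forall z (v : E (cexp z)), crect a b 0 (2 * pi) z ->
      W z * sqnorm (theta v) * weighted_norm v0 <=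
      W z0 * sqnorm (theta v0) * weighted_norm v].
Proof.
move=> b0 cW W0 [z1 [v1 [Kz1 v10]]].
have XK z : crect a b 0 (2 * pi) z -> X (cexp z).
  by move=> [/andP[_ zb] _]; apply: cexp_punctured_disk; exact: le_lt_trans zb b0.
pose N z (v : E (cexp z)) := W z * sqnorm (theta v).
have N0 z (v : E (cexp z)) : X (cexp z) -> 0 <= N z v.
  by move=> Xz; rewrite mulr_ge0// sqnorm_ge0.
have D0 z (v : E (cexp z)) : X (cexp z) -> v != 0 -> 0 < weighted_norm v.
  by move=> Xz vn; apply: lt_le_trans (weighted_norm_ge v Xz); exact: sqnorm_gt0.
pose V z := [set r | exists2 v : E (cexp z), v != 0 & r = N z v / (N z v + weighted_norm v)].
have ND z (v : E (cexp z)) : X (cexp z) -> v != 0 -> 0 < N z v + weighted_norm v.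
  by move=> Xz vn; rewrite ltr_wpDl ?N0// D0.
have := @sup_attained R R[i]^o 'rV[R[i]^o]_(rk E) (crect a b 0 (2 * pi)) V (@crect_compact R _ _ _ _).
case.
- by exists z1 => //; exists (N z1 v1 / (N z1 v1 + weighted_norm v1)); exists v1.
- move=> z r /XK Xz [v vn ->]; rewrite ler_pdivrMr ?ND// mul1r lerDl.
  exact/ltW/D0.
- move=> t0 /XK Xt0; set x0 := cexp t0 in Xt0 *.
  (* Nearby fibers are compared through the frame at [x0]; in its coordinates [N] and
     [N + weighted_norm] are the hermitian forms [H] and [G]. *)
  pose e k : section_of E := frame_section x0 k.
  pose H k l t : R[i] := (W t)%:C * hform (th (e k) (cexp t)) (th (e l) (cexp t)).
  pose G k l t : R[i] := H k l t + weighted_form (e k (cexp t)) (e l (cexp t)).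
  pose vec t (c : 'rV[R[i]^o]_(rk E)) : E (cexp t) := \sum_k c ord0 k *: e k (cexp t).
  have se k y : chart_dom E x0 y -> section_smooth_at (e k) y by move=> cy; exact: frame_smooth.
  have HE t c : X (cexp t) -> chart_dom E x0 (cexp t) ->
      quad H t c = (N t (vec t c))%:C.
    move=> Xt ct; rewrite /N rmorphM /= -hformE//.
    have -> : theta (vec t c) = \sum_k c ord0 k *: th (e k) (cexp t).
      rewrite /theta tensor_at_sum; apply: eq_bigr => k _.
      by rewrite tensor_atZ (thetaE Xt (se k _ ct)).
    rewrite hform_comb// mulr_sumr; apply: eq_bigr => k _; rewrite mulr_sumr.
    by apply: eq_bigr => l _; rewrite /H mulrCA.
  have GE t c : X (cexp t) -> chart_dom E x0 (cexp t) ->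
      quad G t c = (N t (vec t c) + weighted_norm (vec t c))%:C.
    move=> Xt ct; rewrite rmorphD /= -HE// -weighted_formE// weighted_form_comb//.
    rewrite /quad -big_split; apply: eq_bigr => k _ /=; rewrite -big_split.
    by apply: eq_bigr => l _ /=; rewrite -mulrDr.
  have c0 := chart_center E Xt0.
  have vec0 t c : chart_dom E x0 (cexp t) -> c != 0 -> vec t c != 0.
    move=> ct; apply: contraNneq => v0; apply/eqP/rowP => k; rewrite [RHS]mxE.
    have [hb _] := vb_smooth E; have [_ _ _ bas] := hb x0 Xt0.
    have /freeP := basis_free (bas _ ct); apply; rewrite -[RHS]v0.
    by apply: eq_bigr => j _; rewrite /e /frame_section (tnth_nth 0).
  have disc0 (c : 'rV[R[i]^o]_(rk E)) : (\big[setU/set0]_(k < rk E) @polydisc R (rk E) k) c -> c != 0.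
    rewrite -bigcup_seq => -[k _ /(_ k)]; rewrite eqxx => ck.
    by apply/eqP => c0'; move: ck; rewrite c0' mxE /= => /eqP; rewrite eq_sym oner_eq0.
  have cexp_c : continuous_pt (@cexp R) t0 by exact: smooth_continuous (smooth_cexp t0).
  have cH k l : continuous_pt (H k l) t0.
    apply: continuous_ptM (cW t0) _; apply: smooth_continuous.
    apply: (@smooth_comp _ (fun y => hform (th (e k) y) (th (e l) y)) _ _ (smooth_cexp t0)).
    by apply: hform_smooth => //; apply: (der_smooth (@th_der R X E)) => //; exact: se.
  have cG k l : continuous_pt (G k l) t0.
    apply: continuous_ptD (cH k l) _; apply: smooth_continuous.
    apply: (@smooth_comp _ (fun y => weighted_form (e k y) (e l y)) _ _ (smooth_cexp t0)).
    by apply: weighted_form_smooth => //; exact: se.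
  pose rho (t : R[i]^o) c := Re_quad H t c / Re_quad G t c.
  have rhoE t c : X (cexp t) -> chart_dom E x0 (cexp t) ->
      rho t c = N t (vec t c) / (N t (vec t c) + weighted_norm (vec t c)).
    by move=> Xt ct; rewrite /rho /Re_quad HE// GE.
  exists (\big[setU/set0]_(k < rk E) @polydisc R (rk E) k), rho; split.
  + exact: polydiscs_compact.
  + move=> c m /disc0 cn lm.
    have Gn : Re_quad G t0 c != 0.
      by rewrite /Re_quad GE//= gt_eqF// ND// vec0.
    have C1 := Re_quad_continuous (c := c) cH; have C2 := Re_quad_continuous (c := c) cG.
    have C3 : rho p.1 p.2 @[p --> ((t0 : R[i]^o), c)] --> rho t0 c.
      by apply: cvgM; [exact: C1|apply: cvgV; [exact: Gn|exact: C2]].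
    have L := cvgr_lt _ C3 _ lm; exact: L.
  + have n1 : \forall t \near (t0 : R[i]^o), X (cexp t) /\ chart_dom E x0 (cexp t).
      exact: (cexp_c _ (filterI (base_near E Xt0) (chart_near E Xt0))).
    apply: filterS n1 => t [Xt ct] r [v vn ->].
    pose c : 'rV[R[i]^o]_(rk E) := \row_k coord (frame E x0 (cexp t)) k v.
    have vE : v = vec t c.
      by rewrite {1}(frame_expand v Xt0 ct); apply: eq_bigr => k _; rewrite mxE.
    have cn : c != 0.
      by apply: contraNneq vn => c0'; rewrite vE c0' /vec big1// => k _; rewrite mxE scale0r.
    (* Numerator and denominator scale by the same factor, so the coordinates may be moved into the
       compact set. *)
    have [s s0 sc] := normalize_row cn; exists (\row_k (s * c ord0 k)) => //.
    rewrite rhoE//.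
    have -> : vec t (\row_k (s * c ord0 k)) = s *: v.
      by rewrite vE /vec scaler_sumr; apply: eq_bigr => k _; rewrite mxE scalerA.
    have q0 : 0 < complex.Re (s * cj s).
      case: (s) s0 => x y; rewrite eq_complex /= negb_and /cj /= mulrN opprK -!expr2 => xy.
      rewrite lt_neqAle addr_ge0 ?sqr_ge0// andbT eq_sym paddr_eq0 ?sqr_ge0// !sqrf_eq0.
      by rewrite negb_and.
    have -> : N t (s *: v) = complex.Re (s * cj s) * N t v.
      by rewrite /N /theta tensor_atZ sqnormZ// mulrCA.
    have -> : weighted_norm (s *: v) = complex.Re (s * cj s) * weighted_norm v.
      rewrite /weighted_norm mulr_sumr; apply: eq_bigr => p _.
      by rewrite hprojZ sqnormZ// mulrCA.
    by rewrite -mulrDr -mulf_div divff ?gt_eqF// mul1r.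
  by move=> c /disc0 cn; exists (vec t0 c); [exact: vec0|rewrite rhoE].
move=> z0 [r0 [Kz0 [v0 v0n ->] mx]].
exists z0, v0; split=> // z v Kz.
have [->|vn] := eqVneq v 0.
  have n0 : sqnorm (0 : E (cexp z)) = 0 by apply/eqP; rewrite sqnorm_eq0//; exact: XK.
  have w0 : 0 <= weighted_norm (0 : E (cexp z)).
    by apply: le_trans (weighted_norm_ge _ (XK _ Kz)); exact: sqnorm_ge0 (XK _ Kz).
  rewrite /theta tensor_at0 n0 mulr0 mul0r.
  exact: mulr_ge0 (N0 z0 v0 (XK _ Kz0)) w0.
have := mx z _ Kz; move=> /(_ _ (ex_intro2 _ _ v vn erefl)).
have a1 := ND _ _ (XK _ Kz) vn; have a2 := ND _ _ (XK _ Kz0) v0n.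
rewrite ler_pdivrMr// mulrAC ler_pdivlMr// -/(N z v) -/(N z0 v0); lra.
Qed.

End AhlforsEstimate.

(** * Curvature at a maximising vector *)

Section CurvaturePinch.
Variables (R : realType) (X : set R[i]^o) (E : pvhs X).
Implicit Types (x : R[i]) (p : int).

Lemma mul_cj_real (z : R[i]) : z * cj z = (complex.Re (z * cj z))%:C.
Proof. by case: z => a b; apply/eqP; rewrite eq_complex /= eqxx /=; apply/eqP; ring. Qed.

Lemma sqnorm_CS x (v w : E x) : X x ->
  complex.Re (hform v w * cj (hform v w)) <= sqnorm v * sqnorm w.
Proof.
by move=> Xx; have := hform_CS v w Xx; rewrite mul_cj_real !hformE// -rmorphM lecR.
Qed.

(** With [b_q] for the weights, the log-curvature of [|th e|^2] is at least [A (b_p - b_(p-1))] and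
    that of [|e|^2] at most [A (b_(p+1) - b_p)]. The difference is [A] times minus the second
    difference of the weights, that is [2 A]. *)
Lemma curvature_pinch p x (v : E x) (A : R) : X x -> v \in hodge E p x -> v != 0 ->
  theta v != 0 -> 0 <= A ->
  (forall q (u : E x), u \in hodge E q x ->
     sqnorm (theta u) <= A * type_weight E q * sqnorm u) ->
  sqnorm (theta v) = A * type_weight E p * sqnorm v ->
  exists e : section_of E, [/\ section_smooth_at e x, in_hodge p e x, e x = v &
    A *+ 2 <= complex.Re (lcurv (fun y => hform (th e y) (th e y)) x)
              - complex.Re (lcurv (fun y => hform (e y) (e y)) x)].
Proof.
move=> Xx vp v0 tv0 A0 bnd eqv.
have [e [se ep ev de [be dbe bte dbte]]] := adapted_section Xx vp.
exists e; split=> //.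
have pt : p \in hodge_types E.
  by apply: contraNT v0 => pt; move: vp; rewrite hodge_out// memv0.
have ste := der_smooth (@th_der R X E) Xx se.
rewrite (lcurv_hform Xx ste bte dbte) (lcurv_hform Xx se be dbe).
rewrite de ev (thetaE Xx se) ev.
set f := theta v in tv0 eqv *; set g := dd (th e) x.
rewrite !hform0l// cj0 mulr0 subr0 add0r !hformE// (mul_cj_real (hform g f)).
rewrite -!(rmorphM, rmorphD, rmorphB, rmorphXn) -!fmorphV -!rmorphM /=.
have n0 := sqnorm_gt0 Xx v0; have m0 := sqnorm_gt0 Xx tv0.
have CS1 := sqnorm_CS g f Xx.
(* Equality holds at [v], and [|theta v|^2] is the product of [tstar (theta v)] with [v]: this
   bounds [|tstar (theta v)|] from below. *)
have CS2 : sqnorm f ^+ 2 <= sqnorm (tstar f) * sqnorm v.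
  have := sqnorm_CS (tstar f) v Xx.
  by rewrite tstar_adj// -/f hformE// cj_real -rmorphM /= -expr2.
have CS3 : sqnorm (tstar v) ^+ 2 <= sqnorm v * sqnorm (theta (tstar v)).
  have := sqnorm_CS v (theta (tstar v)) Xx.
  by rewrite -tstar_adj// hformE// cj_real -rmorphM /= -expr2.
have B1 := bnd _ _ (tstar_hodge Xx vp).
have B2 := bnd _ _ (theta_hodge Xx vp); rewrite -/f in B2.
have s0 := sqnorm_ge0 (tstar v) Xx.
have [w1 w2] := type_weight_adj pt.
have wE : type_weight E p *+ 2 = type_weight E (p - 1) + type_weight E (p + 1) + 2.
  by rewrite /type_weight !rmorphD rmorphN /= rmorph1; move: (p%:~R : R) (type_bound E) => y b; ring.
move: CS1 CS2 CS3 B1 B2 s0 n0 m0 eqv w1 w2 wE.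
move: (complex.Re (hform g f * cj (hform g f))) (sqnorm g) (sqnorm (theta f)) (sqnorm (tstar f))
  (sqnorm (theta (tstar v))) (sqnorm (tstar v)) (sqnorm f) (sqnorm v)
  (type_weight E p) (type_weight E (p - 1)) (type_weight E (p + 1)).
move=> r g2 m' s' k s m n w wm wp CS1 CS2 CS3 B1 B2 s0 n0 m0 eqv w1 w2 wE.
(* The bound on [theta] over [E^(p+1)] passes to its adjoint on [E^p]:
   [|tstar v|^4 <= |v|^2 |theta (tstar v)|^2], then one factor [s] is cancelled. *)
have S : s <= A * wp * n.
  have [sp|s00] := ltP 0 s; last by apply: le_trans s00 _; rewrite !mulr_ge0// ltW.
  rewrite -(ler_pM2r sp); apply: le_trans (_ : n * k <= _); first by rewrite -expr2.
  by rewrite [leRHS]mulrAC [leRHS]mulrC; rewrite ler_wpM2l// ltW.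
have S' : A * w * m <= s'.
  rewrite -(ler_pM2r n0); apply: le_trans CS2; rewrite eqv.
  by rewrite le_eqVlt; apply/orP; left; apply/eqP; ring.
(* The gradient term [g2 * m - r] is a Cauchy-Schwarz defect and has the favourable sign. *)
have K1 : A * w - A * wm <= (m * (g2 + (s' - m')) - r) / m ^+ 2.
  rewrite ler_pdivlMr ?exprn_gt0//.
  have h : m * (A * w * m - A * wm * m) <= m * (s' - m') by rewrite (ler_wpM2l (ltW m0))//; lra.
  have -> : (A * w - A * wm) * m ^+ 2 = m * (A * w * m - A * wm * m) by ring.
  have -> : m * (g2 + (s' - m')) - r = m * (s' - m') + (g2 * m - r) by ring.
  lra.
have K2 : (n * (s - m)) / n ^+ 2 <= A * wp - A * w.
  rewrite ler_pdivrMr ?exprn_gt0//.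
  have -> : (A * wp - A * w) * n ^+ 2 = n * (A * wp * n - A * w * n) by ring.
  by rewrite (ler_wpM2l (ltW n0))//; lra.
have : A * (w *+ 2) = A * (wm + wp + 2) by rewrite wE.
by rewrite !mulr2n; lra.
Qed.

Lemma lcurv_cst (c z : R[i]) : lcurv (fun=> c) z = 0.
Proof.
have E0 : \forall w \near (z : R[i]^o), (fun=> 0 : R[i]) w = delbar (fun=> c : R[i]) w.
  by apply: nearc => w; have [_ ->] := del_cst c w.
rewrite /lcurv; have [-> _] := del_eq (smooth_cst 0 z) E0.
by have [-> _] := del_cst (0 : R[i]) z; have [-> _] := del_cst c z; rewrite mulr0 mul0r subrr mul0r.
Qed.

End CurvaturePinch.

(** * The estimate of the Higgs field *)

Section ThetaBound.
Variables (R : realType) (E : pvhs (@punctured_disk R)).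
Local Notation X := (@punctured_disk R).

(** The maximum principle for [N / D] on the strip. The base point [y] is kept apart from [cexp z],
    so that a vector can be regarded over another logarithm of [y] without a cast. *)
Lemma theta_bound_strip (a b : R) : a < b -> b < 0 ->
  forall z (y : R[i]) (u : E y), a <= complex.Re z <= b -> cexp z = y ->
  (expR (complex.Re z) * ((complex.Re z - a) * (b - complex.Re z))) ^+ 2 * sqnorm (theta u) <=
  ((b - a) / 2) ^+ 2 * weighted_norm u.
Proof.
move=> ab b0.
pose W (z : R[i]) := (expR (complex.Re z) * ((complex.Re z - a) * (b - complex.Re z))) ^+ 2.
pose q (z : R[i]) := affine_Re (- a) 1 z * affine_Re b (-1) z.
pose Wc (z : R[i]) := cexp z * cj (cexp z) * q z ^+ 2.
have qE z : q z = ((complex.Re z - a) * (b - complex.Re z))%:C.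
  by rewrite /q /affine_Re -rmorphM; congr (_%:C); ring.
have WE z : Wc z = (W z)%:C.
  by rewrite /Wc cexp_norm2 qE -rmorphXn -rmorphM; congr (_%:C); rewrite /W [RHS]exprMn.
have sq z : smooth_at q z by exact: smoothM (smooth_affine_Re _ _ _) (smooth_affine_Re _ _ _).
have se (z : R[i]) := smooth_cexp z.
have s1 (z : R[i]) := smoothM (se z) (smooth_cj (se z)).
have sW z : smooth_at Wc z by exact: smoothM (s1 z) (smoothX 2 (sq z)).
have cW z : continuous_pt (fun z => (W z)%:C) z.
  by apply: continuous_pt_near (smooth_continuous (sW z)); apply: nearc => w; exact: WE.
have W0 z : 0 <= W z by exact: sqr_ge0.
have XK z : a <= complex.Re z <= b -> X (cexp z).
  by move=> /andP[_ zb]; apply: cexp_punctured_disk; exact: le_lt_trans zb b0.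
move=> z1 y1 u1 z1ab y1E; rewrite -/(W z1).
have Xy1 : X y1 by rewrite -y1E; exact: XK.
have [->|u10] := eqVneq u1 0.
  have n0 : sqnorm (0 : E y1) = 0 by apply/eqP; rewrite sqnorm_eq0.
  rewrite /theta tensor_at0 n0 mulr0 mulr_ge0 ?sqr_ge0//.
  by apply: le_trans (weighted_norm_ge _ Xy1); rewrite n0.
have [|z0 [v0 [[z0ab z0im] v0n mx]]] := weighted_max (E := E) (a := a) b0 cW W0.
  have [z' [r1 r2 r3]] := cexp_fundamental_strip z1.
  have y1E' : cexp z' = y1 by rewrite r3.
  case: _ / y1E' u1 u10 {y1E Xy1} => u1 u10.
  by exists z', u1; split=> //; split=> //; rewrite r1.
have Xz0 := XK _ z0ab.
have D0 : 0 < weighted_norm v0 by apply: lt_le_trans (weighted_norm_ge _ Xz0); exact: sqnorm_gt0.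
pose c := W z0 * sqnorm (theta v0) / weighted_norm v0.
have c0 : 0 <= c.
  by apply: divr_ge0; [apply: mulr_ge0; [exact: W0|exact: sqnorm_ge0]|exact: ltW].
have B z y (u : E y) : a <= complex.Re z <= b -> cexp z = y ->
    W z * sqnorm (theta u) <= c * weighted_norm u.
  move=> zab yE; have [z' [r1 r2 r3]] := cexp_fundamental_strip z.
  have yE' : cexp z' = y by rewrite r3.
  case: _ / yE' u {yE} => u.
  have -> : W z = W z' by rewrite /W r1.
  rewrite /c [leRHS]mulrAC ler_pdivlMr//; apply: mx; split=> //; by rewrite r1.
suff cl : c <= ((b - a) / 2) ^+ 2.
  apply: le_trans (B _ _ u1 z1ab y1E) _; rewrite ler_wpM2r//.
  by apply: le_trans (weighted_norm_ge _ Xy1); exact: sqnorm_ge0.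
have [cp|c00] := ltP 0 c; last by apply: le_trans c00 _; exact: sqr_ge0.
have eq0 : W z0 * sqnorm (theta v0) = c * weighted_norm v0 by rewrite /c divfK// gt_eqF.
(* The inequality holds on each Hodge component of [v0] and is an equality for
   their sum, hence on each component. *)
have [p [pt Pv0 eqp]] : exists p, [/\ p \in hodge_types E, hproj p v0 != 0 &
    W z0 * sqnorm (theta (hproj p v0)) = c * (type_weight E p * sqnorm (hproj p v0))].
  have Bp p : W z0 * sqnorm (theta (hproj p v0)) <= c * (type_weight E p * sqnorm (hproj p v0)).
    by rewrite -weighted_norm_hodge ?hproj_in//; apply: B.
  have sum0 : \sum_(p <- hodge_types E)
      (c * (type_weight E p * sqnorm (hproj p v0)) - W z0 * sqnorm (theta (hproj p v0))) = 0.
    by rewrite sumrB -!mulr_sumr -sqnorm_theta// -/(weighted_norm v0) eq0 subrr.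
  have all0 p : p \in hodge_types E -> c * (type_weight E p * sqnorm (hproj p v0)) - W z0 * sqnorm (theta (hproj p v0)) = 0.
    move=> pt; move: sum0 => /eqP; rewrite psumr_eq0 => [/allP/(_ p pt)/eqP//|r _].
    by rewrite subr_ge0.
  have /hasP[p pt pn] : has (fun p => hproj p v0 != 0) (hodge_types E).
    apply: contraNT v0n => /hasPn H; rewrite -(sum_hproj v0 Xz0) big_seq big1// => p /H.
    by rewrite negbK => /eqP.
  by exists p; split=> //; have /eqP := all0 p pt; rewrite subr_eq0 => /eqP.
set v := hproj p v0 in Pv0 eqp.
have vp : v \in hodge E p (cexp z0) by exact: hproj_in.
have vn0 := sqnorm_gt0 Xz0 Pv0.
have w1 : 0 < type_weight E p by apply: lt_le_trans (type_weight_ge1 pt).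
have Fz0 : 0 < W z0 * sqnorm (theta v) by rewrite eqp; exact: (mulr_gt0 cp (mulr_gt0 w1 vn0)).
have Wz0 : 0 < W z0.
  by rewrite lt_neqAle W0 andbT eq_sym; apply: contraTneq Fz0 => ->; rewrite mul0r ltxx.
have tv0 : theta v != 0.
  rewrite -sqnorm_eq0//; apply: contraTneq Fz0 => ->; by rewrite mulr0 ltxx.
have [|r u ur||e [sme ep ev pinch]] := curvature_pinch (A := c / W z0) Xz0 vp Pv0 tv0.
- exact: divr_ge0 c0 (ltW Wz0).
- have := B z0 _ u z0ab erefl; rewrite (weighted_norm_hodge Xz0 ur).
  rewrite mulrC -ler_pdivlMr// => H; apply: le_trans H _.
  by rewrite le_eqVlt; apply/orP; left; apply/eqP; ring.
- have -> : sqnorm (theta v) = (W z0 * sqnorm (theta v)) / W z0 by rewrite mulrC mulKf// gt_eqF.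
  by rewrite eqp; ring.
(* [W] vanishes on both vertical sides, so the maximum lies strictly between them; horizontally
   there is no boundary, as [B] holds for every imaginary part. *)
have [x0a x0b] : 0 < complex.Re z0 - a /\ 0 < b - complex.Re z0.
  move: z0ab => /andP[h1 h2]; rewrite !subr_gt0 !lt_neqAle h1 h2 !andbT.
  by split; apply: contraTneq Wz0 => e0; rewrite /W e0 subrr ?mul0r !mulr0 expr0n ltxx.
have ste := der_smooth (@th_der R X E) Xz0 sme.
have sF1 := hform_smooth Xz0 ste ste; have sG1 := hform_smooth Xz0 sme sme.
have sF2 : smooth_at (fun z => hform (th e (cexp z)) (th e (cexp z))) z0.
  exact: (@smooth_comp _ (fun y => hform (th e y) (th e y)) _ _ (se z0) sF1).
have sG2 : smooth_at (fun z => hform (e (cexp z)) (e (cexp z))) z0.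
  exact: (@smooth_comp _ (fun y => hform (e y) (e y)) _ _ (se z0) sG1).
(* On type [p] the weighted norm is a constant multiple of the Hodge norm, so along [e] the bound
   [B] reads [F <= G], with equality at [z0]. *)
pose k : R[i] := (c * type_weight E p)%:C.
have kn0 : k != 0 by rewrite eq_complex /= eqxx andbT; apply: mulf_neq0; rewrite gt_eqF.
pose F z := Wc z * hform (th e (cexp z)) (th e (cexp z)).
pose G z := k * hform (e (cexp z)) (e (cexp z)).
have FG : \forall z \near (z0 : R[i]^o), F z <= G z.
  have n1 : \forall y \near (cexp z0 : R[i]^o), [/\ X y, section_smooth_at e y & e y \in hodge E p y].
    by apply: filterS3 (base_near E Xz0) (sms_near Xz0 sme) ep => y.
  have n2 : \forall z \near (z0 : R[i]^o), [/\ X (cexp z), section_smooth_at e (cexp z) & e (cexp z) \in hodge E p (cexp z)].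
    have cc : continuous_pt (@cexp R) z0 by exact: smooth_continuous (se z0).
    exact: (cc _ n1).
  have n3 : \forall z \near (z0 : R[i]^o), a <= complex.Re z <= b.
    apply/nbhs_box; exists (Num.min (complex.Re z0 - a) (b - complex.Re z0)).
      by rewrite lt_min x0a x0b.
    move=> z; rewrite lt_min ReB => /andP[]; rewrite !ltr_norml => /andP[h1 h2] /andP[h3 h4] _.
    by apply/andP; split; lra.
  apply: filterS2 n2 n3 => z [Xz sz ez] zab.
  rewrite /F /G WE /k (thetaE Xz sz) !hformE// -!rmorphM lecR -(mulrA c (type_weight E p)).
  by rewrite -(weighted_norm_hodge Xz ez); apply: B.
have FE : F z0 = (W z0 * sqnorm (theta v))%:C.
  by rewrite /F WE (thetaE Xz0 sme) ev hformE// -rmorphM.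
have FG0 : F z0 = G z0.
  by rewrite FE eqp /G ev hformE// /k -rmorphM mulrA.
have F0 : 0 < F z0 by rewrite FE ltcR.
have := lcurv_le (smoothM (sW z0) sF2) (smoothM (smooth_cst k z0) sG2) FG FG0 F0.
have qn0 : q z0 != 0 by rewrite qE eq_complex /= eqxx andbT mulf_neq0// gt_eqF.
have hn1 : hform (th e (cexp z0)) (th e (cexp z0)) != 0 by rewrite hform_eq0// (thetaE Xz0 sme) ev.
have hn2 : hform (e (cexp z0)) (e (cexp z0)) != 0 by rewrite hform_eq0// ev.
have en0 : cexp z0 * cj (cexp z0) != 0 by rewrite mulf_neq0 ?cj_eq0 ?cexp_neq0.
have Wn0 : Wc z0 != 0 by rewrite mulf_neq0// expf_neq0.
rewrite (lcurvM (sW z0) sF2 Wn0 hn1) (lcurvM (smooth_cst k z0) sG2 kn0 hn2) lcurv_cst add0r.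
rewrite (@lcurv_comp_cexp _ (fun y => hform (th e y) (th e y)) _ sF1).
rewrite (@lcurv_comp_cexp _ (fun y => hform (e y) (e y)) _ sG1).
rewrite (lcurvM (s1 z0) (smoothX 2 (sq z0)) en0) ?expf_neq0// lcurv_cexp2 add0r.
rewrite (lcurvX 2 (sq z0) qn0).
have an1 : affine_Re (- a) 1 z0 != 0 by apply: contraNneq qn0; rewrite /q => ->; rewrite mul0r.
have an2 : affine_Re b (-1) z0 != 0 by apply: contraNneq qn0; rewrite /q => ->; rewrite mulr0.
rewrite (lcurvM (smooth_affine_Re _ _ _) (smooth_affine_Re _ _ _) an1 an2) !lcurv_affine_Re.
rewrite -rmorphD -(rmorph_nat (real_complex R)) -rmorphM ReD !ReZ [complex.Re _%:C]/=.
move: pinch; move: (complex.Re (lcurv _ _)) (complex.Re (lcurv _ _)) => K2 K1 pinch H.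
set x := complex.Re z0 in x0a x0b H Wz0 *.
have e0 : 0 < expR x by exact: expR_gt0.
have E2 : 0 < expR x ^+ 2 by rewrite exprn_gt0.
have H1 : expR x ^+ 2 * ((c / W z0) *+ 2) <= 2 * ((1 / (- a + 1 * x)) ^+ 2 / 4 + (-1 / (b + -1 * x)) ^+ 2 / 4).
  apply: le_trans (_ : expR x ^+ 2 * (K1 - K2) <= _); first by rewrite (ler_wpM2l (ltW E2)).
  by move: H; rewrite mulrBr; lra.
move: H1; rewrite /W -/x.
have -> : - a + 1 * x = x - a by ring.
have -> : b + -1 * x = b - x by ring.
have -> : b - a = (x - a) + (b - x) by ring.
move: (x - a) (b - x) (expR x) x0a x0b e0 {E2 H Wz0} => al be ex al0 be0 ex0.
have -> : ex ^+ 2 * ((c / (ex * (al * be)) ^+ 2) *+ 2) = (c * 2) / (al * be) ^+ 2.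
  by rewrite -mulr_natr; field; rewrite !gt_eqF.
have -> : 2 * ((1 / al) ^+ 2 / 4 + (-1 / be) ^+ 2 / 4) = ((al ^+ 2 + be ^+ 2) / 2) / (al * be) ^+ 2.
  by field; rewrite !gt_eqF.
rewrite ler_pM2r ?invr_gt0 ?exprn_gt0 ?mulr_gt0// => H.
(* What remains is [2 c <= (al^2 + be^2) / 2], and [al^2 + be^2 <= (al + be)^2] where
   [al + be = b - a]. *)
have := mulr_gt0 al0 be0; nra.
Qed.

(** The strip from [3 x / 2] to [x / 2] is centred at [x]: both cut-off factors equal [|x| / 2], as
    does half the width, which leaves [4 / x^2]. *)
Lemma theta_bound (z y : R[i]) (u : E y) : complex.Re z < 0 -> cexp z = y ->
  expR (complex.Re z) ^+ 2 * sqnorm (theta u) <=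
  4 / complex.Re z ^+ 2 * (type_bound E ^+ 2 * sqnorm u).
Proof.
move=> z0 yE; set x := complex.Re z in z0 *.
have Xy : X y by rewrite -yE; exact: cexp_punctured_disk.
have h1 : 3 / 2 * x < x / 2 by lra.
have h2 : x / 2 < 0 by lra.
have h3 : 3 / 2 * x <= complex.Re z <= x / 2 by rewrite -/x; apply/andP; split; lra.
have := theta_bound_strip h1 h2 u h3 yE; rewrite -/x.
have -> : (expR x * ((x - 3 / 2 * x) * (x / 2 - x))) ^+ 2 * sqnorm (theta u) =
  (expR x ^+ 2 * sqnorm (theta u)) * ((x / 2) ^+ 2) ^+ 2 by field.
have -> : ((x / 2 - 3 / 2 * x) / 2) ^+ 2 = (x / 2) ^+ 2 by field.
have p0 : 0 < (x / 2) ^+ 2 by rewrite exprn_even_gt0//= lt_eqF.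
have p00 : 0 < ((x / 2) ^+ 2) ^+ 2 by rewrite exprn_gt0 ?p0.
rewrite -(ler_pdivlMr _ _ p00) => H; apply: le_trans H _.
have -> : (x / 2) ^+ 2 * weighted_norm u / ((x / 2) ^+ 2) ^+ 2 = 4 / x ^+ 2 * weighted_norm u.
  by field; rewrite lt_eqF.
by rewrite ler_wpM2l ?weighted_norm_le// divr_ge0// sqr_ge0.
Qed.

End ThetaBound.

(** * Flat sections on the half-plane *)

Lemma Re_mul_cj (R : realType) (u w : R[i]) :
  complex.Re (u * w * cj (u * w)) = complex.Re (u * cj u) * complex.Re (w * cj w).
Proof. by case: u => a b; case: w => c d; rewrite /cj /=; ring. Qed.

Section MultivaluedFlatSections.
Variables (R : realType) (E : pvhs (@punctured_disk R)).
Variable v : multivalued_section E.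
Hypothesis v_flat : multivalued_flat v.
Local Notation X := (@punctured_disk R).
Local Notation sms := (@section_smooth_at R E).

Let coordv (z0 : R[i]) (k : 'I_(rk E)) : R[i] -> R[i] :=
  @frame_coord R (pullback (@cexp R) E) z0 k v.

(** The sum computes the cast of [u] whatever the centre of the frame, which allows expansions in
    two different frames to be identified. *)
Lemma sum_frame_coord_cast (w0 y y' : R[i]) (u : E y) (yy : y = y') :
  X w0 -> chart_dom E w0 y' ->
  \sum_k coord (frame E w0 y) k u *: frame_section w0 k y' = eq_rect y (fun t => E t) u y' yy.
Proof. by case: _ / yy => Xw cy; rewrite /= -frame_expand. Qed.

Lemma coordv_smooth z k : complex.Re z < 0 -> smooth_at (coordv z k) z.
Proof. by move=> z0; have [H _ _] := v_flat z0; exact: H. Qed.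

(** Because [cexp] is holomorphic, the (1,0)-part of the pulled back connection involves only
    [nabla], the (0,1)-part only [nablabar]. *)
Lemma coordv_flat z : complex.Re z < 0 ->
  \sum_k (del (coordv z k) z *: frame_section (cexp z) k (cexp z) +
     coordv z k z *: (cexp z *: nabla (conn E) (frame_section (cexp z) k) (cexp z))) = 0
  /\
  \sum_k (delbar (coordv z k) z *: frame_section (cexp z) k (cexp z) +
     coordv z k z *: (cj (cexp z) *: nablabar (conn E) (frame_section (cexp z) k) (cexp z))) = 0.
Proof.
move=> z0; have [_ H1 H2] := v_flat z0.
have [d1 d2] := del_cexp z; have [d3 d4] := del_cj_cexp z.
split; [rewrite -[RHS]H1|rewrite -[RHS]H2]; apply: eq_bigr => k _; congr (_ + _ *: _).
  by rewrite d1 -[(fun w => _)]/(fun w => cj (cexp w : R[i])) d3 scale0r addr0.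
by rewrite d2 -[(fun w => _)]/(fun w => cj (cexp w : R[i])) d4 scale0r add0r.
Qed.

(** A branch [L] of the logarithm brings [v] down to the disk as [s w = v (L w)]. The norm
    computations for flat sections of [E] then apply to [v] locally. *)
Lemma local_flat_section z0 : complex.Re z0 < 0 -> exists s : section_of E,
  (\forall z \near (z0 : R[i]^o), s (cexp z) = v z) /\
  (\forall w \near (cexp z0 : R[i]^o),
     [/\ sms s w, nabla (conn E) s w = 0 & nablabar (conn E) s w = 0]).
Proof.
move=> z00; have [L [L1 L2 sL dL]] := local_log z0.
set w0 := cexp z0 in L2 sL dL *.
have Xw0 : X w0 by exact: cexp_punctured_disk.
have cexp_c : continuous_pt (@cexp R) z0 by exact: smooth_continuous (smooth_cexp z0).
pose s : section_of E := fun w => \sum_k coordv z0 k (L w) *: frame_section w0 k w.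
have neg := near_Re_lt0 z00.
have gen (P : R[i] -> Prop) : (\forall w \near (w0 : R[i]^o), P w) ->
    \forall z \near (z0 : R[i]^o), P (cexp z).
  by move=> H; exact: (cexp_c _ H).
have chart : \forall z \near (z0 : R[i]^o), chart_dom E w0 (cexp z).
  exact: (cexp_c _ (chart_near E Xw0)).
exists s; split.
  apply: filterS2 L1 chart => z Lz cz; rewrite /s Lz.
  by rewrite [RHS](frame_expand _ Xw0 cz).
have main : \forall z \near (z0 : R[i]^o),
    [/\ sms s (cexp z), nabla (conn E) s (cexp z) = 0 & nablabar (conn E) s (cexp z) = 0].
  have n2 : \forall z \near (z0 : R[i]^o), \forall w \near (cexp z : R[i]^o), cexp (L w) = w /\ chart_dom E w0 w.
    have n1 : \forall w \near (w0 : R[i]^o), cexp (L w) = w /\ chart_dom E w0 w.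
      by apply: filterS2 L2 (chart_near E Xw0) => w.
    pose P (w : R[i]) := \forall u \near (w : R[i]^o), cexp (L u) = u /\ chart_dom E w0 u.
    have n1' : \forall w \near (w0 : R[i]^o), P w by exact: near_near n1.
    exact: (gen P n1').
  have n3 : \forall z \near (z0 : R[i]^o), smooth_at L (cexp z) /\ (del L (cexp z) = (cexp z)^-1 /\ delbar L (cexp z) = 0).
    exact: (cexp_c _ (filterI (smooth_near sL) dL)).
  apply: filterS3 (filterI L1 neg) n2 n3 => z [Lz z0'] n2z [sLz [dLz bLz]].
  have Xz : X (cexp z) by exact: cexp_punctured_disk.
  (* The pulled back connection at [z] is computed in the frame centred at [z], so flatness of [s]
     at [cexp z] is checked in that frame instead of the one at [z0]. *)
  pose c k w := coordv z k (L w).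
  have sc k : smooth_at (c k) (cexp z).
    by apply: (@smooth_comp _ (coordv z k)); [exact: sLz|rewrite Lz; exact: coordv_smooth].
  have dc k : del (c k) (cexp z) = (cexp z)^-1 * del (coordv z k) z /\
      delbar (c k) (cexp z) = (cj (cexp z))^-1 * delbar (coordv z k) z.
    have [-> ->] := @del_comp _ (coordv z k) L (cexp z) sLz ltac:(by rewrite Lz; exact: coordv_smooth).
    by rewrite dLz bLz Lz cj0 !mul0r addr0 add0r cjV.
  have ck k : c k (cexp z) = coordv z k z by exact: (congr1 (coordv z k) Lz).
  have fs k : sms (frame_section (cexp z) k) (cexp z).
    by apply: frame_smooth => //; exact: chart_center.
  have sce k : sms (fun w => c k w *: frame_section (cexp z) k w) (cexp z).
    exact: smsZ (sc k) (fs k).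
  have ssum : sms (fun w => \sum_k c k w *: frame_section (cexp z) k w) (cexp z).
    by apply: sms_comb => k _.
  (* Both sums are the value of [v] at [L w], transported along [cexp (L w) = w]. *)
  have sE : \forall w \near (cexp z : R[i]^o), \sum_k c k w *: frame_section (cexp z) k w = s w.
    apply: filterS2 n2z (chart_near E Xz) => w [ew cw] cw'.
    rewrite /s /c /coordv /frame_coord /=.
    by rewrite (sum_frame_coord_cast _ ew Xz cw') (sum_frame_coord_cast _ ew Xw0 cw).
  have [f1 f2] := coordv_flat z0'.
  have e0 : cexp z != 0 by exact: cexp_neq0.
  split.
  - exact: sms_eq sE ssum.
  - rewrite -(der_eq (connP E).1 Xz ssum sE) (der_sum (connP E).1 (fun c x => (del_cst c x).1) _ Xz sce).
    have := congr1 (fun u => (cexp z)^-1 *: u) f1; rewrite scaler0 scaler_sumr => f1'.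
    rewrite -[RHS]f1'; apply: eq_bigr => k _.
    rewrite (derZ (connP E).1 Xz (sc k) (fs k)) (dc k).1 scalerDr; congr (_ + _); first by rewrite scalerA.
    by rewrite ck !scalerA mulrCA mulVf// mulr1.
  - rewrite -(der_eq (connP E).2 Xz ssum sE) (der_sum (connP E).2 (fun c x => (del_cst c x).2) _ Xz sce).
    have := congr1 (fun u => (cj (cexp z))^-1 *: u) f2; rewrite scaler0 scaler_sumr => f2'.
    rewrite -[RHS]f2'; apply: eq_bigr => k _.
    rewrite (derZ (connP E).2 Xz (sc k) (fs k)) (dc k).2 scalerDr; congr (_ + _); first by rewrite scalerA.
    by rewrite ck !scalerA mulrCA mulVf ?cj_eq0// mulr1.
have Lw0 : L w0 = z0 by exact: nbhs_singleton L1.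
have cL : continuous_pt L w0 by exact: smooth_continuous.
have main' : \forall w \near (w0 : R[i]^o),
    [/\ sms s (cexp (L w)), nabla (conn E) s (cexp (L w)) = 0 &
        nablabar (conn E) s (cexp (L w)) = 0].
  by apply: (cL (fun z => [/\ sms s (cexp z), nabla (conn E) s (cexp z) = 0 &
    nablabar (conn E) s (cexp z) = 0])); rewrite Lw0.
by apply: filterS2 L2 main' => w ->.
Qed.

Definition flat_norm (z : R[i]) : R := sqnorm (v z : E (cexp z)).

Lemma flat_norm_local z0 : complex.Re z0 < 0 -> exists s : section_of E,
  [/\ sms s (cexp z0),
     \forall w \near (cexp z0 : R[i]^o), nabla (conn E) s w = 0 /\ nablabar (conn E) s w = 0,
     s (cexp z0) = v z0 &
     \forall z \near (z0 : R[i]^o), hform (s (cexp z)) (s (cexp z)) = (flat_norm z)%:C].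
Proof.
move=> z00; have [s [sv fs]] := local_flat_section z00.
have neg := near_Re_lt0 z00.
exists s; split.
- by have [] := nbhs_singleton fs.
- by apply: filterS fs => w [].
- exact: nbhs_singleton sv.
by apply: filterS2 sv neg => z -> zn; rewrite hformE//; exact: cexp_punctured_disk.
Qed.

Lemma flat_norm_smooth z : complex.Re z < 0 -> smooth_at (fun z => (flat_norm z)%:C) z.
Proof.
move=> z0; have [s [ss _ _ sE]] := flat_norm_local z0.
have Xz := cexp_punctured_disk z0.
apply: (smooth_eq sE); exact: (@smooth_comp _ (fun w => hform (s w) (s w)) _ _ (smooth_cexp z) (hform_smooth Xz ss ss)).
Qed.

Lemma flat_norm_lcurv z : complex.Re z < 0 -> 0 < flat_norm z ->
  0 <= complex.Re (lcurv (fun z => (flat_norm z)%:C) z).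
Proof.
move=> z0 n0; have [s [ss fs sv sE]] := flat_norm_local z0.
have Xz := cexp_punctured_disk z0.
have sh := hform_smooth Xz ss ss.
have sc := @smooth_comp _ (fun w => hform (s w) (s w)) _ _ (smooth_cexp z) sh.
rewrite (lcurv_eq sc sE).
rewrite (@lcurv_comp_cexp _ (fun y => hform (s y) (s y)) _ sh) ReZ mulr_ge0 ?sqr_ge0//.
have [_ H] := lcurv_flat Xz ss fs.
have : s (cexp z) != 0.
  by rewrite sv -sqnorm_eq0// gt_eqF.
by move=> /H; case: (lcurv _ _) => a b; rewrite lecE => /andP[].
Qed.

(** The derivative is twice the real part of [e * del n], and [del n = - 2 exp z h(theta v, v)].
    Cauchy-Schwarz and the bound [2 type_bound / |x|] for [exp z * theta] give the constant [8]. *)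
Lemma flat_norm_partial z (e : R[i]) : complex.Re z < 0 -> e = 1 \/ e = 'i%C ->
  `|complex.Re (partial e (fun z => (flat_norm z)%:C) z)| <=
  8 * type_bound E / `|complex.Re z| * flat_norm z.
Proof.
move=> z0 eE; have [s [ss fs sv sE]] := flat_norm_local z0.
have Xz := cexp_punctured_disk z0.
have sh := hform_smooth Xz ss ss.
have sc := @smooth_comp _ (fun w => hform (s w) (s w)) _ _ (smooth_cexp z) sh.
have [dE bE] := del_eq sc sE.
have [_ ->] := cdiff_partial e (smooth_cdiff (flat_norm_smooth z0)).
have bd : delbar (fun z => (flat_norm z)%:C) z = cj (del (fun z => (flat_norm z)%:C) z).
  have [_ <-] := del_cj (flat_norm_smooth z0).
  have E1 : \forall w \near (z : R[i]^o), (flat_norm w)%:C = cj (flat_norm w)%:C.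
    by apply: nearc => w; rewrite cj_real.
  by have [_ ->] := del_eq (flat_norm_smooth z0) E1.
rewrite bd.
have -> : del (fun z => (flat_norm z)%:C) z = cexp z * - (hform (theta (v z : E (cexp z))) (v z) *+ 2).
  rewrite dE; have [-> _] := @del_comp _ (fun w => hform (s w) (s w)) _ _ (smooth_cexp z) sh.
  have [-> ->] := del_cexp z; rewrite cj0 mul0r addr0.
  by have [-> _] := lcurv_flat Xz ss fs; rewrite sv.
have CS := sqnorm_CS (theta (v z : E (cexp z))) (v z) Xz.
have TB := theta_bound (v z : E (cexp z)) z0 erefl.
have n0 : 0 <= flat_norm z by exact: sqnorm_ge0.
have M0 : 0 <= type_bound E by rewrite addr_ge0// sumr_ge0.
rewrite -/(flat_norm z) in CS TB.
set h := hform _ _ in CS *; set x := complex.Re z in z0 TB *.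
have e2 : complex.Re (e * cj e) = 1.
  by case: eE => ->; rewrite /cj /=; ring.
have eh : complex.Re (cexp z * cj (cexp z)) = expR x ^+ 2 by rewrite cexp_norm2.
rewrite -cjM.
have -> : complex.Re (e * (cexp z * - (h *+ 2)) + cj (e * (cexp z * - (h *+ 2)))) =
    - 4 * complex.Re (e * cexp z * h).
  have -> : e * (cexp z * - (h *+ 2)) = (- 2)%:C * (e * cexp z * h).
    by rewrite rmorphN rmorph_nat -mulr_natl; ring.
  by rewrite ReD Re_cj ReZ; ring.
have K : complex.Re (e * cexp z * h) ^+ 2 <= (2 * type_bound E / `|x| * flat_norm z) ^+ 2.
  apply: le_trans (_ : expR x ^+ 2 * complex.Re (h * cj h) <= _).
    have A (u : R[i]) : complex.Re u ^+ 2 <= complex.Re (u * cj u).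
      by case: u => a b /=; rewrite mulrN opprK -expr2 lerDl -expr2 sqr_ge0.
    apply: le_trans (A _) _; rewrite le_eqVlt; apply/orP; left; apply/eqP.
    by rewrite (Re_mul_cj (e * cexp z)) (Re_mul_cj e) e2 eh mul1r.
  apply: le_trans (_ : expR x ^+ 2 * (sqnorm (theta (v z : E (cexp z))) * flat_norm z) <= _).
    by rewrite ler_wpM2l ?sqr_ge0.
  rewrite mulrA; apply: le_trans (ler_wpM2r n0 TB) _.
  rewrite le_eqVlt; apply/orP; left; apply/eqP.
  have -> : x ^+ 2 = `|x| ^+ 2 by rewrite real_normK ?num_real.
  by field; rewrite normr_eq0 lt_eqF.
have K' : `|complex.Re (e * cexp z * h)| <= 2 * type_bound E / `|x| * flat_norm z.
  rewrite -(ler_pXn2r (n := 2))// ?nnegrE ?real_normK ?num_real//.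
  by rewrite mulr_ge0// divr_ge0// mulr_ge0.
move: (complex.Re (e * cexp z * h)) K' => t K'.
have -> : `|- 4 * t| = 4 * `|t| by rewrite normrM normrN (ger0_norm (_ : 0 <= 4)).
have -> : 8 * type_bound E / `|x| * flat_norm z = 4 * (2 * type_bound E / `|x| * flat_norm z) by ring.
exact: ler_wpM2l.
Qed.

Lemma flat_norm_ge0 z : complex.Re z < 0 -> 0 <= flat_norm z.
Proof. by move=> z0; apply: sqnorm_ge0; exact: cexp_punctured_disk. Qed.

End MultivaluedFlatSections.

Lemma flat_norm_monodromy (R : realType) (E : pvhs (@punctured_disk R))
    (v : multivalued_section E) (l z : R[i]) : complex.Re z < 0 ->
  monodromy v z = l *: v z ->
  flat_norm v (z - two_pi_i R) = complex.Re (l * cj l) * flat_norm v z.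
Proof.
move=> z0 /(congr1 (fun u : E (cexp z) => sqnorm u)).
rewrite /monodromy sqnormZ; last exact: cexp_punctured_disk.
move=> <-; rewrite /flat_norm.
by case: _ / (cexp_period z).
Qed.

(** * Differential inequalities on an interval *)

Section Gronwall.
Variable R : realType.

Lemma gronwall (g A dA : R -> R) (a b : R) : a <= b ->
  (forall t, a <= t <= b -> [/\ is_derive t 1 A (dA t), derivable g t 1 &
     derive1 g t <= dA t * g t]) ->
  g b * expR (- A b) <= g a * expR (- A a).
Proof.
move=> ab H; pose f := g * (expR \o (fun t => - A t)).
have D t : a <= t <= b -> is_derive t 1 f ((derive1 g t - dA t * g t) * expR (- A t)).
  move=> /H[d1 d2 _].
  have g1 : is_derive t 1 g (derive1 g t) by rewrite derive1E; exact: derivableP.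
  have n1 : is_derive t 1 (- A) (- dA t) by exact: is_deriveN.
  have e1 : is_derive t 1 (expR \o (- A)) (expR ((- A) t) * - dA t).
    by apply: is_derive1_comp.
  apply: is_derive_eq (is_deriveM g1 e1) _.
  rewrite /GRing.scale /=; have -> : (- A) t = - A t by [].
  move: (derive1 g t) => d; ring.
have := @ler0_derive1_nincr R f a b _ _ _ a b (lexx a) ab (lexx b); apply.
- move=> t; rewrite in_itv /= => /andP[h1 h2].
  by have [] := D t; rewrite ?ltW.
- move=> t; rewrite in_itv /= => /andP[h1 h2]; have tab : a <= t <= b by rewrite !ltW.
  rewrite derive1E (@derive_val _ _ _ _ _ _ _ (D t tab)).
  by rewrite mulr_le0_ge0 ?expR_ge0// subr_le0; have [] := H t tab.
apply: derivable_within_continuous => t; rewrite in_itv /= => tab.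
by have [] := D t tab.
Qed.

Lemma gronwall_lower (g A dA : R -> R) (a b : R) : a <= b ->
  (forall t, a <= t <= b -> [/\ is_derive t 1 A (dA t), derivable g t 1 &
     dA t * g t <= derive1 g t]) ->
  g a * expR (- A a) <= g b * expR (- A b).
Proof.
move=> ab H.
have := @gronwall (fun t => - g t) A dA a b ab; rewrite !mulNr lerN2; apply => t tab.
have [d1 d2 d3] := H t tab.
have d4 : is_derive t 1 (- g) (- derive1 g t).
  by rewrite derive1E; apply: is_deriveN; exact: derivableP.
split; [exact: d1|by have [d5 _] := d4; exact: d5|].
by rewrite derive1E (@derive_val _ _ _ _ _ _ _ d4) mulrN lerN2.
Qed.

End Gronwall.

(** * Growth and boundedness for an eigenvector of the monodromy *)

Section FlatNormGrowth.
Variables (R : realType) (E : pvhs (@punctured_disk R)).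
Variables (v : multivalued_section E) (lambda : R[i]).
Hypothesis v_flat : multivalued_flat v.
Hypothesis v_eigen : forall z, half_plane z -> monodromy v z = lambda *: v z.

Local Notation n := (flat_norm v).
Let kappa : R := 8 * type_bound E.

Let kappa_gt0 : 0 < kappa.
Proof. by rewrite mulr_gt0// ltr_pwDl// sumr_ge0. Qed.

Lemma flat_norm_slice (e z : R[i]) (t : R) : e = 1 \/ e = 'i%C ->
  complex.Re (z + t%:C * e) < 0 ->
  derivable (fun s : R => n (z + s%:C * e)) t 1 /\
  `|derive1 (fun s : R => n (z + s%:C * e)) t| <=
     kappa / `|complex.Re (z + t%:C * e)| * n (z + t%:C * e).
Proof.
move=> eE zt; set y := z + t%:C * e in zt *.
have [[d _] dE] := cdiff_partial e (smooth_cdiff (flat_norm_smooth v_flat zt)).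
have E0 : (fun u : R => n (z + (u + t)%:C * e)) =
    (fun u => complex.Re (slice e (fun z => (n z)%:C) y u)).
  apply/funext => u; rewrite /slice /=; congr (n _).
  by rewrite rmorphD /= mulrDl -addrA (addrC (t%:C * e)).
have [|d1 d2] := @derivable_shift R (fun s : R => n (z + s%:C * e)) t; first by rewrite E0.
split=> //; rewrite d2 E0.
exact: (flat_norm_partial v_flat zt eE).
Qed.

Lemma flat_norm_vertical (z : R[i]) (s : R) : complex.Re z < 0 -> 0 <= s ->
  let ep := kappa / `|complex.Re z| in
  n (z + s%:C * 'i%C) <= n z * expR (ep * s) /\
  n z <= n (z + s%:C * 'i%C) * expR (ep * s).
Proof.
move=> z0 s0 ep; pose g (t : R) := n (z + t%:C * 'i%C).
have ReE (t : R) : complex.Re (z + t%:C * 'i%C) = complex.Re z by rewrite ReD ReZ /= mulr0 addr0.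
have g0 : g 0 = n z by rewrite /g mul0r addr0.
have H (t : R) : derivable g t 1 /\ `|derive1 g t| <= ep * g t.
  by have [|d] := @flat_norm_slice 'i%C z t (or_intror erefl); rewrite ReE.
have dA (c t : R) : is_derive t 1 (fun t => c * t) c.
  have := is_deriveZ c (is_derive_id t 1); rewrite /GRing.scale /= mulr1; exact.
split.
  have := @gronwall R g (fun t => ep * t) (fun=> ep) 0 s s0.
  rewrite mulr0 oppr0 expR0 mulr1 g0 => K.
  rewrite -ler_pdivrMr ?expR_gt0// -expRN; apply: K => t _; split=> //; have [h1 h2] := H t => //.
  exact: le_trans (ler_norm _) h2.
have := @gronwall_lower R g (fun t => - ep * t) (fun=> - ep) 0 s s0.
rewrite mulr0 oppr0 expR0 mulr1 g0 mulNr opprK; apply => t _; split=> //; have [h1 h2] := H t => //.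
by rewrite mulNr lerNl; apply: le_trans h2; rewrite -normrN ler_norm.
Qed.

(** Integrating [kappa / |t|] gives a logarithm, so along a horizontal line the norm changes at most
    by the power [kappa] of [|t|], in either direction. *)
Lemma flat_norm_horizontal (z : R[i]) (a b : R) : complex.Re z = 0 ->
  a <= b -> b < 0 ->
  n (z + a%:C) * expR (- (kappa * ln (- a))) <= n (z + b%:C) * expR (- (kappa * ln (- b))) /\
  n (z + b%:C) * expR (kappa * ln (- b)) <= n (z + a%:C) * expR (kappa * ln (- a)).
Proof.
move=> z0 ab b0; pose g (t : R) := n (z + t%:C * 1).
have ReE (t : R) : complex.Re (z + t%:C * 1) = t by rewrite mulr1 ReD z0 add0r.
have H (t : R) : t < 0 -> derivable g t 1 /\ `|derive1 g t| <= kappa / `|t| * g t.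
  by move=> t0; have [|d] := @flat_norm_slice 1 z t (or_introl erefl); rewrite ReE.
have dL (c t : R) : t < 0 -> is_derive t 1 (fun t => c * ln (- t)) (c / t).
  move=> t0.
  have n1 : is_derive t 1 (- @id R) (- 1) by apply: is_deriveN; exact: is_derive_id.
  have t0' : 0 < (- @id R) t by rewrite /= oppr_gt0.
  have l1 : is_derive t 1 (@ln R \o (- @id R)) (((- @id R) t)^-1 * -1).
    by apply: is_derive1_comp; exact: is_derive1_ln.
  apply: is_derive_eq (is_deriveZ c l1) _.
  rewrite /GRing.scale /=; have -> : (- @id R) t = - t by [].
  by rewrite invrN; ring.
have gE (t : R) : g t = n (z + t%:C) by rewrite /g mulr1.
rewrite -!gE; split.
  have := @gronwall_lower R g (fun t => kappa * ln (- t)) (fun t => kappa / t) a b ab.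
  apply => t /andP[_ tb]; have t0 := le_lt_trans tb b0; have [h1 h2] := H t t0.
  split; [exact: dL|exact: h1|].
  have -> : kappa / t = - (kappa / `|t|) by rewrite ltr0_norm// invrN mulrN opprK.
  by rewrite mulNr lerNl; apply: le_trans h2; rewrite -normrN ler_norm.
have := @gronwall R g (fun t => - kappa * ln (- t)) (fun t => - kappa / t) a b ab.
rewrite !mulNr !opprK; apply => t /andP[_ tb]; have t0 := le_lt_trans tb b0; have [h1 h2] := H t t0.
split; [|exact: h1|].
  by have := dL (- kappa) t t0; rewrite (_ : (fun t => - kappa * ln (- t)) =
      (fun t => - (kappa * ln (- t))))//; apply/funext => u; rewrite mulNr.
have -> : - kappa / t = kappa / `|t| by rewrite ltr0_norm// invrN mulrN mulNr.
exact: le_trans (ler_norm _) h2.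
Qed.

Let Lam := complex.Re (lambda * cj lambda).

Let n_shift z : complex.Re z < 0 -> n (z - two_pi_i R) = Lam * n z.
Proof. by move=> z0; exact: flat_norm_monodromy z0 (v_eigen z0). Qed.

Lemma eigenvalue_norm1 : (exists2 z, half_plane z & v z != 0) -> Lam = 1.
Proof.
move=> [z0 hz0 vz0].
have z00 : complex.Re z0 < 0 by [].
have nz0 : 0 < n z0 by apply: sqnorm_gt0 => //; exact: cexp_punctured_disk.
set x0 := complex.Re z0 in z00; pose iy : R[i] := (0 +i* complex.Im z0)%C.
have z0E : z0 = iy + x0%:C.
  by rewrite /iy /x0; case: (z0) => a b; apply/eqP; rewrite eq_complex /= add0r addr0 !eqxx.
(* Only [v z0] is known to be nonzero; the horizontal estimate carries positivity to all points on
   the left of [z0]. *)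
have pos (x : R) : x <= x0 -> 0 < n (iy + x%:C).
  move=> xx0; have [_] := @flat_norm_horizontal iy x x0 erefl xx0 z00.
  rewrite -z0E => H.
  have : 0 < n (iy + x%:C) * expR (kappa * ln (- x)).
    by apply: lt_le_trans H; rewrite mulr_gt0// expR_gt0.
  by rewrite pmulr_lgt0 ?expR_gt0.
have bound (x : R) : x <= x0 -> 0 < Lam /\ `|ln Lam| * `|x| <= kappa * (2 * pi).
  move=> xx0; have xn := le_lt_trans xx0 z00; have nx := pos x xx0.
  set z := iy + x%:C in nx.
  have zx : complex.Re z = x by rewrite /z /= add0r.
  have zn : complex.Re z < 0 by rewrite zx.
  have zn' : complex.Re (z - two_pi_i R) < 0 by rewrite ReB zx /= subr0.
  have pi0 : 0 <= 2 * pi :> R by rewrite mulr_ge0// pi_ge0.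
  have [] := flat_norm_vertical zn' pi0.
  have -> : z - two_pi_i R + (2 * pi)%:C * 'i%C = z.
    have -> : (2 * pi)%:C * 'i%C = two_pi_i R :> R[i].
      by apply/eqP; rewrite /two_pi_i eq_complex /=; apply/andP; split; apply/eqP; ring.
    by rewrite subrK.
  rewrite n_shift// ReB zx /= subr0; set c := kappa / `|x| * (2 * pi) => H1 H2.
  have L0 : 0 < Lam.
    have : 0 < Lam * n z * expR c by apply: lt_le_trans H1.
    by rewrite pmulr_lgt0 ?expR_gt0// pmulr_lgt0.
  split=> //.
  have x1 : 0 < `|x| by rewrite normr_gt0 lt_eqF.
  rewrite -ler_pdivlMr//.
  have -> : kappa * (2 * pi) / `|x| = c by rewrite /c; field; rewrite gt_eqF.
  rewrite ler_norml; apply/andP; split.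
    rewrite -(expRK (- c)) ler_ln ?posrE ?expR_gt0//.
    rewrite expRN -(ler_pM2r nx) mulrC ler_pdivrMr ?expR_gt0//.
  rewrite -(expRK c) ler_ln ?posrE ?expR_gt0//.
  by rewrite -(ler_pM2r nx) (mulrC (expR c)).
have [L0 _] := bound x0 (lexx _).
have l0 : ln Lam = 0.
  apply/eqP/negPn/negP => ln0.
  have ln1 : 0 < `|ln Lam| by rewrite normr_gt0.
  (* Far enough left that [|ln Lam| * u] exceeds the bound by at least [1]. *)
  pose u := Num.max (- x0) ((kappa * (2 * pi) + 1) / `|ln Lam|).
  have [|_] := bound (- u); first by rewrite lerNl le_max lexx.
  have u0 : 0 < u by rewrite lt_max oppr_gt0 z00.
  rewrite normrN (gtr0_norm u0).
  have : (kappa * (2 * pi) + 1) / `|ln Lam| <= u by rewrite le_max lexx orbT.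
  rewrite ler_pdivrMr// (mulrC u); lra.
by rewrite -[LHS]lnK ?posrE// l0 expR0.
Qed.

Hypothesis Lam1 : Lam = 1.

Let n_period z : complex.Re z < 0 -> n (z - two_pi_i R) = n z.
Proof. by move=> z0; rewrite n_shift// Lam1 mul1r. Qed.

Lemma n_strip z : complex.Re z < 0 -> exists z',
  [/\ complex.Re z' = complex.Re z, 0 <= complex.Im z' <= 2 * pi & n z' = n z].
Proof. by move=> z0; apply: fundamental_strip => u uz; apply: n_period; rewrite uz. Qed.

(** By periodicity one period suffices: the vertical estimate covers [Re z = -1] and gives [M], the
    horizontal one then moves left. Rounding [kappa] up to a natural number provides an exponent fit
    for [lcurvX]. *)
Lemma flat_norm_polynomial_growth : exists M (k : nat), 0 <= M /\
  forall z, complex.Re z <= -1 -> n z <= M * (- complex.Re z) ^+ k.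
Proof.
pose M := n (-1)%:C * expR (kappa * (2 * pi)).
have [k kP] : exists k : nat, kappa < k%:R.
  by exists (Num.bound kappa); apply: archi_boundP; exact: ltW.
have m1 : -1 < 0 :> R by rewrite oppr_lt0.
have M0 : 0 <= M by rewrite mulr_ge0 ?expR_ge0// flat_norm_ge0.
exists M, k; split=> // z zx; set x := complex.Re z in zx *.
have zn : complex.Re z < 0 by exact: le_lt_trans zx m1.
have [z' [r1 /andP[i1 i2] <-]] := n_strip zn.
rewrite -/x in r1; pose iy : R[i] := (0 +i* complex.Im z')%C.
have zE : z' = iy + x%:C.
  by rewrite -r1 /iy; case: (z') => a b; apply/eqP; rewrite eq_complex /= add0r addr0 !eqxx.
have [H _] := @flat_norm_horizontal iy x (-1) erefl zx m1.
rewrite opprK ln1 mulr0 oppr0 expR0 mulr1 expRN ler_pdivrMr ?expR_gt0// -zE in H.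
have H2 : n (iy + (-1)%:C) <= M.
  have [V _] := @flat_norm_vertical (-1)%:C (complex.Im z') m1 i1.
  have e1 : iy + (-1)%:C = (-1)%:C + (complex.Im z')%:C * 'i%C.
    by apply/eqP; rewrite eq_complex /= !(mul0r, mulr0, mulr1, subr0, add0r, addr0) !eqxx.
  rewrite e1; apply: le_trans V _.
  rewrite /= normrN normr1 divr1 ler_wpM2l ?flat_norm_ge0// ler_expR ler_wpM2l// ltW//.
apply: le_trans H _; apply: ler_pM => //.
  by apply: flat_norm_ge0; rewrite ReD /= add0r.
have u1 : 1 <= - x by rewrite lerNr.
have u0 : 0 < - x by exact: lt_le_trans u1.
have -> : (- x) ^+ k = expR (k%:R * ln (- x)) by rewrite expRM_natl lnK.
by rewrite ler_expR ler_wpM2r ?ln_ge0// ltW.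
Qed.

Lemma flat_norm_bounded : exists M : R, forall z, complex.Re z <= -1 -> n z <= M.
Proof.
have [M [k [M0 growth]]] := flat_norm_polynomial_growth.
exists (M * 2 ^+ k.+1).
have m1 : -1 < 0 :> R by rewrite oppr_lt0.
(* [- log (1 - d x)] is strictly subharmonic, so [n / (1 - d x) ^ (k + 1)] has
   no interior maximum; it is small at [x = - L] for large [L]. *)
suff key (d L : R) : 0 < d -> d <= 1 -> 1 < L -> L ^+ k <= (1 + d * L) ^+ k.+1 ->
    forall z, - L <= complex.Re z <= -1 -> n z <= M * (1 - d * complex.Re z) ^+ k.+1.
  move=> z zx; set x := complex.Re z in zx *.
  have u0 : 0 < - x by lra.
  (* With this [d] the factor [1 - d x] equals [2], whence the constant [M * 2 ^+ k.+1]. *)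
  pose d := (- x)^-1; have d0 : 0 < d by rewrite invr_gt0.
  have d1 : d <= 1 by rewrite invf_le1//; lra.
  (* Large enough for [x] to lie in the strip and for [d ^+ k.+1 * L >= 1], which yields
     [L ^+ k <= (d * L) ^+ k.+1]. *)
  pose L := 1 + - x + (d ^+ k.+1)^-1.
  have D0 : 0 < d ^+ k.+1 by rewrite exprn_gt0.
  have Di : 0 < (d ^+ k.+1)^-1 by rewrite invr_gt0.
  have L1 : 1 < L by rewrite /L; lra.
  have L0 : 0 < L by exact: lt_trans L1.
  have LP : L ^+ k <= (1 + d * L) ^+ k.+1.
    apply: le_trans (_ : (d * L) ^+ k.+1 <= _); last first.
      by rewrite lerXn2r ?nnegrE ?addr_ge0 ?mulr_ge0 ?ltW// ltr_pwDl.
    rewrite exprMn (exprS L) mulrA (ler_peMl (exprn_ge0 _ (ltW L0)))//.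
    by rewrite -ler_pdivrMl// mulr1 /L; lra.
  have := key d L d0 d1 L1 LP z; rewrite -/x.
  have -> : 1 - d * x = 2 by rewrite -mulrN /d mulVf ?gt_eqF// -natr1.
  by apply; apply/andP; split=> //; rewrite /L; lra.
move=> d0 d1 L1 LP.
pose m := k.+1; pose P z := (1 - d * complex.Re z) ^+ m.
have P0 z : complex.Re z < 0 -> 0 < 1 - d * complex.Re z.
  by move=> z0; have := mulr_gt0 d0 (_ : 0 < - complex.Re z); rewrite oppr_gt0 mulrN => /(_ z0); lra.
pose Pc z := affine_Re 1 (- d) z ^+ m.
have PE z : Pc z = (P z)%:C by rewrite /Pc /affine_Re -rmorphXn /= mulNr.
have sP z : smooth_at Pc z by exact: smoothX (smooth_affine_Re _ _ _).
pose K := crect (- L) (-1) 0 (2 * pi).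
have Kneg z : K z -> complex.Re z < 0 by move=> [/andP[_ h] _]; exact: le_lt_trans h m1.
pose f (z : R[i]^o) := n z / P z.
have [z0 Kz0 mx] : exists2 z0, z0 \in K & forall z, z \in K -> f z <= f z0.
  apply: compact_EVT_max; [|exact: crect_compact|].
    by exists (-1)%:C; rewrite /K /crect /= lexx mulr_ge0 ?pi_ge0// lexx lerN2 ltW.
  apply: continuous_in_subspaceT => z; rewrite inE => /Kneg z0.
  have c1 := smooth_continuous (flat_norm_smooth v_flat z0).
  have Pz : Pc z != 0.
    by rewrite PE eq_complex /= eqxx andbT expf_neq0// gt_eqF// P0.
  have c2 := continuous_ptM c1 (continuous_ptV Pz (smooth_continuous (sP z))).
  move=> A /nbhs_ballP[e /= e0 eA].
  move/continuous_ptP : c2 => /(_ e e0); apply: filterS => w [+ _] => h.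
  by apply: eA; rewrite /ball /= distrC; move: h; rewrite !PE -!fmorphV -!rmorphM -rmorphB /=.
rewrite inE in Kz0; have z0n := Kneg _ Kz0; have Pz0 := exprn_gt0 m (P0 _ z0n).
rewrite -/(P z0) in Pz0.
pose c := f z0.
have c0 : 0 <= c by rewrite divr_ge0 ?flat_norm_ge0// ltW.
(* Both [n] and [P] are periodic, so the maximum over one period bounds the whole strip and only its
   vertical sides count as boundary. *)
have B z : - L <= complex.Re z <= -1 -> n z <= c * P z.
  move=> zL; have zn : complex.Re z < 0 by move: zL => /andP[_ h]; exact: le_lt_trans h m1.
  have [z' [r1 i1 <-]] := n_strip zn.
  have -> : P z = P z' by rewrite /P r1.
  rewrite -ler_pdivrMr; last by rewrite exprn_gt0// P0// r1.
  by apply: mx; rewrite inE; split=> //; rewrite r1.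
suff cM : c <= M.
  move=> z zL; apply: le_trans (B z zL) _; rewrite ler_wpM2r// ltW// exprn_gt0// P0//.
  by move: zL => /andP[_ h]; exact: le_lt_trans h m1.
have eqc : n z0 = c * P z0 by rewrite /c /f divfK// gt_eqF.
have [cp|c00] := ltP 0 c; last exact: le_trans c00 M0.
case: (Kz0) => /andP[h1 h2] _.
rewrite leNgt; apply/negP => Mc.
(* On the right side the growth bound gives [n z0 <= M], while [P z0 >= 1]; this contradicts
   [M < c]. *)
have x1 : complex.Re z0 < -1.
  rewrite lt_neqAle h2 andbT; apply/eqP => e1.
  have := growth z0 h2; rewrite eqc e1 opprK expr1n mulr1.
  have : 1 <= P z0 by rewrite /P e1 exprn_ege1//; lra.
  by nra.
(* On the left side [n z0 <= M * L ^+ k <= M * P z0] by the choice of [L], again against [M < c]. *)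
have x2 : - L < complex.Re z0.
  rewrite lt_neqAle h1 andbT; apply/eqP => e1.
  have := growth z0 h2; rewrite eqc -e1 opprK.
  have : L ^+ k <= P z0 by rewrite /P -e1 mulrN opprK.
  by nra.
have nn0 : 0 < n z0 by rewrite eqc mulr_gt0.
have sn := flat_norm_smooth v_flat z0n.
have cn0 : c%:C != 0 by rewrite eq_complex /= eqxx andbT gt_eqF.
have an0 : affine_Re 1 (- d) z0 != 0.
  by rewrite /affine_Re eq_complex /= eqxx andbT mulNr gt_eqF// P0.
have H1 : \forall z \near (z0 : R[i]^o), (n z)%:C <= c%:C * Pc z.
  apply/nbhs_box; exists (Num.min (complex.Re z0 + L) (-1 - complex.Re z0)).
    by rewrite lt_min; apply/andP; split; lra.
  move=> z; rewrite lt_min ReB => /andP[]; rewrite !ltr_norml => /andP[k1 k2] /andP[k3 k4] _.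
  rewrite PE -rmorphM lecR; apply: B; apply/andP; split; lra.
have H2 : (n z0)%:C = c%:C * Pc z0 by rewrite PE -rmorphM eqc.
have H3 : 0 < (n z0)%:C :> R[i] by rewrite ltcR.
(* At an interior point of contact the log-curvature of [n], which is nonnegative, would be at most
   that of [c P], which is strictly negative. *)
have := lcurv_le sn (smoothM (smooth_cst c%:C z0) (sP z0)) H1 H2 H3.
have := flat_norm_lcurv v_flat z0n nn0.
move: (complex.Re (lcurv (fun z => (n z)%:C) z0)) => q q0.
rewrite (lcurvM (smooth_cst _ _) (sP z0) cn0) ?expf_neq0// lcurv_cst add0r.
rewrite (lcurvX m (smooth_affine_Re _ _ _) an0) lcurv_affine_Re.
rewrite -(rmorph_nat (real_complex R)) ReZ /=.
have : 0 < (- d / (1 + - d * complex.Re z0)) ^+ 2.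
  rewrite exprn_even_gt0//=; apply: mulf_neq0; first by rewrite oppr_eq0 gt_eqF.
  by rewrite invr_eq0 mulNr gt_eqF// P0.
have m0 : 0 < m%:R :> R by rewrite ltr0n.
move: ((- d / _) ^+ 2) (m%:R : R) m0 => s t t0 s0 qle.
have := mulr_gt0 t0 s0; lra.
Qed.

End FlatNormGrowth.

Theorem mainTheorem4 (R : realType) (E : pvhs (@punctured_disk R))
    (v : multivalued_section E) (lambda : R[i])
    (v_flat : multivalued_flat v)
    (v_neq0 : exists2 z, half_plane z & v z != 0)
    (v_eigen : forall z, half_plane z -> monodromy v z = lambda *: v z) :
  exists M r : R, forall z : R[i],
    half_plane z -> r <= `|complex.Re z| -> log_norm v z <= M.
Proof.
have L1 := eigenvalue_norm1 v_flat v_eigen v_neq0.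
have [M bnd] := flat_norm_bounded v_flat v_eigen L1.
(* [ln] takes the value [0] at nonpositive arguments; raising [M] to at least [1] makes the bound
   cover that value too. *)
exists (ln (Num.max 1 M)), 1 => z hz; rewrite ltr0_norm// => z1.
have M1 : 1 <= Num.max 1 M by rewrite le_max lexx.
have nM : flat_norm v z <= Num.max 1 M.
  by apply: le_trans (bnd z _) _; [rewrite lerNr|rewrite le_max lexx orbT].
rewrite /log_norm -[complex.Re _]/(flat_norm v z).
have [n0|n0] := ltP 0 (flat_norm v z); last by rewrite ln0// ln_ge0.
by rewrite ler_ln// posrE (lt_le_trans _ M1).
Qed.
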